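(* Let $D$ be a bounded convex domain in $\mathbb{C}^n$ with $\mathcal{C}^\infty$ boundary $\partial D$. Assume that $\partial D$ contains an analytic disk, i.e. there is a non-constant holomorphic map $\phi:\Delta\to\mathbb{C}^n$ with $\phi(\Delta)\subset\partial D$. Then the metric space $(D,d_D^K)$ is not Gromov hyperbolic.
   Context: $\Delta=\{\zeta\in\mathbb{C}:|\zeta|<1\}$. Kobayashi metric. For a domain $D\subset\mathbb{C}^n$, $p\in D$, $v\in\mathbb{C}^n$, set $K_D(p,v)=\inf\{\alpha>0 : \exists f:\Delta\to D \text{ holomorphic},\ f(0)=p,\ f'(0)=v/\alpha\}$. The Kobayashi pseudodistance is $d_D^K(p,q)=\inf\int_0^1K_D(\gamma(t),\gamma'(t))\,dt$, the infimum being over all $\mathcal{C}^1$ paths $\gamma:[0,1]\to D$ with $\gamma(0)=p$, $\gamma(1)=q$. For a bounded domain it is a distance. Gromov hyperbolicity. Let $(X,d)$ be a metric space. A curve $\gamma:[a,b]\to X$ is a geodesic if $d(\gamma(t_1),\gamma(t_2))=|t_1-t_2|$ for all $t_1,t_2\in[a,b]$. A geodesic triangle is a union of images of three geodesics $\gamma_i:[a_i,b_i]\to X$, $i=1,2,3$, with $\gamma_i(b_i)=\gamma_{i+1}(a_{i+1})$ (indices modulo $3$); the images of the $\gamma_i$ are its sides. $(X,d)$ is Gromov hyperbolic if there is $\delta>0$ such that for every geodesic triangle in $X$ each side is contained in the $\delta$-neighbourhood of the union of the other two sides. *)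

(* Defs.v *)
From HB Require Import structures.
From mathcomp Require Import all_boot all_order all_algebra.
From mathcomp Require Import complex.
From mathcomp Require Import all_classical all_reals all_analysis.

Set Implicit Arguments.
Unset Strict Implicit.
Unset Printing Implicit Defensive.

Import Order.TTheory GRing.Theory Num.Theory.
Import numFieldNormedType.Exports.

Local Open Scope ring_scope.
Local Open Scope classical_set_scope.
Local Open Scope complex_scope.

(* Same pattern as [numFieldNormedType]: [R[i]] with the topology and the normed
   module structure (over itself) given by the modulus. *)
Section ComplexNormed.
Variable R : rcfType.
#[non_forgetful_inheritance]
HB.instance Definition _ := PseudoPointedMetric.copy R[i] R[i]^o.
#[non_forgetful_inheritance]
HB.instance Definition _ := NormedModule.copy R[i] R[i]^o.
End ComplexNormed.

Section Gromov.
Context {R : realType} {T : Type}.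
Implicit Types (X A : set T) (d : T -> T -> R).

Definition geodesic X d (a b : R) (g : R -> T) : Prop :=
  [/\ a <= b, g @` `[a, b] `<=` X &
      {in `[a, b] &, forall t1 t2, d (g t1) (g t2) = `|t1 - t2|}].

Definition geodesic_triangle X d (a b : 'I_3 -> R) (g : 'I_3 -> R -> T) : Prop :=
  (forall i, geodesic X d (a i) (b i) (g i)) /\
  (forall i, g i (b i) = g (ordS i) (a (ordS i))).

Definition side (a b : 'I_3 -> R) (g : 'I_3 -> R -> T) (i : 'I_3) : set T :=
  g i @` `[a i, b i].

Definition neighbourhood X d (delta : R) A : set T :=
  [set x | X x /\ exists2 y, A y & d x y < delta].

Definition gromov_hyperbolic X d : Prop :=
  exists2 delta : R, 0 < delta &
    forall a b g, geodesic_triangle X d a b g -> forall i,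
      side a b g i `<=`
      neighbourhood X d delta (\bigcup_(j in [set j | j != i]) side a b g j).

End Gromov.

(* ['rV[R[i]]_n] only carries a normed module structure over [R[i]]; real
   differential calculus on it goes through the identification C^n = R^(2n). *)
Section Realification.
Context {R : realType} {n : nat}.

Definition realify (z : 'rV[R[i]]_n) : 'rV[R]_(n + n) :=
  row_mx (map_mx (@complex.Re R) z) (map_mx (@complex.Im R) z).

Definition complexify (w : 'rV[R]_(n + n)) : 'rV[R[i]]_n :=
  \row_j (lsubmx w 0 j +i* rsubmx w 0 j).

Lemma realifyK : cancel realify complexify.
Proof.
move=> z; apply/rowP => j.
by rewrite mxE row_mxKl row_mxKr !mxE; case: (z 0 j).
Qed.

Lemma complexifyK : cancel complexify realify.
Proof.
move=> w; rewrite -[RHS]hsubmxK /realify; congr row_mx;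
  by apply/rowP => j; rewrite !mxE.
Qed.

End Realification.

Section Smooth.
Context {R : realType} {V : normedModType R}.

Definition iter_derive (s : seq V) (f : V -> R) : V -> R :=
  foldr (fun v g => 'D_v g) f s.

(* C^infinity on an open set U: every iterated directional derivative exists and
   is continuous on U. *)
Definition smooth_on (U : set V) (f : V -> R) : Prop :=
  forall s x, U x -> {for x, continuous (iter_derive s f)} /\
    forall v, derivable (iter_derive s f) x v.

End Smooth.

Section SeveralComplexVariables.
Context {R : realType}.

Definition unit_disc : set R[i] := [set z | `|z| < 1].

Definition holomorphic_disc n (f : R[i] -> 'rV[R[i]]_n) : Prop :=
  forall z, unit_disc z -> derivable f z 1.

Section Domain.
Context {n : nat}.
Implicit Types (D : set 'rV[R[i]]_n).

Definition domain D : Prop := [/\ open D, connected D & D !=set0].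

(* [0 <= l <= 1] in [R[i]] forces [l] to be real, so convexity over the field
   [R[i]] is ordinary convexity of the underlying real space: see [convexP]. *)
Definition convex D : Prop := convex_set (D : set (convex_lmodType 'rV[R[i]]_n)).

Lemma convexP D : convex D <->
  forall x y (t : R), 0 <= t <= 1 -> D x -> D y ->
    D (t%:C *: x + (1 - t)%:C *: y).
Proof.
split=> [h x y t /andP[t0 t1] Dx Dy|h x y l].
  have T0 : 0 <= (t%:C : R[i]) by rewrite lecR.
  have T1 : (t%:C : R[i]) <= 1 by rewrite lecR.
  have := h x y (Itv01 T0 T1); rewrite !inE => /(_ Dx Dy).
  by rewrite /conv /= rmorphB.
rewrite !inE => Dx Dy; rewrite /conv /=; set c : R[i] := l%:num.
have c0 : 0 <= c by apply: (@ge0 _ _ l).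
have c1 : c <= 1 by apply: (@le1 _ _ l).
have e : c = (complex.Re c)%:C by rewrite RRe_real //; apply: ger0_real.
move: c0 c1; rewrite e => c0 c1.
have := h x y (complex.Re c); rewrite -lecR c0 -lecR c1 => /(_ isT Dx Dy).
by rewrite rmorphB.
Qed.

Definition boundary D : set 'rV[R[i]]_n := closure D `\` D^°.

(* Local defining functions: near each boundary point D is [rho < 0] with [rho]
   real-smooth and [d rho != 0]. *)
Definition smooth_boundary D : Prop :=
  forall p, boundary D p ->
    exists (U : set 'rV[R[i]]_n) (rho : 'rV[R[i]]_n -> R),
    [/\ open U /\ U p,
        smooth_on (complexify @^-1` U) (rho \o complexify),
        exists v, 'D_v (rho \o complexify) (realify p) != 0 &
        D `&` U = [set z | rho z < 0] `&` U].

Definition kobayashi_metric D (p v : 'rV[R[i]]_n) : \bar R :=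
  ereal_inf [set alpha%:E | alpha in [set alpha : R | 0 < alpha /\
    exists f : R[i] -> 'rV[R[i]]_n,
      [/\ holomorphic_disc f, f @` unit_disc `<=` D,
          f 0 = p & f^`() 0 = (alpha^-1)%:C *: v]]].

Definition path_derive (g : R -> 'rV[R[i]]_n) (t : R) : 'rV[R[i]]_n :=
  complexify ((realify \o g)^`()%classic t).

(* A C^1 path on [0, 1] (one-sided derivatives at 0 and 1) extends to a C^1
   function on the line; only the values of [g] on [0, 1] are constrained by D
   or enter the length. *)
Definition C1_path D (p q : 'rV[R[i]]_n) (g : R -> 'rV[R[i]]_n) : Prop :=
  [/\ forall t, derivable (realify \o g) t 1,
      continuous ((realify \o g)^`()),
      g @` `[0, 1] `<=` D, g 0 = p & g 1 = q].

Definition kobayashi_length D (g : R -> 'rV[R[i]]_n) : \bar R :=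
  (\int[@lebesgue_measure R]_(t in `[0%R, 1%R])
     kobayashi_metric D (g t) (path_derive g t))%E.

(* The infimum is finite when D is a domain and p, q are in D, so [fine] only
   changes its type. *)
Definition kobayashi_dist D (p q : 'rV[R[i]]_n) : R :=
  fine (ereal_inf [set kobayashi_length D g | g in C1_path D p q]).

Definition contains_analytic_disc (A : set 'rV[R[i]]_n) : Prop :=
  exists phi : R[i] -> 'rV[R[i]]_n,
    [/\ holomorphic_disc phi, phi @` unit_disc `<=` A &
        exists z w, [/\ unit_disc z, unit_disc w & phi z != phi w]].

End Domain.
End SeveralComplexVariables.

(* Main.v *)
Require Import Defs.
From mathcomp Require Import all_boot all_order all_algebra.
From mathcomp Require Import complex ring lra.
From mathcomp Require Import all_classical all_reals all_analysis.
Import numFieldNormedType.Exports.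
Import Order.TTheory GRing.Theory Num.Theory.
Local Open Scope ring_scope.
Local Open Scope classical_set_scope.
Local Open Scope complex_scope.

Set Implicit Arguments.
Unset Strict Implicit.
Unset Printing Implicit Defensive.

(** The proof compares two families of points that approach the boundary along two
    parallel normals, based at points of a flat piece of the boundary.

    Convexity makes the Kobayashi metric a continuous Finsler norm
    ([kob_continuous]). All lower bounds come from the Schwarz-Pick inequality for
    the half-plane ([halfplane_schwarz]): since [D] lies in half-spaces, half the
    logarithm of the distance to a hyperplane that misses [D] is 1-Lipschitz
    ([dist_log_lb]). In particular boundary points are at infinite distance, closed
    balls are compact, and any two points are joined by a geodesic
    ([kobayashi_geodesic]); so the thin triangle condition has content. The
    inequality is derived from Goursat's lemma ([goursat]), through the mean value
    property ([mean_value]).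

    Smoothness provides a ball inside [D] tangent at each boundary point
    ([smooth_inner_ball]); its normal is the unique supporting direction. Schwarz-Pick
    also shows that the tangent discs of an analytic disc in the boundary are
    contained in [closure D] ([tangent_disc_closure]). Rescaling such a disc yields
    two boundary points [xi] and [eta = xi + e] with the same inner normal [nu], such
    that [e] is a complex tangent direction, the affine disc of radius [5 / 6] about
    [xi] in the direction [e] lies in [closure D], and the ray from [xi] leaves
    [closure D] at [eta] ([boundary_face]).

    Let [x] and [y] be the points at Euclidean height [t] above [xi] and [eta] along
    [nu], and let [b] be minus half the logarithm of the distance to the common
    supporting hyperplane. Both points have [b = - ln t / 2], and both families climb
    at unit speed up to a constant, by the round discs in the tangent balls
    ([dist_normal]). Three facts are incompatible.

    - The distance of [x] and [y] is at most [3 / 2 * b] plus a constant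
      ([dist_across]): above [xi] there are discs of fixed radius in the direction
      [e], above [eta] discs of radius of order [sqrt t].
    - In a Gromov hyperbolic space two such families fellow-travel as soon as the
      factor is less than 2 ([fellow_travel]); so the distance stays bounded.
    - The distance is unbounded ([dist_across_unbounded]): a half-space that
      contains [D] and cuts off a point just beyond [eta] has a boundary much closer
      to [eta] than to [xi]. *)

(** * Integrals over segments and repeated bisection *)

Section SegmentIntegral.
Variable R : realType.
Implicit Types (f g : R -> R) (a b c : R).

Definition seg_int f a b : R := (\int[@lebesgue_measure R]_(x in `[a, b]) f x)%R.

Definition cont_seg f a b := forall x, a <= x <= b -> {for x, continuous f}.

Lemma cont_segW f a b c d : a <= c -> d <= b -> cont_seg f a b -> cont_seg f c d.
Proof.
move=> ac db h x /andP[cx xd]; apply: h.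
by rewrite (le_trans ac cx) (le_trans xd db).
Qed.

Lemma cont_seg_within f a b : cont_seg f a b -> {within `[a, b], continuous f}.
Proof.
by move=> h; apply: continuous_in_subspaceT => x /[1!inE]/=; rewrite in_itv/=; apply: h.
Qed.

Lemma cont_seg_integrable f a b : cont_seg f a b ->
  (@lebesgue_measure R).-integrable `[a, b] (EFin \o f).
Proof.
move=> h; apply: continuous_compact_integrable; first exact: segment_compact.
exact: cont_seg_within.
Qed.

Lemma seg_intB f g a b : cont_seg f a b -> cont_seg g a b ->
  seg_int (fun x => f x - g x) a b = seg_int f a b - seg_int g a b.
Proof. by move=> cf cg; rewrite /seg_int RintegralB//; exact: cont_seg_integrable. Qed.

Lemma seg_intZ f a b c : cont_seg f a b ->
  seg_int (fun x => c * f x) a b = c * seg_int f a b.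
Proof. by move=> cf; rewrite /seg_int RintegralZl//; exact: cont_seg_integrable. Qed.

Lemma seg_int_cst a b c : a <= b -> seg_int (fun=> c) a b = c * (b - a).
Proof.
move=> ab; rewrite /seg_int Rintegral_cst//= lebesgue_measure_itv/= lte_fin.
by case: ltgtP ab => //= -> _; rewrite subrr.
Qed.

Lemma seg_int_split f a b c : a <= c <= b -> cont_seg f a b ->
  seg_int f a b = seg_int f a c + seg_int f c b.
Proof.
move=> /andP[ac cb] cf.
have := @Rintegral_itvB _ f (BLeft a) (BRight b) c (cont_seg_integrable cf).
rewrite !bnd_simp => /(_ ac cb) h.
apply/eqP; rewrite addrC -subr_eq /seg_int h; apply/eqP.
by rewrite Rintegral_itv_obnd_cbnd//; apply: (integrableS _ _ _ (cont_seg_integrable (cont_segW ac (lexx b) cf))) => //;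
  apply: subset_itvr; rewrite bnd_simp.
Qed.

Lemma seg_int_bound f a b c e : a <= b -> cont_seg f a b ->
  (forall x, a <= x <= b -> `|f x - c| <= e) ->
  `|seg_int f a b - c * (b - a)| <= e * (b - a).
Proof.
move=> ab cf h.
rewrite -(seg_int_cst c ab) -seg_intB//; last by move=> x _; exact: cst_continuous.
have cfc : cont_seg (fun x => f x - c) a b.
  by move=> x xab; apply: continuousB; [exact: cf|exact: cst_continuous].
apply: le_trans (le_normr_Rintegral _ (cont_seg_integrable cfc)) _ => //.
rewrite -(seg_int_cst e ab); apply: le_Rintegral => //.
- by apply: cont_seg_integrable => x xab; apply: continuous_comp; [exact: cfc|exact: norm_continuous].
- by apply: cont_seg_integrable => x xab; exact: cst_continuous.
Qed.

End SegmentIntegral.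

Section Bisection.
Variable R : realType.
Implicit Types (W : R -> R -> R -> R -> R).

(** Cut the rectangle in four and keep a quarter that carries at least a quarter of
    the value of [W]. The quarters shrink to a point, where [W] is small compared
    with the square of the diameter, while the diameter is only halved each time;
    so the original value is arbitrarily small. This is the combinatorial half of
    Goursat's lemma. *)
Lemma bisection_zero W (A B C D : R) : A <= B -> C <= D ->
  (forall a m b c n d, A <= a -> a <= m -> m <= b -> b <= B ->
     C <= c -> c <= n -> n <= d -> d <= D ->
     W a b c d = W a m c n + W m b c n + W a m n d + W m b n d) ->
  (forall x0 y0, A <= x0 <= B -> C <= y0 <= D -> forall e, 0 < e ->
     exists2 r, 0 < r & forall a b c d, A <= a -> a <= x0 <= b -> b <= B ->
       C <= c -> c <= y0 <= d -> d <= D -> b - a < r -> d - c < r ->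
       `|W a b c d| <= e * (b - a + (d - c)) ^+ 2) ->
  W A B C D = 0.
Proof.
move=> AB CD add small.
pose val (q : (R * R) * (R * R)) := W q.1.1 q.1.2 q.2.1 q.2.2.
pose ok (q : (R * R) * (R * R)) := [/\ A <= q.1.1, q.1.1 <= q.1.2, q.1.2 <= B &
   [/\ C <= q.2.1, q.2.1 <= q.2.2 & q.2.2 <= D]].
have step q : exists q', ok q -> [/\ ok q', q.1.1 <= q'.1.1 , q'.1.2 <= q.1.2 ,
   q.2.1 <= q'.2.1 & q'.2.2 <= q.2.2] /\ [/\
   q'.1.2 - q'.1.1 = (q.1.2 - q.1.1) / 2, q'.2.2 - q'.2.1 = (q.2.2 - q.2.1) / 2 &
   `|val q| <= 4 * `|val q'|].
  case: q => -[a b] [c d].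
  have [okq|] := pselect (ok ((a, b), (c, d))); last by exists ((a, b), (c, d)).
  case: (okq) => /= Aa ab bB [Cc cd dD].
  pose m := (a + b) / 2; pose n := (c + d) / 2.
  have E : W a b c d = W a m c n + W m b c n + W a m n d + W m b n d.
    by apply: add; rewrite // /m /n; lra.
  have Em : m - a = (b - a) / 2 by rewrite /m; lra.
  have En : n - c = (d - c) / 2 by rewrite /n; lra.
  clearbody m n.
  have [h1|h1] := leP `|W a b c d| (4 * `|W a m c n|).
    exists ((a, m), (c, n)) => _; rewrite /ok /val /=.
    by do !split => //=; lra.
  have [h2|h2] := leP `|W a b c d| (4 * `|W m b c n|).
    exists ((m, b), (c, n)) => _; rewrite /ok /val /=.
    by do !split => //=; lra.
  have [h3|h3] := leP `|W a b c d| (4 * `|W a m n d|).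
    exists ((a, m), (n, d)) => _; rewrite /ok /val /=.
    by do !split => //=; lra.
  have [h4|h4] := leP `|W a b c d| (4 * `|W m b n d|).
    exists ((m, b), (n, d)) => _; rewrite /ok /val /=.
    by do !split => //=; lra.
  exfalso.
  have := ler_normD (W a m c n + W m b c n + W a m n d) (W m b n d).
  have := ler_normD (W a m c n + W m b c n) (W a m n d).
  have := ler_normD (W a m c n) (W m b c n).
  rewrite -E; lra.
have [nxt nxtP] := choice step.
pose q0 : (R * R) * (R * R) := ((A, B), (C, D)).
pose q k := iter k nxt q0.
have ok0 : ok q0 by split=> //; split.
have okq k : ok (q k).
  by elim: k => // k IH; have [[] ] := nxtP _ IH.
have S k := nxtP _ (okq k).
have w1 k : (q k).1.2 - (q k).1.1 = (B - A) / 2 ^+ k.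
  elim: k => [|k IH]; first by rewrite expr0 divr1.
  by have [_ [-> _ _]] := S k; rewrite IH exprS invfM mulrCA mulrC.
have w2 k : (q k).2.2 - (q k).2.1 = (D - C) / 2 ^+ k.
  elim: k => [|k IH]; first by rewrite expr0 divr1.
  by have [_ [_ -> _]] := S k; rewrite IH exprS invfM mulrCA mulrC.
have v k : `|W A B C D| <= 4 ^+ k * `|val (q k)|.
  elim: k => [|k IH]; first by rewrite expr0 mul1r.
  apply: le_trans IH _; rewrite exprSr -mulrA ler_pM2l ?exprn_gt0//.
  by have [_ [_ _ ->]] := S k.
have mono k l : (k <= l)%N -> [/\ (q k).1.1 <= (q l).1.1, (q l).1.2 <= (q k).1.2,
    (q k).2.1 <= (q l).2.1 & (q l).2.2 <= (q k).2.2].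
  elim: l => [|l IH]; first by rewrite leqn0 => /eqP ->.
  rewrite leq_eqVlt => /predU1P[->//|]; rewrite ltnS => /IH[h1 h2 h3 h4].
  have [[_ g1 g2 g3 g4] _] := S l.
  by split; [exact: le_trans h1 g1|exact: le_trans g2 h2|exact: le_trans h3 g3|exact: le_trans g4 h4].
have cross k l : (q k).1.1 <= (q l).1.2 /\ (q k).2.1 <= (q l).2.2.
  have [[_ _ _ _] _] := S 0%N.
  case: (leqP k l) => [kl|/ltnW kl].
    have [h1 _ h3 _] := mono _ _ kl; have [_ o1 _ [_ o2 _]] := okq l.
    by split; [exact: le_trans h1 o1|exact: le_trans h3 o2].
  have [_ h2 _ h4] := mono _ _ kl; have [_ o1 _ [_ o2 _]] := okq k.
  by split; [exact: le_trans o1 h2|exact: le_trans o2 h4].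
pose X := [set (q k).1.1 | k in setT]; pose Y := [set (q k).2.1 | k in setT].
have X0 : X !=set0 by exists (q 0%N).1.1, 0%N.
have Y0 : Y !=set0 by exists (q 0%N).2.1, 0%N.
have xub l : ubound X (q l).1.2 by move=> _ [k _ <-]; have [] := cross k l.
have yub l : ubound Y (q l).2.2 by move=> _ [k _ <-]; have [] := cross k l.
have hX : has_sup X by split=> //; exists (q 0%N).1.2.
have hY : has_sup Y by split=> //; exists (q 0%N).2.2.
have xin k : (q k).1.1 <= sup X <= (q k).1.2.
  by apply/andP; split; [apply: ub_le_sup; [case: hX|exists k]|apply: ge_sup => //; exact: xub].
have yin k : (q k).2.1 <= sup Y <= (q k).2.2.
  by apply/andP; split; [apply: ub_le_sup; [case: hY|exists k]|apply: ge_sup => //; exact: yub].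
apply/eqP; rewrite -normr_eq0 eq_le normr_ge0 andbT; apply/ler_addgt0Pr => e e0.
rewrite add0r.
pose s := B - A + (D - C) + 1.
have s0 : 0 < s by rewrite /s; lra.
have [r r0 hr] := small _ _ (xin 0%N) (yin 0%N) (e / s ^+ 2) (divr_gt0 e0 (exprn_gt0 _ s0)).
have [k hk] : exists k : nat, s / 2 ^+ k < r.
  have [k _ /(_ k (leqnn k))/=] := @near_infty_natSinv_expn_lt R (PosNum (divr_gt0 r0 s0)).
  rewrite ltr_pdivlMr// mulrC => hk.
  by exists k; rewrite -[_^-1]div1r.
have [ k1 k2 k3 [k4 k5 k6] ] := okq k.
have b1 : (B - A) / 2 ^+ k <= s / 2 ^+ k.
  by rewrite ler_pM2r ?invr_gt0 ?exprn_gt0// /s; lra.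
have b2 : (D - C) / 2 ^+ k <= s / 2 ^+ k.
  by rewrite ler_pM2r ?invr_gt0 ?exprn_gt0// /s; lra.
have := hr _ _ _ _ k1 (xin k) k3 k4 (yin k) k6.
rewrite w1 w2 => /(_ (le_lt_trans b1 hk) (le_lt_trans b2 hk)) hW.
apply: le_trans (v k) _.
have p4 : (4 : R) ^+ k = (2 ^+ k) ^+ 2 by rewrite -exprM mulnC exprM; congr (_ ^+ k); rewrite expr2; lra.
apply: (@le_trans _ _ (4 ^+ k * (e / s ^+ 2 * ((B - A) / 2 ^+ k + (D - C) / 2 ^+ k) ^+ 2))).
  by rewrite ler_pM2l ?exprn_gt0//.
rewrite -mulrDl exprMn exprVn p4.
have t0 : (2 ^+ k) ^+ 2 != 0 :> R by rewrite !expf_neq0.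
have s2 : s ^+ 2 != 0 by rewrite expf_neq0// gt_eqF.
have alg (u w x : R) : u != 0 -> w != 0 -> u * (e / w * (x * u^-1)) = e * (x / w).
  by move=> u0 w0; field; rewrite u0 w0.
rewrite (alg _ _ _ t0 s2).
rewrite -[leRHS]mulr1.
apply: ler_wpM2l; first exact: ltW.
rewrite ler_pdivrMr ?exprn_gt0// mul1r.
rewrite ler_pXn2r// ?nnegrE /s; lra.
Qed.

End Bisection.

(** * Goursat's lemma for rectangles *)

Section Goursat.
Variable R : realType.
Implicit Types (P Q : R -> R -> R).

(** Real differentiability of [P + i Q] together with the Cauchy-Riemann equations:
    [a + i b] is the complex derivative. *)
Definition cauchy_riemann_at P Q (x0 y0 : R) := exists a b : R, forall e : R, 0 < e ->
  exists2 r, 0 < r & forall x y, `|x - x0| < r -> `|y - y0| < r ->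
    `|P x y - P x0 y0 - (a * (x - x0) - b * (y - y0))| <= e * (`|x - x0| + `|y - y0|) /\
    `|Q x y - Q x0 y0 - (b * (x - x0) + a * (y - y0))| <= e * (`|x - x0| + `|y - y0|).

Lemma lipschitz_at_continuous (f : R -> R) x0 (r M : R) : 0 < r ->
  (forall x, `|x - x0| < r -> `|f x - f x0| <= M * `|x - x0|) ->
  {for x0, continuous f}.
Proof.
move=> r0 h; apply/cvgrPdist_le => e e0.
near=> x.
have xr : `|x - x0| < r by rewrite distrC; near: x; exact: cvgr_dist_lt.
rewrite distrC; apply: le_trans (h _ xr) _.
have xm : `|x - x0| <= e / (`|M| + 1).
  rewrite distrC; near: x; apply: cvgr_dist_le => //.
  by rewrite divr_gt0// ltr_pwDr.
have M1 : 0 < `|M| + 1 by rewrite ltr_pwDr.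
move: xm; rewrite ler_pdivlMr// => xm; apply: le_trans xm; rewrite mulrC.
apply: ler_wpM2l => //; have := ler_norm M; lra.
Unshelve. all: by end_near. Qed.

Lemma cauchy_riemann_continuous P Q x0 y0 : cauchy_riemann_at P Q x0 y0 ->
  [/\ {for x0, continuous (fun x => P x y0)}, {for y0, continuous (fun y => P x0 y)},
      {for x0, continuous (fun x => Q x y0)} & {for y0, continuous (fun y => Q x0 y)}].
Proof.
move=> [a [b /(_ 1 ltr01)[r r0 h]]].
have h0 (z : R) : `|z - z| < r by rewrite subrr normr0.
split; [apply: (@lipschitz_at_continuous _ _ r (1 + `|a|))|
  apply: (@lipschitz_at_continuous _ _ r (1 + `|b|))|
  apply: (@lipschitz_at_continuous _ _ r (1 + `|b|))|
  apply: (@lipschitz_at_continuous _ _ r (1 + `|a|))] => // x hx.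
- have [+ _] := h _ _ hx (h0 y0); rewrite subrr normr0 mulr0 subr0 addr0.
  have := ler_normD (P x y0 - P x0 y0 - a * (x - x0)) (a * (x - x0)).
  by rewrite subrK normrM; lra.
- have [+ _] := h _ _ (h0 x0) hx; rewrite subrr normr0 mulr0 sub0r add0r.
  have := ler_normB (P x0 x - P x0 y0 - - (b * (x - y0))) (b * (x - y0)).
  by rewrite opprK addrK normrM; lra.
- have [_ +] := h _ _ hx (h0 y0); rewrite subrr normr0 mulr0 !addr0.
  have := ler_normD (Q x y0 - Q x0 y0 - b * (x - x0)) (b * (x - x0)).
  by rewrite subrK normrM; lra.
- have [_ +] := h _ _ (h0 x0) hx; rewrite subrr normr0 mulr0 !add0r.
  have := ler_normD (Q x0 x - Q x0 y0 - a * (x - y0)) (a * (x - y0)).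
  by rewrite subrK normrM; lra.
Qed.

(** The real part of the contour integral of [P + i Q] around the rectangle with
    sides [a, b] and [c, d]. *)
Definition rect_int P Q (a b c d : R) :=
  seg_int (fun x => P x c) a b - seg_int (fun x => P x d) a b -
  (seg_int (fun y => Q b y) c d - seg_int (fun y => Q a y) c d).

(** Near a point the function is a complex-affine map, whose contour integral is
    zero, plus an error that is small relative to the size of the rectangle; so the
    contour integral is small relative to the square of this size, as required by
    [bisection_zero]. *)
Theorem goursat P Q (A B C D : R) : A <= B -> C <= D ->
  (forall x y, A <= x <= B -> C <= y <= D -> cauchy_riemann_at P Q x y) ->
  rect_int P Q A B C D = 0.
Proof.
move=> AB CD CR.
have cP y : C <= y <= D -> cont_seg (fun x => P x y) A B.
  by move=> hy x hx; have [] := cauchy_riemann_continuous (CR x y hx hy).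
have cQ x : A <= x <= B -> cont_seg (fun y => Q x y) C D.
  by move=> hx y hy; have [] := cauchy_riemann_continuous (CR x y hx hy).
apply: bisection_zero => //.
- move=> a m b c n d Aa am mb bB Cc cn nd dD; rewrite /rect_int.
  have sP y : C <= y <= D -> seg_int (fun x => P x y) a b =
      seg_int (fun x => P x y) a m + seg_int (fun x => P x y) m b.
    by move=> hy; apply: seg_int_split; [rewrite am|exact: cont_segW Aa bB (cP _ hy)].
  have sQ x : A <= x <= B -> seg_int (fun y => Q x y) c d =
      seg_int (fun y => Q x y) c n + seg_int (fun y => Q x y) n d.
    by move=> hx; apply: seg_int_split; [rewrite cn|exact: cont_segW Cc dD (cQ _ hx)].
  rewrite (sP c) ?(sP d) ?(sQ a) ?(sQ b); first ring; by apply/andP; split; lra.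
move=> x0 y0 hx hy e e0.
have [a0 [b0 /(_ (e / 4) (divr_gt0 e0 (ltr0n _ 4)))[r r0 h]]] := CR _ _ hx hy.
exists r => // a b c d Aa /andP[ax xb] bB Cc /andP[cy yd] dD br dr.
set s := b - a + (d - c).
have near x y : a <= x <= b -> c <= y <= d -> [/\ `|x - x0| < r, `|y - y0| < r &
    e / 4 * (`|x - x0| + `|y - y0|) <= e / 4 * s].
  move=> /andP[h1 h2] /andP[h3 h4].
  have hx1 : `|x - x0| <= b - a by rewrite ler_norml; lra.
  have hy1 : `|y - y0| <= d - c by rewrite ler_norml; lra.
  split; [lra|lra|apply: ler_wpM2l; [lra|rewrite /s; lra]].
have ab : a <= b by lra.
have cd : c <= d by lra.
have incl x : a <= x <= b -> A <= x <= B by lra.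
have incl2 x : c <= x <= d -> C <= x <= D by lra.
have cPy y : c <= y <= d -> cont_seg (fun x => P x y) a b.
  by move=> /incl2 /cP; exact: cont_segW.
have cQx x : a <= x <= b -> cont_seg (fun y => Q x y) c d.
  by move=> /incl /cQ; exact: cont_segW.
have caa : a <= a <= b by lra.
have cbb : a <= b <= b by lra.
have ccc : c <= c <= d by lra.
have cdd : c <= d <= d by lra.
have hP : `|seg_int (fun x => P x c - P x d) a b - (b0 * (d - c)) * (b - a)| <=
   e / 2 * s * (b - a).
  apply: seg_int_bound => //.
    by move=> x hx'; apply: continuousB; [exact: cPy|exact: cPy].
  move=> x hx'.
  have [n1 n2 n3] := near _ _ hx' ccc; have [m1 m2 m3] := near _ _ hx' cdd.
  have [+ _] := h _ _ n1 n2; have [+ _] := h _ _ m1 m2.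
  rewrite !ler_norml; lra.
have hQ : `|seg_int (fun y => Q b y - Q a y) c d - (b0 * (b - a)) * (d - c)| <=
   e / 2 * s * (d - c).
  apply: seg_int_bound => //.
    by move=> x hx'; apply: continuousB; [exact: cQx|exact: cQx].
  move=> y hy'.
  have [n1 n2 n3] := near _ _ caa hy'; have [m1 m2 m3] := near _ _ cbb hy'.
  have [_ +] := h _ _ n1 n2; have [_ +] := h _ _ m1 m2.
  rewrite !ler_norml; lra.
move: hP hQ; rewrite !seg_intB; [|exact: cQx|exact: cQx|exact: cPy|exact: cPy] => hP hQ.
rewrite /rect_int.
have s0 : 0 <= s by rewrite /s; lra.
have -> : e * s ^+ 2 = e / 2 * s * (b - a) + e / 2 * s * (d - c) + e / 2 * s ^+ 2.
  by rewrite /s; field.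
have : 0 <= e / 2 * s ^+ 2 by rewrite mulr_ge0 ?exprn_ge0//; lra.
rewrite [b0 * (b - a) * (d - c)]mulrAC in hQ.
by move: hP hQ; rewrite !ler_norml; lra.
Qed.

End Goursat.

(** * The complex modulus and first-order expansions *)

Section ComplexModulus.
Variable R : realType.
Implicit Types z w : R[i].

Definition cabs z : R := Normc.normc z.

Lemma cabsE z : `|z| = (cabs z)%:C. Proof. by []. Qed.

Lemma cabs_lt z (r : R) : (`|z| < r%:C) = (cabs z < r).
Proof. by rewrite cabsE ltcR. Qed.

Lemma cabs_ge0 z : 0 <= cabs z.
Proof. by case: z => a b; exact: sqrtr_ge0. Qed.

Lemma cabsM z w : cabs (z * w) = cabs z * cabs w.
Proof. exact: Normc.normcM. Qed.

Lemma cabsV z : cabs z^-1 = (cabs z)^-1.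
Proof. exact: Normc.normcV. Qed.

Lemma cabsN z : cabs (- z) = cabs z.
Proof. exact: normcN. Qed.

Lemma cabsD z w : cabs (z + w) <= cabs z + cabs w.
Proof. exact: le_normcD. Qed.

Lemma cabsB z w : cabs (z - w) <= cabs z + cabs w.
Proof. by rewrite -(cabsN w); exact: cabsD. Qed.

Lemma cabs0 : cabs 0 = 0. Proof. exact: Normc.normc0. Qed.

Lemma cabs1 : cabs 1 = 1. Proof. exact: Normc.normc1. Qed.

Lemma cabs_real (x : R) : cabs x%:C = `|x|.
Proof. by rewrite /cabs /= expr0n/= addr0 sqrtr_sqr. Qed.

Lemma cabs_eq0 z : (cabs z == 0) = (z == 0).
Proof.
by apply/eqP/eqP => [/Normc.eq0_normc//|->]; rewrite cabs0.
Qed.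

Lemma cabs_gt0 z : (0 < cabs z) = (z != 0).
Proof. by rewrite lt_neqAle cabs_ge0 andbT eq_sym cabs_eq0. Qed.

Lemma sqr_cabs z : cabs z ^+ 2 = complex.Re z ^+ 2 + complex.Im z ^+ 2.
Proof. by case: z => a b; rewrite /cabs /= sqr_sqrtr// addr_ge0 ?sqr_ge0. Qed.

Lemma Re_le_cabs z : `|complex.Re z| <= cabs z.
Proof.
rewrite -(ler_pXn2r (ltn0Sn 1)) ?nnegrE ?cabs_ge0//.
by rewrite real_normK ?num_real// sqr_cabs lerDl sqr_ge0.
Qed.

Lemma Im_le_cabs z : `|complex.Im z| <= cabs z.
Proof.
rewrite -(ler_pXn2r (ltn0Sn 1)) ?nnegrE ?cabs_ge0//.
by rewrite real_normK ?num_real// sqr_cabs lerDr sqr_ge0.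
Qed.

Lemma cabs_le_ReIm z : cabs z <= `|complex.Re z| + `|complex.Im z|.
Proof.
rewrite {1}[z]complexE; apply: le_trans (cabsD _ _) _.
by rewrite cabsM !cabs_real {1}/cabs /= expr0n expr1n add0r sqrtr1 mul1r.
Qed.

Lemma cReD z w : complex.Re (z + w) = complex.Re z + complex.Re w.
Proof. by case: z w => a b []. Qed.
Lemma cImD z w : complex.Im (z + w) = complex.Im z + complex.Im w.
Proof. by case: z w => a b []. Qed.
Lemma cReN z : complex.Re (- z) = - complex.Re z. Proof. by case: z. Qed.
Lemma cImN z : complex.Im (- z) = - complex.Im z. Proof. by case: z. Qed.
Lemma cReM z w : complex.Re (z * w) =
  complex.Re z * complex.Re w - complex.Im z * complex.Im w.
Proof. by case: z w => a b []. Qed.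
Lemma cImM z w : complex.Im (z * w) =
  complex.Re z * complex.Im w + complex.Im z * complex.Re w.
Proof. by case: z w => a b [c d]. Qed.

Lemma cImMr (x : R) z : complex.Im (x%:C * z) = x * complex.Im z.
Proof. by rewrite cImM /= mul0r addr0. Qed.
Lemma cReMr (x : R) z : complex.Re (x%:C * z) = x * complex.Re z.
Proof. by rewrite cReM /= mul0r subr0. Qed.

Lemma nbhs_complexP z (A : set R[i]) :
  nbhs z A <-> exists2 r : R, 0 < r & forall w, cabs (w - z) < r -> A w.
Proof.
split=> [/nbhs_ballP[e /= e0 h]|[r r0 h]].
  have eE : e = (complex.Re e)%:C by rewrite RRe_real// gtr0_real.
  exists (complex.Re e); first by rewrite -ltcR -eE.
  move=> w hw; apply: h; rewrite -ball_normE /= eE -opprB normrN.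
  by rewrite cabs_lt.
apply/nbhs_ballP; exists r%:C => /=; first by rewrite ltcR.
move=> w; rewrite -ball_normE /= -opprB normrN cabs_lt; exact: h.
Qed.

(** Complex differentiability with a real-valued error, which can be fed to linear
    arithmetic. *)
Definition cdiff_at (f : R[i] -> R[i]) z l := forall e : R, 0 < e ->
  exists2 r : R, 0 < r & forall w, cabs (w - z) < r ->
    cabs (f w - f z - l * (w - z)) <= e * cabs (w - z).

Lemma cdiff_atP (f : R[i] -> R[i]) z l : is_derive z 1 f l <-> cdiff_at f z l.
Proof.
split.
  move=> [df dl] e e0.
  have {}df : ((fun k => k^-1 *: ((f \o shift z) (k *: 1) - f z)) @ 0^') --> l by rewrite -dl.
  move: df => /cvgrPdist_le /(_ e%:C); rewrite ltcR => /(_ e0).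
  move=> /nbhs_complexP[r r0 h]; exists r => // w wr.
  have [->|wz] := eqVneq w z; first by rewrite !subrr mulr0 subrr cabs0 mulr0.
  have wz0 : w - z != 0 by rewrite subr_eq0.
  have /h/(_ wz0) : cabs (w - z - 0) < r by rewrite subr0.
  rewrite /= [_%:A]mulr1 subrK.
  rewrite distrC cabsE lecR => hle.
  have -> : f w - f z - l * (w - z) = (w - z) * ((w - z)^-1 *: (f w - f z) - l).
    by rewrite -[_^-1 *: _]/(_^-1 * _) [RHS]mulrBr mulVKf// [_ * l]mulrC.
  rewrite cabsM mulrC ler_wpM2r ?cabs_ge0//.
move=> h; have lim : ((fun k => k^-1 *: ((f \o shift z) (k *: 1) - f z)) @ 0^') --> l.
  apply/cvgrPdist_le => e e0.
  have eE : e = (complex.Re e)%:C by rewrite RRe_real// gtr0_real.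
  have e1 : 0 < complex.Re e by rewrite -ltcR -eE.
  have [r r0 hr] := h _ e1; apply/nbhs_complexP; exists r => // w.
  rewrite subr0 => wr w0 /=; rewrite [_%:A]mulr1 eE distrC cabsE lecR.
  have := hr (w + z); rewrite addrK => /(_ wr) {}hr.
  have -> : w^-1 *: (f (w + z) - f z) - l = (f (w + z) - f z - l * w) * w^-1.
    by rewrite -[w^-1 *: _]/(w^-1 * _) [in RHS]mulrBl mulfK// [_ * w^-1]mulrC.
  by rewrite cabsM cabsV ler_pdivrMr ?cabs_gt0.
by split; [apply/cvg_ex; exists l|exact: cvg_lim lim].
Qed.

Lemma is_derive_rowP n (f : R[i] -> 'rV[R[i]]_n) z l :
  is_derive z 1 f l <-> forall j, is_derive z 1 (fun w => f w 0 j) (l 0 j).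
Proof.
split=> [[df <-] j|h].
  suff lim : ((fun k => k^-1 *: (((fun w => f w 0 j) \o shift z) (k *: 1) - f z 0 j)) @ 0^') -->
     ('D_1 f z) 0 j.
    by split; [apply/cvg_ex; eexists; exact: lim|exact: cvg_lim lim].
  have := cvg_comp _ _ df (@coord_continuous _ _ _ 0 j _).
  by apply: cvg_trans; apply: near_eq_cvg; near=> k => /=; rewrite !mxE.
have lim : ((fun k => k^-1 *: ((f \o shift z) (k *: 1) - f z)) @ 0^') --> l.
  move=> A [P Pl PA].
  have : \forall k \near 0^', forall j, P 0 j (k^-1 *: ((f (k *: 1 + z) 0 j) - f z 0 j)).
    apply: filter_forall => j; have [dj ej] := h j.
    by have := dj (P 0 j); apply; rewrite [lim _]ej.
  apply: filterS => k hk; apply: PA => i j; rewrite ord1 !mxE; exact: hk.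
by split; [apply/cvg_ex; exists l|exact: cvg_lim lim].
Unshelve. all: by end_near. Qed.

Lemma is_derive_epsP (U : normedModType R) (g : R -> U) (t : R) (v : U) :
  is_derive t (1 : R) g v <-> forall e : R, 0 < e -> exists2 r : R, 0 < r &
    forall x, `|x - t| < r -> `|g x - g t - (x - t) *: v| <= e * `|x - t|.
Proof.
split.
  move=> [df dE] e e0.
  have {}df : ((fun k => k^-1 *: ((g \o shift t) (k *: (1 : R)) - g t)) @ 0^') --> v.
    by rewrite -dE.
  move: df => /cvgrPdist_le /(_ _ e0)/nbhs_ballP[r /= r0 h]; exists r => // x xr.
  have [->|xx0] := eqVneq x t; first by rewrite !subrr scale0r subrr !normr0 mulr0.
  have xx : x - t != 0 by rewrite subr_eq0.
  have /h/(_ xx) : ball 0 r (x - t) by rewrite -ball_normE /= sub0r normrN.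
  rewrite /= [_%:A]mulr1 subrK distrC => hle.
  have -> : g x - g t - (x - t) *: v = (x - t) *: ((x - t)^-1 *: (g x - g t) - v).
    by rewrite scalerBr scalerA divff// scale1r.
  by rewrite normrZ mulrC ler_wpM2r.
move=> h.
have lim : ((fun k => k^-1 *: ((g \o shift t) (k *: (1 : R)) - g t)) @ 0^') --> v.
  apply/cvgrPdist_le => e e0; have [r r0 hr] := h _ e0.
  apply/nbhs_ballP; exists r => // k /=; rewrite -ball_normE /= sub0r normrN => kr k0.
  rewrite [_%:A]mulr1 distrC.
  have -> : k^-1 *: (g (k + t) - g t) - v = k^-1 *: (g (k + t) - g t - k *: v).
    by rewrite [RHS]scalerBr scalerA mulVf// scale1r.
  rewrite normrZ normfV mulrC ler_pdivrMr ?normr_gt0//.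
  by have := hr (k + t); rewrite addrK; apply.
by split; [apply/cvg_ex; exists v|exact: cvg_lim lim].
Qed.

End ComplexModulus.

(** * The mean value property *)

Section MeanValue.
Variable R : realType.
Implicit Types (F : R -> R -> R[i]) (G : R[i] -> R[i]).

(** Differentiability of [F (x + i y)] with complex-linear differential, for a map
    written in real coordinates: the form in which a holomorphic function is
    composed with the polar map. *)
Definition cplx_diff_at F (x0 y0 : R) (l : R[i]) := forall e : R, 0 < e ->
  exists2 r : R, 0 < r & forall x y, `|x - x0| < r -> `|y - y0| < r ->
    cabs (F x y - F x0 y0 - l * ((x - x0) +i* (y - y0))) <= e * (`|x - x0| + `|y - y0|).

Lemma cplx_diff_cauchy_riemann F x0 y0 l : cplx_diff_at F x0 y0 l ->
  cauchy_riemann_at (fun x y => complex.Re (F x y)) (fun x y => complex.Im (F x y)) x0 y0.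
Proof.
move=> h; exists (complex.Re l), (complex.Im l) => e e0.
have [r r0 hr] := h e e0; exists r => // x y hx hy.
have {}hr := hr _ _ hx hy.
have hR := le_trans (Re_le_cabs _) hr; have hI := le_trans (Im_le_cabs _) hr.
split; move: hR hI; rewrite !(cReD, cReN, cReM) ?(cImD, cImN, cImM) /= //.
by rewrite [complex.Re l * (y - y0) + _]addrC.
Qed.

Lemma cplx_diff_comp F G x0 y0 l k : cplx_diff_at F x0 y0 l ->
  cdiff_at G (F x0 y0) k -> cplx_diff_at (fun x y => G (F x y)) x0 y0 (k * l).
Proof.
move=> hF hG e e0.
pose M := cabs l + cabs k + 1.
have M0 : 0 < M by rewrite /M; have := cabs_ge0 l; have := cabs_ge0 k; lra.
pose e1 := Num.min 1 (e / (2 * M)).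
have e10 : 0 < e1 by rewrite lt_min ltr01 divr_gt0// mulr_gt0.
have [e11 e1M] : e1 <= 1 /\ e1 * M <= e / 2.
  have : e1 <= 1 /\ e1 <= e / (2 * M) by split; rewrite ge_min lexx ?orbT.
  case=> h1 h2; split=> //; apply: le_trans (ler_wpM2r (ltW M0) h2) _.
  by rewrite invfM mulrA mulfVK ?gt_eqF.
have [r r0 hr] := hF _ e10; have [s s0 hs] := hG _ e10.
pose t := Num.min r (s / (2 * M)).
have t0 : 0 < t by rewrite lt_min r0 divr_gt0// mulr_gt0.
exists t => // x y hx hy.
have hx1 : `|x - x0| < r by apply: lt_le_trans hx _; rewrite ge_min lexx.
have hy1 : `|y - y0| < r by apply: lt_le_trans hy _; rewrite ge_min lexx.
have {}hr := hr _ _ hx1 hy1.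
set d := `|x - x0| + `|y - y0| in hr *.
have d0 : 0 <= d by rewrite addr_ge0.
set h := (x - x0) +i* (y - y0) in hr *.
have hd : cabs h <= d by apply: le_trans (cabs_le_ReIm _) _.
have dF : cabs (F x y - F x0 y0) <= M * d.
  have := cabsD (F x y - F x0 y0 - l * h) (l * h); rewrite subrK => /le_trans; apply.
  rewrite cabsM; apply: le_trans (lerD hr (ler_wpM2l (cabs_ge0 _) hd)) _.
  rewrite -mulrDl ler_wpM2r// /M; have := cabs_ge0 k; lra.
have dFs : cabs (F x y - F x0 y0) < s.
  apply: le_lt_trans dF _; rewrite mulrC -ltr_pdivlMr//.
  have h1 : `|x - x0| < s / (2 * M) by apply: lt_le_trans hx _; rewrite ge_min lexx orbT.
  have h2 : `|y - y0| < s / (2 * M) by apply: lt_le_trans hy _; rewrite ge_min lexx orbT.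
  have -> : s / M = s / (2 * M) + s / (2 * M) by field; rewrite gt_eqF.
  exact: ltrD.
have {}hs := hs _ dFs.
have -> : G (F x y) - G (F x0 y0) - k * l * h =
   (G (F x y) - G (F x0 y0) - k * (F x y - F x0 y0)) + k * (F x y - F x0 y0 - l * h) by ring.
apply: le_trans (cabsD _ _) _; rewrite cabsM.
apply: le_trans (lerD hs (ler_wpM2l (cabs_ge0 _) hr)) _.
apply: (@le_trans _ _ (e1 * (M * d) + M * (e1 * d))).
  apply: lerD; first by rewrite ler_wpM2l// ltW.
  by rewrite ler_wpM2r ?mulr_ge0 ?(ltW e10)// /M; have := cabs_ge0 l; lra.
rewrite mulrA [M * _]mulrA [M * e1]mulrC -mulrDl ler_wpM2r//; lra.
Qed.

(** The exponential map: it turns circles about the origin into vertical segments. *)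
Definition polar (x y : R) : R[i] := (expR x * cos y) +i* (expR x * sin y).

Lemma cabs_polar x y : cabs (polar x y) = expR x.
Proof.
rewrite /cabs /= !exprMn -mulrDr cos2Dsin2 mulr1 sqrtr_sqr.
by rewrite gtr0_norm// expR_gt0.
Qed.

Lemma derive_eps (f : R -> R) (x0 d : R) : is_derive x0 1 f d -> forall e, 0 < e ->
  exists2 r : R, 0 < r & forall x, `|x - x0| < r ->
    `|f x - f x0 - d * (x - x0)| <= e * `|x - x0|.
Proof.
move=> /is_derive_epsP h e /h[r r0 hr]; exists r => // x /hr.
by rewrite -[_ *: _]/(_ * _) [_ * d]mulrC.
Qed.

Lemma cplx_diff_polar x0 y0 : cplx_diff_at polar x0 y0 (polar x0 y0).
Proof.
move=> e e0.
set E := expR x0; have E0 : 0 < E by exact: expR_gt0.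
pose e1 := e / (6 * (E + 1)).
have e10 : 0 < e1 by rewrite divr_gt0// mulr_gt0//; lra.
have e1E : e1 * (E + 1) * 6 = e by rewrite /e1; field; rewrite gt_eqF//; lra.
have [r1 r10 h1] := derive_eps (is_derive_expR x0) e10.
have [r2 r20 h2] := derive_eps (is_derive_cos y0) e10.
have [r3 r30 h3] := derive_eps (is_derive_sin y0) e10.
pose r4 := Num.min (Num.min 1 (e1 / 2)) (Num.min r1 (Num.min r2 r3)).
have r40 : 0 < r4 by rewrite !lt_min ltr01 r10 r20 r30 divr_gt0.
exists r4 => // x y; rewrite !lt_min => /andP[/andP[xa xb] /and3P[x1 x2 x3]]
  /andP[/andP[ya yb] /and3P[y1 y2 y3]].
have {}h1 := h1 _ x1; have {}h2 := h2 _ y2; have {}h3 := h3 _ y3.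
set dx := x - x0 in h1 xa xb *; set dy := y - y0 in h2 h3 ya yb *.
set A := expR x - expR x0 - expR x0 * dx in h1.
set B := cos y - cos y0 - - sin y0 * dy in h2.
set C := sin y - sin y0 - cos y0 * dy in h3.
have sinle (z : R) : `|sin z| <= 1 by rewrite ler_norml; have := sin_geN1 z; have := sin_le1 z; lra.
have cosle (z : R) : `|cos z| <= 1 by rewrite ler_norml; have := cos_geN1 z; have := cos_le1 z; lra.
have bound (c s c' : R) (T S : R) : `|c| <= 1 -> `|s| <= 1 -> `|S| <= e1 * `|dy| ->
    `|A * c + E * S + E * dx * (S + s * dy)| <= e1 * (E + 1) * 3 * (`|dx| + `|dy|).
  move=> hc hs hS.
  have dx0 := normr_ge0 dx; have dy0 := normr_ge0 dy.
  have t1 : `|A * c| <= e1 * `|dx|.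
    rewrite normrM; apply: le_trans h1; rewrite -[leRHS]mulr1 ler_wpM2l//.
  have t2 : `|E * S| <= E * (e1 * `|dy|).
    by rewrite normrM (gtr0_norm E0) ler_pM2l.
  have t3 : `|E * dx * (S + s * dy)| <= E * (e1 * `|dx| + e1 * `|dy|).
    rewrite !normrM (gtr0_norm E0) -mulrA ler_pM2l//.
    have hSd : `|S + s * dy| <= e1 * `|dy| + `|dy|.
      apply: le_trans (ler_normD _ _) _; apply: lerD => //.
      by rewrite normrM -[leRHS]mul1r ler_wpM2r.
    apply: le_trans (ler_wpM2l dx0 hSd) _.
    have : `|dx| * `|dy| <= e1 / 2 * `|dx| by rewrite mulrC ler_wpM2r// ltW.
    have : `|dx| * `|dy| <= `|dy| by rewrite -[leRHS]mul1r ler_wpM2r// ltW.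
    have : e1 * (`|dx| * `|dy|) <= e1 * `|dy|.
      by rewrite ler_pM2l// -[leRHS]mul1r ler_wpM2r// ltW.
    have -> : `|dx| * (e1 * `|dy| + `|dy|) = e1 * (`|dx| * `|dy|) + `|dx| * `|dy| by ring.
    have : 0 <= e1 * `|dx| by rewrite mulr_ge0// ltW.
    lra.
  apply: le_trans (ler_normD _ _) _; apply: le_trans (lerD (ler_normD _ _) (lexx _)) _.
  have : 0 <= e1 * `|dx| by rewrite mulr_ge0// ltW.
  have : 0 <= e1 * `|dy| by rewrite mulr_ge0// ltW.
  have : 0 <= E * (e1 * `|dx|) by exact: mulr_ge0 (ltW E0) (mulr_ge0 (ltW e10) (normr_ge0 _)).
  have : 0 <= E * (e1 * `|dy|) by exact: mulr_ge0 (ltW E0) (mulr_ge0 (ltW e10) (normr_ge0 _)).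
  lra.
have hr : `|expR x * cos y - E * cos y0 - (E * cos y0 * dx - E * sin y0 * dy)| <=
    e1 * (E + 1) * 3 * (`|dx| + `|dy|).
  rewrite (_ : _ - _ - _ = A * cos y + E * B + E * dx * (B + - sin y0 * dy)).
    by apply: bound; rewrite ?normrN.
  by rewrite /A /B /E; ring.
have hi : `|expR x * sin y - E * sin y0 - (E * cos y0 * dy + E * sin y0 * dx)| <=
    e1 * (E + 1) * 3 * (`|dx| + `|dy|).
  rewrite (_ : _ - _ - _ = A * sin y + E * C + E * dx * (C + cos y0 * dy)).
    exact: bound.
  by rewrite /A /C /E; ring.
apply: le_trans (cabs_le_ReIm _) _.
rewrite !(cReD, cReN, cReM, cImD, cImN, cImM) /=.
apply: le_trans (lerD hr hi) _.
by rewrite -mulrDl ler_wpM2r ?addr_ge0//; lra.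
Qed.

(** In the coordinates of [polar] the punctured disc becomes a half-strip. Goursat's
    lemma on a rectangle of height [2 pi], applied to ['i * G], compares the
    integrals over two vertical sides: the horizontal sides cancel by periodicity.
    So the circular mean does not depend on the radius, and it tends to [L] at the
    centre. *)
Lemma mean_value G L :
  (forall z, 0 < cabs z < 1 -> exists l, cdiff_at G z l) ->
  (forall e : R, 0 < e -> exists2 r : R, 0 < r & forall z, 0 < cabs z < r -> cabs (G z - L) <= e) ->
  forall x : R, x < 0 -> cont_seg (fun y => complex.Re (G (polar x y))) 0 (pi *+ 2) /\
    seg_int (fun y => complex.Re (G (polar x y))) 0 (pi *+ 2) = complex.Re L * (pi *+ 2).
Proof.
move=> dG limG.
have dFi (x y : R) : x < 0 -> exists l, cplx_diff_at (fun x y => 'i * G (polar x y)) x y l.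
  move=> x0; have hz : 0 < cabs (polar x y) < 1 by rewrite cabs_polar expR_gt0 expR_lt1.
  have [l hl] := dG _ hz; exists ('i * (l * polar x y)).
  have := cplx_diff_comp (cplx_diff_polar x y) hl.
  move=> h e e0; have [r r0 hr] := h e e0; exists r => // x' y' hx hy.
  apply: le_trans (hr _ _ hx hy).
  rewrite (_ : _ - _ - _ = 'i * (G (polar x' y') - G (polar x y) -
    l * polar x y * ((x' - x) +i* (y' - y)))); last by ring.
  by rewrite cabsM {1}/cabs /= expr0n expr1n add0r sqrtr1 mul1r.
pose P x y := complex.Re ('i * G (polar x y)); pose Q x y := complex.Im ('i * G (polar x y)).
have QE x y : Q x y = complex.Re (G (polar x y)) by rewrite /Q cImM /= mul1r mul0r add0r.
have CR x y : x < 0 -> cauchy_riemann_at P Q x y.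
  by move=> /(dFi x y)[l hl]; exact: cplx_diff_cauchy_riemann hl.
have pi2 : 0 <= pi *+ 2 :> R by rewrite mulrn_wge0// pi_ge0.
have cont x : x < 0 -> cont_seg (Q x) 0 (pi *+ 2).
  by move=> x0 y _; have [] := cauchy_riemann_continuous (CR x y x0).
have QEf x : Q x = (fun y => complex.Re (G (polar x y))) by apply/funext => y; exact: QE.
have J x1 x2 : x1 <= x2 -> x2 < 0 -> seg_int (Q x2) 0 (pi *+ 2) = seg_int (Q x1) 0 (pi *+ 2).
  move=> x12 x20.
  have := @goursat _ P Q x1 x2 0 (pi *+ 2) x12 pi2.
  rewrite /rect_int (_ : (fun x => P x 0) = (fun x => P x (pi *+ 2))); last first.
    by apply/funext => x; rewrite /P /polar cos2pi sin2pi cos0 sin0.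
  rewrite subrr sub0r => /(_ _)/eqP; rewrite oppr_eq0 subr_eq0 => H; apply/eqP/H.
  by move=> x y /andP[_ hx] _; apply: CR; exact: le_lt_trans hx x20.
move=> x x0; rewrite -QEf; split; first exact: cont.
apply/eqP; rewrite -subr_eq0 -normr_eq0 eq_le normr_ge0 andbT; apply/ler_addgt0Pr => e e0.
rewrite add0r.
have p0 : 0 < pi *+ 2 :> R by rewrite mulrn_wgt0// pi_gt0.
have [r r0 hr] := limG _ (divr_gt0 e0 p0).
pose x1 := Num.min x (ln (r / 2)).
have x1x : x1 <= x by rewrite ge_min lexx.
have x10 : x1 < 0 by exact: le_lt_trans x1x x0.
rewrite (J _ _ x1x x0).
have bnd y : 0 <= y <= pi *+ 2 -> `|Q x1 y - complex.Re L| <= e / (pi *+ 2).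
  move=> _; rewrite QE -cReN -cReD.
  apply: le_trans (Re_le_cabs _) _; apply: hr; rewrite cabs_polar expR_gt0/=.
  have r2 : 0 < r / 2 by rewrite divr_gt0.
  apply: (@le_lt_trans _ _ (r / 2)); last lra.
  by rewrite -[leRHS]lnK// ler_expR ge_min lexx orbT.
have := seg_int_bound pi2 (cont _ x10) bnd.
by rewrite subr0 divfK// gt_eqF.
Qed.

End MeanValue.

(** * The Schwarz-Pick inequality for the half-plane *)

Section HalfPlaneSchwarz.
Variable R : realType.
Implicit Types (f : R[i] -> R[i]).

Lemma cdiff_derivable f z : derivable f z 1 -> exists l, cdiff_at f z l.
Proof. by move=> /derivableP h; eexists; apply/cdiff_atP; exact: h. Qed.

(** The mean of [Re f * (1 - cos)] over the circle of radius [r] is non-negative.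
    Expanding [cos y] as [(z / r + r / z) / 2] on this circle identifies this mean
    with that of a function holomorphic off the origin, up to the antiholomorphic
    part of [f 0]; the mean value property evaluates it as
    [Re (f 0) - (r / 2) Re l]. *)
Lemma schwarz_kernel f (l : R[i]) (r : R) : 0 < r < 1 ->
  (forall z, cabs z < 1 -> derivable f z 1) -> cdiff_at f 0 l ->
  (forall z, cabs z < 1 -> 0 <= complex.Re (f z)) ->
  r * complex.Re l <= 2 * complex.Re (f 0).
Proof.
move=> /andP[r0 r1] df dl f0.
pose G z := f z * (1 - (2 * r)^-1%:C * z) - (r / 2)%:C * ((f z - f 0) * z^-1).
pose L := f 0 - (r / 2)%:C * l.
have dG z : 0 < cabs z < 1 -> exists l, cdiff_at G z l.
  move=> /andP[z0 z1]; apply: cdiff_derivable.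
  have z_neq0 : z != 0 by rewrite -cabs_gt0.
  have did (y : R[i]) : derivable (fun z : R[i] => z) y 1 by exact: derivable_id.
  have dc (c y : R[i]) : derivable (fun _ : R[i] => c) y 1 by exact: derivable_cst.
  apply: derivableB.
    apply: derivableM; first exact: df.
    by apply: derivableB; [exact: dc|apply: derivableM; [exact: dc|exact: did]].
  apply: derivableM; first exact: dc.
  apply: derivableM; first by apply: derivableB; [exact: df|exact: dc].
  by apply: derivableV.
have limG (e : R) : 0 < e -> exists2 s : R, 0 < s & forall z, 0 < cabs z < s -> cabs (G z - L) <= e.
  move=> e0; have [s s0 hs] := dl _ e0.
  pose A := (cabs l + e) + (cabs (f 0) + (cabs l + e)) / (2 * r).
  have A0 : 0 < A.
    rewrite ltr_wpDr// ?divr_ge0//; have := cabs_ge0 l; have := cabs_ge0 (f 0); lra.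
  exists (Num.min (Num.min s 1) (e / (2 * A))).
    by rewrite !lt_min s0 ltr01 divr_gt0// mulr_gt0.
  move=> z; rewrite !lt_min => /andP[z0 /andP[/andP[zs z1] zA]].
  have z_neq0 : z != 0 by rewrite -cabs_gt0.
  have {}hs : cabs (f z - f 0 - l * z) <= e * cabs z.
    by have := hs z; rewrite subr0; apply.
  have h1 : cabs (f z - f 0) <= (cabs l + e) * cabs z.
    rewrite -[f z - f 0](subrK (l * z)); apply: le_trans (cabsD _ _) _.
    by rewrite cabsM; lra.
  have h2 : cabs (f z) <= cabs (f 0) + (cabs l + e).
    rewrite -[f z](subrK (f 0)); apply: le_trans (cabsD _ _) _.
    rewrite addrC lerD2l; apply: le_trans h1 _.
    rewrite -[leRHS]mulr1 ler_wpM2l ?ltW//; have := cabs_ge0 l; lra.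
  have -> : G z - L = (f z - f 0) - (2 * r)^-1%:C * (f z * z) -
     (r / 2)%:C * ((f z - f 0 - l * z) * z^-1).
    by rewrite /G /L [in RHS](mulrBl (z^-1)) mulfK//; ring.
  apply: le_trans (cabsB _ _) _; apply: le_trans (lerD (cabsB _ _) (lexx _)) _.
  rewrite !cabsM cabsV !cabs_real (gtr0_norm (divr_gt0 r0 _))//.
  have r20 : 0 < (2 * r)^-1 by rewrite invr_gt0 mulr_gt0.
  rewrite (gtr0_norm r20).
  have h3 : cabs (f z - f 0 - l * z) * (cabs z)^-1 <= e by rewrite ler_pdivrMr.
  have h4 : (2 * r)^-1 * (cabs (f z) * cabs z) <=
      (cabs (f 0) + (cabs l + e)) / (2 * r) * cabs z.
    by rewrite mulrA [(2 * r)^-1 * _]mulrC ler_wpM2r ?cabs_ge0// ler_wpM2r ?(ltW r20).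
  have h5 : r / 2 * (cabs (f z - f 0 - l * z) * (cabs z)^-1) <= e / 2.
    have : r / 2 * (cabs (f z - f 0 - l * z) * (cabs z)^-1) <= r / 2 * e.
      by rewrite ler_wpM2l// divr_ge0// ltW.
    have : r * e <= 1 * e by rewrite ler_wpM2r ?(ltW e0) ?(ltW r1).
    lra.
  have h6 : A * cabs z <= e / 2.
    rewrite mulrC -ler_pdivlMr//; apply: ltW; apply: lt_le_trans zA _.
    by rewrite invfM mulrA.
  move: h6; rewrite /A mulrDl; lra.
have lnr : ln r < 0 by rewrite ln_lt0// r0.
have [cG iG] := mean_value dG limG lnr.
pose H z := (f 0)^*%C * z.
have dH z : 0 < cabs z < 1 -> exists l, cdiff_at H z l.
  by move=> _; apply: cdiff_derivable; apply: derivableM; [exact: derivable_cst|exact: derivable_id].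
have limH (e : R) : 0 < e -> exists2 s : R, 0 < s & forall z, 0 < cabs z < s -> cabs (H z - 0) <= e.
  move=> e0; have M0 : 0 < cabs (f 0)^*%C + 1 by rewrite ltr_wpDl ?cabs_ge0.
  exists (e / (cabs (f 0)^*%C + 1)); first exact: divr_gt0.
  move=> z /andP[_]; rewrite subr0 ltr_pdivlMr// cabsM => hz; apply: ltW.
  by apply: le_lt_trans hz; rewrite mulrC ler_wpM2l ?cabs_ge0// lerDl.
have [cH iH] := mean_value dH limH lnr.
have pos : 0 <= seg_int (fun y => complex.Re (G (polar (ln r) y)) -
     (2 * r)^-1 * complex.Re (H (polar (ln r) y))) 0 (pi *+ 2).
  apply: Rintegral_ge0 => y _.
  set w := polar (ln r) y.
  have wE : w = (r * cos y) +i* (r * sin y) by rewrite /w /polar lnK.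
  have cw : cabs w = r by rewrite /w cabs_polar lnK.
  have w0 : w != 0 by rewrite -cabs_gt0 cw.
  have wV : w^-1 = (r^-1 * cos y) +i* (- (r^-1 * sin y)).
    apply: (mulfI w0); rewrite divff// wE; simpc.
    have r_neq0 : r != 0 by rewrite gt_eqF.
    have cs := cos2Dsin2 y.
    by congr (_ +i* _); [rewrite -[LHS]cs|]; field.
  rewrite (_ : _ - _ = complex.Re (f w) * (1 - cos y)).
    apply: mulr_ge0; first by apply: f0; rewrite cw.
    by rewrite subr_ge0 cos_le1.
  rewrite /G /H wV wE.
  case: (f 0) => a b; case: (f _) => c d.
  rewrite !(cReM, cReD, cReN, cImM, cImD, cImN) /=.
  by field; rewrite gt_eqF.
have cH2 : cont_seg (fun y => (2 * r)^-1 * complex.Re (H (polar (ln r) y))) 0 (pi *+ 2).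
  by move=> y hy; apply: continuousM; [exact: cst_continuous|exact: cH].
move: pos; rewrite seg_intB// seg_intZ// iG iH mul0r mulr0 subr0.
have p0 : 0 < pi *+ 2 :> R by rewrite mulrn_wgt0// pi_gt0.
rewrite pmulr_lge0// /L. rewrite cReD cReN cReMr.
lra.
Qed.

(** Rotating the variable turns the real part in [schwarz_kernel] into the modulus,
    and letting [r] tend to 1 removes the loss. This is the Schwarz-Pick inequality
    at the centre of the disc; every lower bound on the Kobayashi metric comes from
    it. *)
Lemma halfplane_schwarz f (l : R[i]) :
  (forall z, cabs z < 1 -> derivable f z 1) -> cdiff_at f 0 l ->
  (forall z, cabs z < 1 -> 0 <= complex.Re (f z)) ->
  cabs l <= 2 * complex.Re (f 0).
Proof.
move=> df dl f0.
have Rel (c : R[i]) : cabs c = 1 -> complex.Re (c * l) <= 2 * complex.Re (f 0).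
  move=> c1; apply/ler_addgt0Pr => e e0.
  pose M := `|complex.Re (c * l)| + 1.
  have M0 : 0 < M by rewrite ltr_wpDl.
  (* Any [r] so close to 1 that [(1 - r) M <= e] will do. *)
  pose r := 1 - Num.min (1 / 2) (e / M).
  have m0 : 0 < Num.min (1 / 2) (e / M) by rewrite lt_min !divr_gt0.
  have m1 : Num.min (1 / 2) (e / M) <= 1 / 2 by rewrite ge_min lexx.
  have m2 : Num.min (1 / 2) (e / M) <= e / M by rewrite ge_min lexx orbT.
  have r01 : 0 < r < 1 by rewrite /r; lra.
  have cz z : cabs (c * z) = cabs z by rewrite cabsM c1 mul1r.
  have := @schwarz_kernel (fun z => f (c * z)) (c * l) r r01.
  rewrite mulr0 => /(_ _ _ _) H.
  have h : r * complex.Re (c * l) <= 2 * complex.Re (f 0).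
    apply: H => [z z1||z z1]; last by apply: f0; rewrite cz.
      have [k hk] := cdiff_derivable (df (c * z) (eq_ind_r (fun x => x < 1) z1 (cz z))).
      have : cdiff_at (fun z => f (c * z)) z (k * c).
        move=> e' e'0; have [s s0 hs] := hk _ e'0; exists s => // w ws.
        have -> : k * c * (w - z) = k * (c * w - c * z) by ring.
        rewrite -(cz (w - z)) [c * (w - z)]mulrBr; apply: hs.
        by rewrite -mulrBr cz.
      by move=> /cdiff_atP[].
    move=> e' e'0; have [s s0 hs] := dl _ e'0; exists s => // w ws.
    have -> : c * l * (w - 0) = l * (c * w - 0) by rewrite !subr0; ring.
    rewrite mulr0 -(cz (w - 0)) [c * (w - 0)]mulrBr mulr0; apply: hs.
    by rewrite subr0 cz -[w]subr0.
  have hN : - complex.Re (c * l) * (1 - r) >= - e.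
    rewrite /r opprB addrCA subrr addr0.
    have : Num.min (1 / 2) (e / M) * `|complex.Re (c * l)| <= e.
      apply: le_trans (ler_wpM2r (normr_ge0 _) m2) _.
      rewrite mulrAC ler_pdivrMr// ler_wpM2l ?(ltW e0)// /M lerDl//.
    move: (Num.min _ _) m0 => m m0 hm.
    have := ler_norm (complex.Re (c * l)); rewrite -(ler_pM2l m0); lra.
  lra.
have [->|l0] := eqVneq l 0; first by rewrite cabs0 mulr_ge0// f0// cabs0.
have cl : cabs l != 0 by rewrite cabs_eq0.
have := Rel ((cabs l)^-1%:C * l^*%C).
have cJ : cabs l^*%C = cabs l by case: (l) => a b; rewrite /cabs /= sqrrN.
rewrite cabsM cabs_real cJ ger0_norm ?invr_ge0 ?cabs_ge0// mulVf// => /(_ erefl).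
rewrite -mulrA cReMr.
have -> : complex.Re (l^*%C * l) = cabs l ^+ 2 by rewrite sqr_cabs; case: (l) => a b /=; ring.
by rewrite expr2 mulKf.
Qed.

End HalfPlaneSchwarz.

(** * Thin triangles and geodesics *)

Section MetricGeometry.
Variables (R : realType) (T : Type) (X : set T) (d : T -> T -> R).

Definition metric_on := [/\ forall x, X x -> d x x = 0,
  forall x y, X x -> X y -> d x y = d y x &
  forall x y z, X x -> X y -> X z -> d x z <= d x y + d y z].

Definition geodesic_from x y (g : R -> T) :=
  [/\ geodesic X d 0 (d x y) g, g 0 = x & g (d x y) = y].

Lemma geodesicP a b (g : R -> T) : geodesic X d a b g <->
  [/\ a <= b, forall t, a <= t <= b -> X (g t) &
    forall s t, a <= s <= b -> a <= t <= b -> d (g s) (g t) = `|s - t|].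
Proof.
split=> -[ab gX gd]; split=> //.
- by move=> t ht; apply: gX; exists t => //=; rewrite in_itv.
- by move=> s t hs ht; apply: gd; rewrite inE/= in_itv.
- by move=> _ [t /= + <-]; rewrite in_itv/=; exact: gX.
- by move=> s t; rewrite !inE/= !in_itv/=; exact: gd.
Qed.

Hypothesis metr : metric_on.

Lemma metric_ge0 x y : X x -> X y -> 0 <= d x y.
Proof.
move=> hx hy; case: metr => [d0 ds dt].
by have := dt x y x hx hy hx; rewrite d0// (ds y x)//; lra.
Qed.

Lemma geodesic_fromP x y g : X x -> X y -> geodesic_from x y g ->
  forall s, 0 <= s <= d x y -> [/\ X (g s), d x (g s) = s & d (g s) y = d x y - s].
Proof.
move=> hx hy [/geodesicP[L0 gX gd] g0 g1] s hs; have /andP[s0 s1] := hs.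
split; first exact: gX.
- by rewrite -{1}g0 gd ?lexx// sub0r normrN ger0_norm.
- by rewrite -{1}g1 gd ?lexx ?andbT// distrC ger0_norm// subr_ge0.
Qed.

Section Thin.
Variable delta : R.
Hypothesis hdelta : forall a b (g : 'I_3 -> R -> T), geodesic_triangle X d a b g ->
  forall i, side a b g i `<=`
    neighbourhood X d delta (\bigcup_(j in [set j | j != i]) side a b g j).

(** The third side of a [geodesic_triangle] has to be traversed backwards to close
    the cycle; here the two sides from [x] keep their natural parametrization. *)
Lemma thin_triangle x y z s r t : X x -> X y -> X z ->
  geodesic_from x y s -> geodesic_from y z r -> geodesic_from x z t ->
  forall u, 0 <= u <= d x y -> exists w, [/\ X w, d (s u) w < delta &
    (exists2 v, 0 <= v <= d y z & w = r v) \/ (exists2 v, 0 <= v <= d x z & w = t v)].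
Proof.
move=> hx hy hz gs gr gt u hu.
pose a := fun _ : 'I_3 => 0 : R.
pose b := fun i : 'I_3 => nth 0 [:: d x y; d y z; d x z] i.
pose g := fun i : 'I_3 => nth s [:: s; r; fun v => t (d x z - v)] i.
have tri : geodesic_triangle X d a b g.
  have [s1 s4 s5] := gs; have [r1 r4 r5] := gr.
  have [/geodesicP[t1 t2 t3] t4 t5] := gt.
  have tmem v : 0 <= v <= d x z -> 0 <= d x z - v <= d x z by lra.
  split.
    case=> [[|[|[|//]]] hi]; rewrite /a /b /g //=; apply/geodesicP; split => //.
      by move=> v /tmem; exact: t2.
    by move=> u1 u2 h1 h2; rewrite t3 ?tmem// distrC; congr (`|_|); lra.
  by case=> [[|[|[|//]]] hi]; rewrite /a /b /g /= ?subrr ?subr0 ?s4 ?s5 ?r4 ?r5 ?t4 ?t5.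
have sid : side a b g ord0 (s u) by exists u => //=; rewrite in_itv.
have [sX [w [j /= j0] [v /= hv <-]] dw] := hdelta tri sid.
exists (g j v); split=> //.
  by have /geodesicP[_ gX _] := tri.1 j; apply: gX; move: hv; rewrite in_itv.
move: hv; rewrite in_itv /=; clear dw.
case: j j0 => [[|[|[|//]]] hi] j0 //= hv; [by left; exists v|right].
exists (d x z - v) => //; move: hv; rewrite /a /b /=; lra.
Qed.

Hypothesis geod : forall x y, X x -> X y -> exists g, geodesic_from x y g.
Variable b : T -> R.
Hypothesis b_lip : forall x y, X x -> X y -> b x - b y <= d x y.

(** The triangle with vertices [o], [x], [x'] is degenerate up to a constant, because
    the height [b] is 1-Lipschitz and the segments [o x] and [x x'] climb at unit
    speed up to [C]. Thinness of the triangle then places the point [g U] close to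
    one of the sides through [x], and the height of [g U] forces it to be close to
    [x] itself. *)
Lemma geodesic_near (o x x' : T) (g : R -> T) (U U' C : R) : X o -> X x -> X x' ->
  geodesic_from o x' g -> b o = 0 -> b x = U -> b x' = U' -> 0 <= U <= U' ->
  d o x <= U + C -> d x x' <= U' - U + C -> d o x' <= U' + C ->
  [/\ U <= d o x', X (g U), b (g U) <= U & d (g U) x <= 2 * C + 2 * delta].
Proof.
move=> ho hx hx' gg bo bx bx' /andP[U0 UU'] h1 h2 h3.
have [d0 ds dt] := metr.
have UL : U <= d o x' by have := b_lip hx' ho; rewrite ds//; lra.
have /(geodesic_fromP ho hx' gg)[zX oz zx'] : 0 <= U <= d o x' by rewrite U0.
set z := g U in zX oz zx' *.
have bz : b z <= U by have := b_lip zX ho; rewrite ds//; lra.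
split=> //.
have bz' : U - C <= b z by have := b_lip hx' zX; rewrite ds//; lra.
have [r gr] := geod hx' hx; have [t gt] := geod ho hx.
have hU : 0 <= U <= d o x' by rewrite U0.
have [w [wX zw H]] := thin_triangle ho hx' hx gg gr gt hU.
have dl0 : 0 <= delta by apply: le_trans (ltW zw); exact: metric_ge0.
have C0 : 0 <= C by have := b_lip hx ho; rewrite ds//; lra.
have wz1 := b_lip wX zX; have wz2 := b_lip zX wX.
rewrite (ds w z)// in wz1.
have tri := dt z w x zX wX hx.
case: H => [[v hv wE]|[v hv wE]].
  have [_ k1 k2] := geodesic_fromP hx' hx gr hv; rewrite -wE in k1 k2.
  have := b_lip hx' wX; rewrite (ds x' x)// in k2 hv; rewrite -/z in zw; lra.
have [_ k1 k2] := geodesic_fromP ho hx gt hv; rewrite -wE in k1 k2.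
have := b_lip wX ho; rewrite (ds w o)//; rewrite -/z in zw; lra.
Qed.

(** Consider a tall triangle with vertices [x 0], [x V], [y V]. Points of the side
    from [x V] to [y V] have height at least [V - d (x V) (y V) / 2], which exceeds
    [U] when [V] is large because [lam < 2]. So at height [U] thinness can only come
    from the two long sides, which are close to [x U] and [y U] by [geodesic_near]. *)
Theorem fellow_travel (x y : R -> T) (C lam : R) : 0 <= lam < 2 ->
  (forall U : R, 0 <= U -> [/\ X (x U), X (y U), b (x U) = U & b (y U) = U]) ->
  (forall U V : R, 0 <= U <= V -> d (x U) (x V) <= V - U + C /\ d (y U) (y V) <= V - U + C) ->
  (forall U : R, 0 <= U -> d (x U) (y U) <= lam * U + C) ->
  exists M, forall U : R, 0 <= U -> d (x U) (y U) <= M.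
Proof.
move=> /andP[lam0 lam2] xy up xyd.
have [d0 ds dt] := metr.
have C0 : 0 <= C.
  have [hX _ _ _] := xy 0 (lexx _).
  have h00 : 0 <= (0 : R) <= 0 by rewrite lexx.
  by have [+ _] := up _ _ h00; rewrite d0//; lra.
exists (2 * (2 * (2 * C) + 2 * delta) + 2 * delta) => U U0.
have dl0 : 0 <= delta.
  have [hX _ _ _] := xy 0 (lexx _); have [g gg] := geod hX hX.
  have h0 : 0 <= (0 : R) <= d (x 0) (x 0) by rewrite d0// lexx.
  have [w [wX h _]] := thin_triangle hX hX hX gg gg gg h0.
  have [gX _ _] := geodesic_fromP hX hX gg h0.
  by apply: le_trans (ltW h); exact: metric_ge0.
(* [V] solves [V - (lam V + C) / 2 = U + delta + 1]: the third side stays higher than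
   [U + delta]. *)
pose V := (U + C / 2 + delta + 1) / (1 - lam / 2).
have l1 : 0 < 1 - lam / 2 by lra.
have VE : V * (1 - lam / 2) = U + C / 2 + delta + 1 by rewrite /V divfK// gt_eqF.
have UV : U <= V.
  rewrite -(ler_pM2r l1) VE; have : 0 <= U * (lam / 2) by rewrite mulr_ge0// divr_ge0.
  lra.
have V0 : 0 <= V by exact: le_trans U0 UV.
have [x0 y0 bx0 by0] := xy 0 (lexx _); have [xU yU bxU byU] := xy U U0.
have [xV yV bxV byV] := xy V V0.
have [x0U y0U] : d (x 0) (x U) <= U - 0 + C /\ d (y 0) (y U) <= U - 0 + C.
  by apply: up; rewrite lexx.
have [x0V y0V] : d (x 0) (x V) <= V - 0 + C /\ d (y 0) (y V) <= V - 0 + C.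
  by apply: up; rewrite lexx.
have [xUV yUV] : d (x U) (x V) <= V - U + C /\ d (y U) (y V) <= V - U + C.
  by apply: up; rewrite U0.
have xy0 : d (x 0) (y 0) <= lam * 0 + C by exact: xyd.
have oyU : d (x 0) (y U) <= U + 2 * C by have := dt _ _ _ x0 y0 yU; lra.
have oyV : d (x 0) (y V) <= V + 2 * C by have := dt _ _ _ x0 y0 yV; lra.
have [s gs] := geod x0 xV; have [t gt] := geod x0 yV; have [r gr] := geod xV yV.
have hUV : 0 <= U <= V by rewrite U0.
have [Us sX bs ds'] : [/\ U <= d (x 0) (x V), X (s U), b (s U) <= U &
   d (s U) (x U) <= 2 * (2 * C) + 2 * delta].
  by apply: (geodesic_near x0 xU xV gs bx0 bxU bxV hUV); lra.
have [Ut tX bt dt'] : [/\ U <= d (x 0) (y V), X (t U), b (t U) <= U &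
   d (t U) (y U) <= 2 * (2 * C) + 2 * delta].
  by apply: (geodesic_near x0 yU yV gt bx0 byU byV hUV); lra.
have st : d (s U) (t U) <= 2 * delta.
  have hU : 0 <= U <= d (x 0) (x V) by rewrite U0.
  have [w [wX sw H]] := thin_triangle x0 xV yV gs gr gt hU.
  have [_ os _] := geodesic_fromP x0 xV gs hU.
  have hU' : 0 <= U <= d (x 0) (y V) by rewrite U0.
  case: H => [[v hv wE]|[v hv wE]].
    have [_ k1 k2] := geodesic_fromP xV yV gr hv; rewrite -wE in k1 k2.
    exfalso.
    have := b_lip xV wX; have := b_lip yV wX; have := b_lip wX sX.
    rewrite (ds w (s U))// (ds (y V) w)//.
    have := xyd _ V0; have : V * (1 - lam / 2) = V - lam * V / 2 by field.
    by rewrite VE; lra.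
  have [_ k1 k2] := geodesic_fromP x0 yV gt hv; rewrite -wE in k1 k2.
  have wt : d w (t U) = `|v - U|.
    by rewrite wE; case: gt => [/geodesicP[_ _ g3] _ _]; exact: g3.
  have h1 := dt _ _ _ x0 sX wX; have h2 := dt _ _ _ x0 wX sX.
  rewrite (ds w (s U))// in h2.
  have h3 : `|v - U| <= delta by rewrite ler_norml; lra.
  by have := dt _ _ _ sX wX tX; lra.
have h1 := dt _ _ _ xU sX yU; have h2 := dt _ _ _ sX tX yU.
by rewrite (ds (x U) (s U))// in h1; lra.
Qed.

End Thin.
End MetricGeometry.

Section GeodesicExistence.
Variables (R : realType) (T : topologicalType) (X : set T) (d : T -> T -> R).
Hypothesis metr : metric_on X d.
Hypothesis separated : forall x y, X x -> X y -> d x y = 0 -> x = y.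
Hypothesis split_mid : forall x y s t e, X x -> X y -> 0 <= s -> 0 <= t ->
  d x y = s + t -> 0 < e -> exists z, [/\ X z, d x z <= s + e & d z y <= t + e].
Hypothesis ball_compact : forall x r, X x -> compact [set z | X z /\ d x z <= r].
Hypothesis ball_closed : forall x r, X x -> closed [set z | X z /\ d x z <= r].

(** For two points of [A] on either side of [t], the condition on [z] cuts out an
    intersection of two closed balls with radii adding up to the distance of their
    centres. Enlarged by [e] these are non-empty by [split_mid], and they decrease
    as the two points approach [t]; compactness gives a common point. *)
Lemma isometry_extension (A : set (R * T)) (s0 s1 t : R) (x0 x1 : T) :
  (forall u, A u -> X u.2) ->
  (forall u v, A u -> A v -> d u.2 v.2 = `|u.1 - v.1|) ->
  A (s0, x0) -> A (s1, x1) -> s0 <= t <= s1 ->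
  exists2 z, X z & forall u, A u -> d u.2 z = `|u.1 - t|.
Proof.
move=> AX Ad A0 A1 /andP[h0 h1].
have [d0 ds dt] := metr.
pose I := [set i : (R * T) * (R * T) * R | [/\ A i.1.1, A i.1.2, i.1.1.1 <= t,
   t <= i.1.2.1 & 0 < i.2]].
pose B (i : (R * T) * (R * T) * R) := [set z | X z /\ d i.1.1.2 z <= t - i.1.1.1 + i.2] `&`
   [set z | X z /\ d i.1.2.2 z <= i.1.2.1 - t + i.2].
have FF : Filter (filter_from I B).
  apply: filter_from_filter; first by exists ((s0, x0), (s1, x1), 1); split=> //=.
  move=> [[[a xa] [c xc]] e] [[[a' xa'] [c' xc']] e'] /= [/= k1 k2 k3 k4 k5] [/= l1 l2 l3 l4 l5].
  have [[m xm] [Am ma ma' mt]] : exists u, [/\ A u, a <= u.1, a' <= u.1 & u.1 <= t].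
    by have [aa|/ltW aa] := leP a a'; [exists (a', xa')|exists (a, xa)]; split.
  have [[n xn] [An nc nc' nt]] : exists u, [/\ A u, u.1 <= c, u.1 <= c' & t <= u.1].
    by have [aa|/ltW aa] := leP c c'; [exists (c, xc)|exists (c', xc')]; split.
  simpl in *.
  exists ((m, xm), (n, xn), Num.min e e'); first by split=> //=; rewrite lt_min k5.
  have e1 : Num.min e e' <= e by rewrite ge_min lexx.
  have e2 : Num.min e e' <= e' by rewrite ge_min lexx orbT.
  have key1 a1 xa1 z : A (a1, xa1) -> a1 <= m -> X z -> d xm z <= t - m + Num.min e e' ->
      d xa1 z <= t - a1 + Num.min e e'.
    move=> A1' am zX hz; have := dt _ _ _ (AX _ A1') (AX _ Am) zX => /=.
    by have := Ad _ _ A1' Am; rewrite /= distrC ger0_norm ?subr_ge0// => ->; lra.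
  have key2 a1 xa1 z : A (a1, xa1) -> n <= a1 -> X z -> d xn z <= n - t + Num.min e e' ->
      d xa1 z <= a1 - t + Num.min e e'.
    move=> A1' am zX hz; have := dt _ _ _ (AX _ A1') (AX _ An) zX => /=.
    by have := Ad _ _ A1' An; rewrite /= ger0_norm ?subr_ge0// => ->; lra.
  move=> z [[/= zX q1] [_ /= q2]]; split; split; split => //=.
  - by apply: le_trans (key1 _ _ z k1 ma zX q1) _; rewrite lerD2l.
  - by apply: le_trans (key2 _ _ z k2 nc zX q2) _; rewrite lerD2l.
  - by apply: le_trans (key1 _ _ z l1 ma' zX q1) _; rewrite lerD2l.
  - by apply: le_trans (key2 _ _ z l2 nc' zX q2) _; rewrite lerD2l.
have PF : ProperFilter (filter_from I B).
  apply: filter_from_proper => -[[[a xa] [c xc]] e] [/= k1 k2 k3 k4 k5].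
  have dac : d xa xc = (t - a) + (c - t).
    by rewrite (Ad _ _ k1 k2) /= distrC ger0_norm; lra.
  have ta : 0 <= t - a by lra.
  have ct : 0 <= c - t by lra.
  have [z [zX z1 z2]] := split_mid (AX _ k1) (AX _ k2) ta ct dac k5.
  by exists z; split; split=> //=; rewrite ds//; exact: (AX _ k2).
have i0I : I ((s0, x0), (s1, x1), 1) by split=> //=.
have [z [/= _ zcl]] := @ball_compact x0 (t - s0 + 1) (AX _ A0) _ PF
   (ex_intro2 _ _ _ i0I (@subIsetl _ _ _)).
rewrite clusterE in zcl.
have zB i : I i -> B i z.
  move=> Ii; have : closure (B i) z by apply: zcl; exists i.
  rewrite -(closure_id _).1//; apply: closedI; apply: ball_closed.
    by have [k _ _ _ _] := Ii; exact: (AX _ k).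
  by have [_ k _ _ _] := Ii; exact: (AX _ k).
have zX : X z by have [[]] := zB _ i0I.
exists z => // -[s x] Au /=.
have xX : X x := AX _ Au.
have le1 s' x' : A (s', x') -> d x' z <= `|s' - t|.
  move=> A'; apply/ler_addgt0Pr => e e0.
  have [st|/ltW st] := leP s' t.
    have [[_ /= h] _] : B ((s', x'), (s1, x1), e) z by apply: zB; split.
    by rewrite distrC ger0_norm// subr_ge0.
  have [_ [_ /= h]] : B ((s0, x0), (s', x'), e) z by apply: zB; split.
  by rewrite ger0_norm// subr_ge0.
apply/eqP; rewrite eq_le le1//=.
have := le1 _ _ Au; have := le1 _ _ A0; have := le1 _ _ A1.
have := dt _ _ _ xX zX (AX _ A0); have := dt _ _ _ xX zX (AX _ A1).
rewrite (ds z x0)//; last exact: (AX _ A0).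
rewrite (ds z x1)//; last exact: (AX _ A1).
rewrite /= (Ad _ _ Au A0) (Ad _ _ Au A1) /=.
have n1 : `|s1 - t| = s1 - t by rewrite ger0_norm// subr_ge0.
have n0 : `|s0 - t| = t - s0 by rewrite distrC ger0_norm// subr_ge0.
have := ler_norm (s - s0); have := ler_norm (s1 - s); rewrite n1 n0 (distrC s s1).
have [st|/ltW st] := leP s t.
  by rewrite (distrC s t) (ger0_norm (_ : 0 <= t - s)) ?subr_ge0//; lra.
by rewrite (ger0_norm (_ : 0 <= s - t)) ?subr_ge0//; lra.
Qed.

(** A Hopf-Rinow theorem without iterated midpoints: by Zorn's lemma there is a
    maximal graph of a partial isometry from the interval to [X] through the two
    end points, and [isometry_extension] shows that it is defined everywhere. *)
Theorem geodesic_exists x y : X x -> X y -> exists g, geodesic_from X d x y g.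
Proof.
move=> hx hy; have [d0 ds dt] := metr.
set L := d x y; have L0 : 0 <= L := metric_ge0 metr hx hy.
pose E (A : set (R * T)) := A `|` [set (0, x)] `|` [set (L, y)].
pose P (A : set (R * T)) := (forall u, E A u -> X u.2 /\ 0 <= u.1 <= L) /\
  (forall u v, E A u -> E A v -> d u.2 v.2 = `|u.1 - v.1|).
have [A [[AX Ad] Amax]] : exists A, P A /\ forall B, A `<` B -> ~ P B.
  apply: Zorn_bigcup => F FP Ftot.
  have base : P set0.
    split=> [u [[//|->]|->]|u v [[//|->]|->] [[//|->]|->]] /=; rewrite ?lexx ?L0 ?subrr ?normr0 ?d0//.
      by rewrite sub0r normrN ger0_norm.
    by rewrite subr0 ger0_norm// ds.
  have big u : E (\bigcup_(A in F) A) u -> exists2 A, P A & E A u /\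
      (A = set0 \/ F A).
    move=> [[[A FA Au]|h]|h].
    - by exists A; [exact: FP|split; [left; left|right]].
    - by exists set0 => //; split; [left; right|left].
    - by exists set0 => //; split; [right|left].
  have mono A B u : A `<=` B -> E A u -> E B u.
    by move=> AB [[h|h]|h]; [left; left; exact: AB|left; right|right].
  split=> [u /big[A [PA _] [Au _]]|u v /big[A PA [Au FA]] /big[B PB [Bv FB]]]; first exact: PA.
  have [AB|BA] : A `<=` B \/ B `<=` A.
    case: FA => [->|FA]; first by left.
    by case: FB => [->|FB]; [right|exact: Ftot].
  - by apply: PB.2 => //; exact: mono Au.
  - by apply: PA.2 => //; exact: mono Bv.
have EA0 : E A (0, x) by left; right.
have EA1 : E A (L, y) by right.
have total t : 0 <= t <= L -> exists z, E A (t, z).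
  move=> ht.
  have [z zX hz] := isometry_extension (fun u Eu => (AX u Eu).1) Ad EA0 EA1 ht.
  exists z; apply: contrapT => nE; apply: (Amax (A `|` [set (t, z)])).
    split; first by left.
    by move=> /(_ (t, z)) h; apply: nE; left; left; apply: h; right.
  have sub u : E (A `|` [set (t, z)]) u -> E A u \/ u = (t, z).
    by case=> [[[h|h]|h]|h]; [left; left; left|right|left; left; right|left; right].
  split=> [u /sub[h|->]|u v /sub[hu|->] /sub[hv|->]] /=; [exact: AX|by []|exact: Ad| | |].
  - exact: hz.
  - by rewrite ds ?hz// 1?distrC//; exact: (AX _ hv).1.
  - by rewrite d0// subrr normr0.
have /choice[g gP] : forall t, exists z, 0 <= t <= L -> E A (t, z).
  move=> t; have [h|h] := pselect (0 <= t <= L).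
    by have [z hz] := total _ h; exists z.
  by exists x.
have i0 : 0 <= (0 : R) <= L by rewrite lexx.
have i1 : 0 <= L <= L by rewrite lexx L0.
(* The graph relates 0 to [x] and [L] to [y], but the chosen section need not pick
   these values before it is known that the graph is single-valued. *)
pose h t := if t == 0 then x else if t == L then y else g t.
have hP t : 0 <= t <= L -> E A (t, h t).
  rewrite /h; have [->//|t0] := eqVneq t 0.
  by have [->//|tL] := eqVneq t L; exact: gP.
exists h; split.
- apply/geodesicP; split=> // [t /hP/AX[]//|s t /hP hs /hP ht].
  exact: (Ad _ _ hs ht).
- by rewrite /h eqxx.
- rewrite /h -/L; have [L00|L00] := eqVneq L 0; last by rewrite eqxx.
  exact: separated.
Qed.

End GeodesicExistence.

(** * Norms and inner products on complex vectors *)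

Section Vectors.
Variables (R : realType) (n : nat).
Local Notation V := 'rV[R[i]]_n.
Implicit Types (z w p q a : V) (D : set V).

(** The norm of a complex vector is an element of [R[i]]; this is its real value. *)
Definition vnorm z : R := complex.Re `|z|.

Lemma vnormE z : `|z| = (vnorm z)%:C.
Proof. by rewrite RRe_real// normr_real. Qed.

Lemma vnorm_ge0 z : 0 <= vnorm z.
Proof. by rewrite -lecR -vnormE normr_ge0. Qed.

Lemma vnormD z w : vnorm (z + w) <= vnorm z + vnorm w.
Proof. by rewrite -lecR rmorphD /= -!vnormE ler_normD. Qed.

Lemma vnormN z : vnorm (- z) = vnorm z.
Proof. by rewrite /vnorm normrN. Qed.

Lemma vnormZ (c : R[i]) z : vnorm (c *: z) = cabs c * vnorm z.
Proof. by apply: complexI; rewrite rmorphM /= -!vnormE normrZ. Qed.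

Lemma vnorm0 : vnorm 0 = 0. Proof. by rewrite /vnorm normr0. Qed.

Lemma vnorm_eq0 z : (vnorm z == 0) = (z == 0).
Proof. by rewrite -[RHS]normr_eq0 vnormE; apply/eqP/eqP => [->//|/complexI]. Qed.

Lemma vnorm_lt z (r : R) : (`|z| < r%:C) = (vnorm z < r).
Proof. by rewrite vnormE ltcR. Qed.

Lemma nbhs_vecP p (A : set V) :
  nbhs p A <-> exists2 r : R, 0 < r & forall w, vnorm w < r -> A (p + w).
Proof.
split=> [/nbhs_ballP[e /= e0 h]|[r r0 h]].
  have eE : e = (complex.Re e)%:C by rewrite RRe_real// gtr0_real.
  exists (complex.Re e); first by rewrite -ltcR -eE.
  move=> w hw; apply: h; rewrite -ball_normE /= eE opprD addNKr normrN.
  by rewrite vnorm_lt.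
apply/nbhs_ballP; exists r%:C => /=; first by rewrite ltcR.
move=> w; rewrite -ball_normE /= -opprB normrN vnorm_lt => /h.
by rewrite addrC subrK.
Qed.

Lemma open_vecP D p : open D -> D p ->
  exists2 r : R, 0 < r & forall w, vnorm w < r -> D (p + w).
Proof. by move=> oD Dp; apply/nbhs_vecP; exact: open_nbhs_nbhs. Qed.

Lemma closure_vecP D p : closure D p <->
  forall r : R, 0 < r -> exists2 w, vnorm w < r & D (p + w).
Proof.
split=> [cl r r0|h A /nbhs_vecP[r r0 rA]].
  have /cl[q [Dq /= hq]] : nbhs p [set q | vnorm (q - p) < r].
    by apply/nbhs_vecP; exists r => // w wr; rewrite /= addrC addKr.
  by exists (q - p) => //; rewrite addrC subrK.
by have [w wr Dw] := h r r0; exists (p + w); split=> //; exact: rA.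
Qed.

Lemma bounded_vecP D : bounded_set D -> exists2 M : R, 0 < M & forall z, D z -> vnorm z <= M.
Proof.
move=> [M [Mr h]]; exists (`|complex.Re M| + 1); first by rewrite ltr_wpDl.
move=> z Dz; rewrite -lecR -vnormE; apply: h => //.
rewrite -[M]RRe_real// ltcR (le_lt_trans (ler_norm _))// ltrDl//.
Qed.

(** [hdot] is the Hermitian product, [rdot] the Euclidean product of the underlying
    real space and [esq] the squared Euclidean norm, while [vnorm] is the maximum
    norm that defines the topology. *)
Definition hdot z a : R[i] := \sum_j z 0 j * (a 0 j)^*.
Definition rdot z w : R := complex.Re (hdot z w).
Definition esq z : R := rdot z z.

Lemma Re_sum (I : finType) (F : I -> R[i]) :
  complex.Re (\sum_i F i) = \sum_i complex.Re (F i).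
Proof. by rewrite -(raddf_sum (@complex.Re R : Rcomplex R -> R)). Qed.

Lemma hdotDl z w a : hdot (z + w) a = hdot z a + hdot w a.
Proof. by rewrite /hdot -big_split; apply: eq_bigr => j _; rewrite mxE mulrDl. Qed.

Lemma hdotZl c z a : hdot (c *: z) a = c * hdot z a.
Proof. by rewrite /hdot mulr_sumr; apply: eq_bigr => j _; rewrite mxE mulrA. Qed.

Lemma hdotNl z a : hdot (- z) a = - hdot z a.
Proof. by rewrite -scaleN1r hdotZl mulN1r. Qed.

Lemma hdotC z a : hdot z a = (hdot a z)^*.
Proof.
rewrite /hdot rmorph_sum; apply: eq_bigr => j _.
by rewrite rmorphM /= conjcK mulrC.
Qed.

Lemma rdotE z w : rdot z w = \sum_j (complex.Re (z 0 j) * complex.Re (w 0 j) +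
  complex.Im (z 0 j) * complex.Im (w 0 j)).
Proof.
rewrite /rdot /hdot Re_sum; apply: eq_bigr => j _.
by case: (z 0 j) (w 0 j) => a b [c d]; rewrite cReM /= mulrN opprK.
Qed.

Lemma rdotC z w : rdot z w = rdot w z.
Proof. by rewrite /rdot hdotC; case: (hdot w z). Qed.

Lemma rdotDl z w a : rdot (z + w) a = rdot z a + rdot w a.
Proof. by rewrite /rdot hdotDl cReD. Qed.
Lemma rdotNl z a : rdot (- z) a = - rdot z a.
Proof. by rewrite /rdot hdotNl cReN. Qed.
Lemma rdotBl z w a : rdot (z - w) a = rdot z a - rdot w a.
Proof. by rewrite rdotDl rdotNl. Qed.
Lemma rdotZl (c : R) z a : rdot (c%:C *: z) a = c * rdot z a.
Proof. by rewrite /rdot hdotZl cReMr. Qed.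
Lemma rdotDr z w a : rdot a (z + w) = rdot a z + rdot a w.
Proof. by rewrite rdotC rdotDl !(rdotC a). Qed.
Lemma rdotNr z a : rdot a (- z) = - rdot a z.
Proof. by rewrite rdotC rdotNl !(rdotC a). Qed.
Lemma rdotZr (c : R) z a : rdot a (c%:C *: z) = c * rdot a z.
Proof. by rewrite rdotC rdotZl !(rdotC a). Qed.

Lemma rdot0l a : rdot 0 a = 0.
Proof. by rewrite -[0](scale0r (0 : V)) -[0%R in LHS]/((0 : R)%:C) rdotZl mul0r. Qed.

Definition rdotE_lin := (rdotDl, rdotDr, rdotNl, rdotNr, rdotZl, rdotZr).

Lemma esqE z : esq z = \sum_j cabs (z 0 j) ^+ 2.
Proof. by rewrite /esq rdotE; apply: eq_bigr => j _; rewrite sqr_cabs. Qed.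

Lemma esq_ge0 z : 0 <= esq z.
Proof. by rewrite esqE sumr_ge0// => j _; rewrite sqr_ge0. Qed.

Lemma esqD z w : esq (z + w) = esq z + 2 * rdot z w + esq w.
Proof. by rewrite /esq !rdotE_lin (rdotC w z); ring. Qed.

Lemma esqN z : esq (- z) = esq z.
Proof. by rewrite /esq !rdotE_lin opprK. Qed.

Lemma esqZ (c : R[i]) z : esq (c *: z) = cabs c ^+ 2 * esq z.
Proof.
rewrite !esqE mulr_sumr; apply: eq_bigr => j _.
by rewrite mxE cabsM exprMn.
Qed.

Lemma cabs_le_vnorm z j : cabs (z 0 j) <= vnorm z.
Proof.
apply/ler_addgt0Pr => e e0.
have : ball (0 : V) (vnorm z + e)%:C z.
  by rewrite -ball_normE /= sub0r normrN vnorm_lt ltrDl.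
move=> [_ /(_ 0 j)]; rewrite -ball_normE /= mxE sub0r normrN cabs_lt.
exact: ltW.
Qed.

Lemma vnorm_le z (M : R) : 0 <= M -> (forall j, cabs (z 0 j) <= M) -> vnorm z <= M.
Proof.
move=> M0 h; apply/ler_addgt0Pr => e e0; apply: ltW; rewrite -vnorm_lt -normrN -sub0r.
suff : ball (0 : V) (M + e)%:C z by rewrite -ball_normE.
split; first by rewrite ltcR; lra.
move=> i j; rewrite ord1 -ball_normE /= mxE sub0r normrN cabs_lt.
by apply: le_lt_trans (h j) _; lra.
Qed.

Lemma vnorm_sqr_le z : vnorm z ^+ 2 <= esq z.
Proof.
rewrite -(sqr_sqrtr (esq_ge0 z)) ler_pXn2r ?nnegrE ?vnorm_ge0 ?sqrtr_ge0//.
apply: vnorm_le; first exact: sqrtr_ge0.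
move=> j; rewrite -[leLHS]ger0_norm ?cabs_ge0// -sqrtr_sqr ler_wsqrtr// esqE.
by rewrite (bigD1 j)//= lerDl sumr_ge0// => k _; rewrite sqr_ge0.
Qed.

Lemma esq_eq0 z : esq z = 0 -> z = 0.
Proof.
move=> h; apply/eqP; rewrite -vnorm_eq0 -sqrf_eq0; apply/eqP/le_anti.
by rewrite sqr_ge0 andbT -h vnorm_sqr_le.
Qed.

Lemma hdot_bound z a : cabs (hdot z a) <= n%:R * vnorm a * vnorm z.
Proof.
have sumle (I : finType) (F : I -> R[i]) : cabs (\sum_i F i) <= \sum_i cabs (F i).
  by elim/big_ind2: _ => [|x1 x2 y1 y2 h1 h2|//]; rewrite ?cabs0//; apply: le_trans (cabsD _ _) (lerD h1 h2).
apply: le_trans (sumle _ _) _.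
apply: (@le_trans _ _ (\sum_(j < n) vnorm a * vnorm z)).
  apply: ler_sum => j _; rewrite cabsM mulrC.
  have -> : cabs (a 0 j)^* = cabs (a 0 j) by case: (a 0 j) => x y; rewrite /cabs /= sqrrN.
  by apply: ler_pM; rewrite ?cabs_ge0// cabs_le_vnorm.
by rewrite sumr_const card_ord -[leRHS]mulrA mulr_natl.
Qed.

End Vectors.

(** * Discs that compete for the Kobayashi metric *)

Section KobayashiMetric.
Variables (R : realType) (n : nat).
Local Notation V := 'rV[R[i]]_n.
Implicit Types (p q a v : V) (D : set V) (f : R[i] -> V).

(** The competitors in the definition of the Kobayashi metric: the affine disc of
    radius [r] in the direction [v] makes [r^-1] admissible. *)
Definition admissible D p v (alpha : R) := 0 < alpha /\ exists f,
  [/\ forall z, cabs z < 1 -> derivable f z 1, forall z, cabs z < 1 -> D (f z),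
      f 0 = p & is_derive (0 : R[i]) 1 f (alpha^-1%:C *: v)].

(** The real-valued Kobayashi metric; it is the extended one as soon as some value
    is admissible, as for every point of an open set. *)
Definition kob D p v : R := inf [set alpha | admissible D p v alpha].

Lemma unit_discE (z : R[i]) : unit_disc z = (cabs z < 1).
Proof. by rewrite /unit_disc /= -[1 in LHS]/((1 : R)%:C) cabs_lt. Qed.

Lemma admissibleE D p v : [set alpha : R | 0 < alpha /\
    exists f : R[i] -> 'rV[R[i]]_n,
      [/\ holomorphic_disc f, f @` unit_disc `<=` D,
          f 0 = p & f^`() 0 = (alpha^-1)%:C *: v]] = [set alpha | admissible D p v alpha].
Proof.
apply/seteqP; split=> alpha [a0 [f [df fD f0 f1]]]; (split; first exact: a0); exists f; split.
- by move=> z z1; apply: df; rewrite unit_discE.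
- by move=> z z1; apply: fD; exists z; rewrite ?unit_discE.
- exact: f0.
- rewrite -f1 derive1E; apply: derivableP; apply: df.
  by rewrite unit_discE cabs0.
- by move=> z; rewrite unit_discE; exact: df.
- by move=> _ [z + <-]; rewrite unit_discE; exact: fD.
- exact: f0.
- by rewrite derive1E; case: f1.
Qed.

Lemma kobayashi_metric_kob D p v : (exists alpha, admissible D p v alpha) ->
  kobayashi_metric D p v = (kob D p v)%:E.
Proof.
move=> ex; rewrite /kobayashi_metric admissibleE ereal_inf_EFin//.
by exists 0 => a [a0 _]; exact: ltW.
Qed.

Lemma kob_lb D p v : has_lbound [set alpha | admissible D p v alpha].
Proof. by exists 0 => a [a0 _]; exact: ltW. Qed.

Lemma kob_le D p v alpha : admissible D p v alpha -> kob D p v <= alpha.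
Proof. by move=> h; apply: ge_inf => //; exact: kob_lb. Qed.

Lemma kob_lt D p v (beta : R) : (exists alpha, admissible D p v alpha) -> kob D p v < beta ->
  exists2 alpha, admissible D p v alpha & alpha < beta.
Proof.
move=> ex h; apply: contrapT => nE.
have : beta <= kob D p v.
  apply: lb_le_inf => // al hal; rewrite leNgt; apply/negP => lt; apply: nE.
  by exists al.
by rewrite leNgt h.
Qed.

Lemma kob_ge0 D p v : 0 <= kob D p v.
Proof.
have [ex|nex] := pselect (exists alpha, admissible D p v alpha).
  by apply: lb_le_inf => // a [a0 _]; exact: ltW.
rewrite /kob (_ : [set _ | _] = set0) ?inf0//.
by apply/seteqP; split=> // a ha; apply: nex; exists a.
Qed.

Lemma is_derive_affine (p u : V) (z : R[i]) : is_derive z 1 (fun w : R[i] => p + w *: u) u.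
Proof.
apply/is_derive_rowP => j.
rewrite (_ : (fun w => _) = (fun w : R[i] => p 0 j + w * u 0 j)); last first.
  by apply/funext => w; rewrite !mxE.
apply/cdiff_atP => e e0; exists 1 => // w _.
rewrite (_ : _ - _ - _ = 0); last by ring.
by rewrite cabs0 mulr_ge0 ?cabs_ge0// ltW.
Qed.

Lemma admissible_affine D p v (r : R) : 0 < r ->
  (forall z : R[i], cabs z < r -> D (p + z *: v)) -> admissible D p v r^-1.
Proof.
move=> r0 h; split; first by rewrite invr_gt0.
exists (fun z => p + z *: (r%:C *: v)); split.
- by move=> z _; have [] := is_derive_affine p (r%:C *: v) z.
- move=> z z1; rewrite scalerA; apply: h.
  by rewrite cabsM cabs_real gtr0_norm// -[ltRHS]mul1r ltr_pM2r.
- by rewrite scale0r addr0.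
- by rewrite invrK; exact: is_derive_affine.
Qed.

Lemma admissible_exists D p v : open D -> D p -> exists alpha, admissible D p v alpha.
Proof.
move=> oD Dp; have [r r0 hr] := open_vecP oD Dp.
have v0 : 0 < vnorm v + 1 by rewrite ltr_wpDl ?vnorm_ge0.
exists (r / (vnorm v + 1))^-1; apply: admissible_affine; first exact: divr_gt0.
move=> z; rewrite ltr_pdivlMr// => hz; apply: hr; rewrite vnormZ.
by apply: le_lt_trans hz; rewrite ler_wpM2l ?cabs_ge0// lerDl.
Qed.

(** A convex combination of the two discs, weighted so that both derivatives scale to
    [(al + be)^-1]: this is why the metric of a convex domain is subadditive in the
    vector. *)
Lemma admissible_add D p v (w : V) (al be : R) : convex D -> admissible D p v al ->
  admissible D p w be -> admissible D p (v + w) (al + be).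
Proof.
move=> /convexP cD [a0 [f [df fD f0 f1]]] [b0 [g [dg gD g0 g1]]].
have ab0 : 0 < al + be by exact: addr_gt0.
split=> //; pose t := al / (al + be).
have t1 : 1 - t = be / (al + be) by rewrite /t; field; rewrite gt_eqF.
exists (fun z => t%:C *: f z + (1 - t)%:C *: g z); split.
- move=> z z1; apply: (@derivableD _ _ _ (t%:C \*: f) ((1 - t)%:C \*: g)); apply: derivableZ; [exact: df|exact: dg].
- move=> z z1; apply: cD; [|exact: fD|exact: gD].
  by apply/andP; split; rewrite /t ?ler_pdivrMr// ?mul1r ?lerDl ?divr_ge0// ltW.
- by rewrite f0 g0 -scalerDl -rmorphD /= addrC subrK scale1r.
- have := is_deriveD (is_deriveZ (t%:C) f1) (is_deriveZ ((1 - t)%:C) g1).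
  rewrite !scalerA -!rmorphM /= t1 /t -!mulrA [_^-1 * al^-1]mulrC [_^-1 * be^-1]mulrC.
  by rewrite !mulVKf ?gt_eqF// -scalerDr.
Qed.

(** Contracting a disc towards a point [q] of the domain; the loss is the factor
    [1 - s]. *)
Lemma admissible_move D p q v (al s : R) : convex D -> 0 <= s < 1 -> D q ->
  admissible D p v al -> admissible D ((1 - s)%:C *: p + s%:C *: q) v (al / (1 - s)).
Proof.
move=> /convexP cD /andP[s0 s1] Dq [a0 [f [df fD f0 f1]]].
have s10 : 0 < 1 - s by rewrite subr_gt0.
split; first exact: divr_gt0.
exists (fun z => (1 - s)%:C *: f z + s%:C *: q); split.
- move=> z z1; apply: (@derivableD _ _ _ ((1 - s)%:C \*: f) (cst _)); last exact: derivable_cst.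
  by apply: derivableZ; exact: df.
- move=> z z1; rewrite -[in s%:C](subKr 1 s); apply: cD => //; [lra|exact: fD].
- by rewrite f0.
- have := is_deriveD (is_deriveZ ((1 - s)%:C) f1) (is_derive_cst (s%:C *: q) (0 : R[i]) (1 : R[i])).
  by rewrite addr0 scalerA -rmorphM /= invfM invrK mulrC.
Qed.

Lemma is_derive_hdot f (z : R[i]) (l a : V) : is_derive z 1 f l ->
  is_derive z 1 (fun w => hdot (f w) a) (hdot l a).
Proof.
move=> /is_derive_rowP h.
rewrite (_ : (fun w => _) = \sum_j ((a 0 j)^*%C \*: (fun w => f w 0 j))); last first.
  by apply/funext => w; rewrite fct_sumE; apply: eq_bigr => j _; rewrite /= mulrC.
rewrite (_ : hdot l a = \sum_j (a 0 j)^*%C *: l 0 j); last first.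
  by apply: eq_bigr => j _; rewrite -[_ *: _]/(_ * _) mulrC.
by apply: is_derive_sum => j; apply: is_deriveZ.
Qed.

(** Schwarz-Pick for the image of a disc under the functional [hdot _ a], which maps
    [D] into a half-plane. *)
Lemma admissible_lb D p v a (c al : R) : (forall z, D z -> c <= rdot z a) ->
  admissible D p v al -> cabs (hdot v a) <= 2 * (rdot p a - c) * al.
Proof.
move=> hD [a0 [f [df fD f0 f1]]].
pose F z := hdot (f z) a - c%:C.
have FD (z l : R[i]) : is_derive z 1 (fun w => hdot (f w) a) l -> is_derive z 1 F l.
  move=> hd; have := is_deriveB hd (is_derive_cst (c%:C : R[i]) z 1).
  by rewrite subr0.
have dF z : cabs z < 1 -> derivable F z 1.
  move=> z1; have /derivableP/(is_derive_hdot a)/FD[] := df _ z1; by [].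
have dF0 : cdiff_at F 0 (hdot (al^-1%:C *: v) a).
  by apply/cdiff_atP; apply: FD; exact: is_derive_hdot.
have F0 z : cabs z < 1 -> 0 <= complex.Re (F z).
  by move=> z1; rewrite cReD cReN /= subr_ge0; apply: hD; exact: fD.
have := halfplane_schwarz dF dF0 F0.
rewrite hdotZl cabsM cabs_real (gtr0_norm (_ : 0 < al^-1)) ?invr_gt0//.
by rewrite mulrC ler_pdivrMr// /F f0 cReD cReN.
Qed.

Lemma admissible_opp D p v (al : R) : admissible D p v al -> admissible D p (- v) al.
Proof.
move=> [a0 [f [df fD f0 f1]]]; split=> //; exists (fun z => f (- z)).
have N (z : R[i]) (l : V) : is_derive (- z) 1 f l -> is_derive z 1 (fun z => f (- z)) (- l).
  move=> /is_derive_rowP h; apply/is_derive_rowP => j.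
  have /cdiff_atP hj := h j; apply/cdiff_atP => e e0.
  have [r r0 hr] := hj _ e0; exists r => // w wr.
  have := hr (- w); rewrite -opprD cabsN => /(_ wr).
  by rewrite !mxE mulrN mulNr.
split.
- by move=> z z1; have [] := N z _ (derivableP (df (- z) (eq_ind_r (fun x => x < 1) z1 (cabsN z)))).
- by move=> z z1; apply: fD; rewrite cabsN.
- by rewrite oppr0.
- by rewrite scalerN; apply: N; rewrite oppr0.
Qed.

Lemma admissible_scale D p v (al c : R) : 0 < c ->
  admissible D p v al -> admissible D p (c%:C *: v) (c * al).
Proof.
move=> c0 [a0 [f [df fD f0 f1]]]; split; first exact: mulr_gt0.
exists f; split=> //; rewrite scalerA -rmorphM /= invfM mulrAC mulVf ?gt_eqF// mul1r.
exact: f1.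
Qed.

Lemma admissible_zero D p (al : R) : 0 < al -> D p -> admissible D p 0 al.
Proof.
move=> a0 Dp; split=> //; exists (cst p); split=> //.
by rewrite scaler0; exact: is_derive_cst.
Qed.

(** In the parameter plane the domain contains the round disc of radius [r] that is
    tangent at 0 to the imaginary axis. The Moebius map of the unit disc onto it
    that sends 0 to the point [t] has derivative [(r ^+ 2 - (r - t) ^+ 2) / r], which
    doubles the radius [t] of the affine disc, up to lower order. *)
Lemma admissible_round D p v (r t : R) : 0 < t < 2 * r ->
  (forall z : R[i], cabs (z - r%:C) < r -> D (p + z *: v)) ->
  admissible D (p + t%:C *: v) v (2 * t - t ^+ 2 / r)^-1.
Proof.
move=> /andP[t0 tr] hD.
have r0 : 0 < r by lra.
pose a : R := (t - r) / r.
have ar : a * r = t - r by rewrite /a mulfVK// gt_eqF.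
have a1 : `|a| < 1 by rewrite -(ltr_pM2r r0) -{1}(gtr0_norm r0) -normrM ar mul1r ltr_norml; lra.
have k0 : 0 < 2 * t - t ^+ 2 / r.
  rewrite (_ : _ - _ = t * (2 * r - t) / r); last by field; rewrite gt_eqF.
  by rewrite divr_gt0// mulr_gt0//; lra.
split; first by rewrite invr_gt0.
have den z : cabs z < 1 -> 1 + a%:C * z != 0.
  move=> z1; apply/eqP => /eqP; rewrite addrC addr_eq0 => /eqP h.
  have := cabsM a%:C z; rewrite h cabsN cabs1 cabs_real => e1.
  have : `|a| * cabs z < 1.
    have [->|z0] := eqVneq (cabs z) 0; first by rewrite mulr0.
    by rewrite -[ltRHS]mul1r ltr_pM// ?cabs_ge0.
  by rewrite -e1 ltxx.
pose h (z : R[i]) := r%:C + r%:C * ((z + a%:C) * (1 + a%:C * z)^-1).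
have dh z : cabs z < 1 -> is_derive z 1 h (r%:C * ((1 - a ^+ 2)%:C * (1 + a%:C * z) ^- 2)).
  move=> z1; have dn0 := den _ z1.
  have dd : is_derive z 1 (fun w : R[i] => 1 + a%:C * w) a%:C.
    have := is_deriveD (is_derive_cst (1 : R[i]) z 1) (is_deriveZ a%:C (is_derive_id z 1)).
    by rewrite add0r -[_ *: 1]/(_ * 1) mulr1.
  have dV : is_derive z 1 (fun w : R[i] => (1 + a%:C * w)^-1) (- (1 + a%:C * z) ^- 2 * a%:C).
    case: dd => dd1 dd2; split; first exact: derivableV.
    by rewrite deriveV// dd2.
  have dn : is_derive z 1 (fun w : R[i] => w + a%:C) 1.
    by have := is_deriveD (is_derive_id z 1) (is_derive_cst (a%:C : R[i]) z 1); rewrite addr0.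
  have dm := is_deriveM dn dV.
  have := is_deriveD (is_derive_cst (r%:C : R[i]) z 1) (is_deriveZ r%:C dm).
  rewrite add0r => H; apply: is_derive_eq H _.
  rewrite -![_ *: _]/(_ * _) rmorphB rmorphXn /=; congr (_ * _).
  by move: dn0; rewrite -[1%:C]/(1 : R[i]); move: (a%:C) => b dn0; field.
have hh (z : R[i]) (l : R[i]) : is_derive z 1 h l -> is_derive z 1 (fun w => p + h w *: v) (l *: v).
  move=> hl; apply/is_derive_rowP => j.
  rewrite (_ : (fun w => _) = cst (p 0 j) + (v 0 j \*: h)); last first.
    by apply/funext => w; rewrite !mxE /= mulrC.
  have := is_deriveD (is_derive_cst (p 0 j) z 1) (is_deriveZ (v 0 j) hl).
  by rewrite add0r mxE mulrC.
exists (fun z => p + h z *: v); split.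
- by move=> z z1; have [] := hh _ _ (dh _ z1).
- move=> z z1; apply: hD.
  rewrite /h addrC addKr !cabsM cabsV cabs_real (gtr0_norm r0) -[ltRHS]mulr1 ltr_pM2l//.
  rewrite ltr_pdivrMr ?cabs_gt0 ?den// mul1r -(ltr_pXn2r (ltn0Sn 1)) ?nnegrE ?cabs_ge0//.
  have a2 : a ^+ 2 < 1 by rewrite -real_normK ?num_real// expr_lt1.
  have z2 : cabs z ^+ 2 < 1 by rewrite expr_lt1 ?cabs_ge0.
  have : 0 < (1 - a ^+ 2) * (1 - cabs z ^+ 2) by rewrite mulr_gt0 ?subr_gt0.
  rewrite !sqr_cabs; case: (z) => x y; rewrite !(cReD, cImD, cReMr, cImMr) /=; lra.
- congr (_ + _ *: _); rewrite /h mulr0 addr0 invr1 mulr1 add0r -rmorphM -rmorphD /=.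
  by congr (_%:C); rewrite mulrC ar addrC subrK.
- have z1 : cabs (0 : R[i]) < 1 by rewrite cabs0.
  have := hh _ _ (dh _ z1); rewrite mulr0 addr0 expr1n invr1 mulr1 -rmorphM /= invrK.
  rewrite (_ : r * (1 - a ^+ 2) = 2 * t - t ^+ 2 / r)//.
  by rewrite /a; field; rewrite gt_eqF.
Qed.

End KobayashiMetric.

(** * The Kobayashi metric of a convex domain is a continuous Finsler norm *)

Section KobayashiNorm.
Variables (R : realType) (n : nat).
Local Notation V := 'rV[R[i]]_n.
Implicit Types (p q a u v w : V).
Variable D : set V.
Hypotheses (oD : open D) (cD : convex D).

Lemma le_kob p v (x : R) : D p -> (forall al, admissible D p v al -> x <= al) -> x <= kob D p v.
Proof. by move=> Dp h; apply: lb_le_inf => //; exact: admissible_exists. Qed.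

Lemma kob_approx p v (e : R) : D p -> 0 < e ->
  exists2 al, admissible D p v al & al < kob D p v + e.
Proof.
by move=> Dp e0; apply: kob_lt; [exact: admissible_exists|rewrite ltrDl].
Qed.

Lemma kobD p v w : D p -> kob D p (v + w) <= kob D p v + kob D p w.
Proof.
move=> Dp; apply/ler_addgt0Pr => e e0.
have e2 : 0 < e / 2 by rewrite divr_gt0.
have [al ha la] := kob_approx v Dp e2; have [be hb lb] := kob_approx w Dp e2.
have := kob_le (admissible_add cD ha hb); lra.
Qed.

Lemma kobN p v : D p -> kob D p (- v) <= kob D p v.
Proof. by move=> Dp; apply: le_kob => // al /admissible_opp; exact: kob_le. Qed.

Lemma kob0 p : D p -> kob D p 0 = 0.
Proof.
move=> Dp; apply/eqP; rewrite eq_le kob_ge0 andbT; apply/ler_addgt0Pr => e e0.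
by rewrite add0r; apply: kob_le; exact: admissible_zero.
Qed.

Lemma kobZ p v (c : R) : D p -> kob D p (c%:C *: v) <= `|c| * kob D p v.
Proof.
move=> Dp; have pos (k : R) u : 0 < k -> kob D p (k%:C *: u) <= k * kob D p u.
  move=> k0; rewrite mulrC -ler_pdivrMr//; apply: le_kob => // al hal.
  by rewrite ler_pdivrMr// mulrC; apply: kob_le; exact: admissible_scale.
have [c0|c0|->] := ltgtP c 0.
- rewrite -[c]opprK rmorphN /= scaleNr -scalerN normrN gtr0_norm ?oppr_gt0//.
  apply: le_trans (pos _ _ _) _; rewrite ?oppr_gt0//.
  by rewrite ler_pM2l ?oppr_gt0// kobN.
- by rewrite gtr0_norm//; exact: pos.
- by rewrite scale0r kob0// normr0 mul0r.
Qed.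

Lemma kob_lbound p v a (c : R) : (forall z, D z -> c <= rdot z a) -> D p ->
  cabs (hdot v a) <= 2 * (rdot p a - c) * kob D p v.
Proof.
move=> hD Dp; apply/ler_addgt0Pr => e e0.
set k := 2 * (rdot p a - c).
have k0 : 0 <= k by rewrite /k mulr_ge0// subr_ge0 hD.
have k1 : 0 < k + 1 by rewrite ltr_wpDl.
have [al ha la] := kob_approx v Dp (divr_gt0 e0 k1).
apply: le_trans (admissible_lb hD ha) _; rewrite -/k.
apply: le_trans (ler_wpM2l k0 (ltW la)) _.
rewrite mulrDr lerD2l mulrCA -[leRHS]mulr1 ler_wpM2l ?ltW//.
by rewrite ltr_pdivrMr// mul1r ltrDl.
Qed.

Lemma kob_move p q v (s : R) : 0 <= s < 1 -> D q -> D p ->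
  (1 - s) * kob D ((1 - s)%:C *: p + s%:C *: q) v <= kob D p v.
Proof.
move=> hs Dq Dp; have s1 : 0 < 1 - s by move: hs => /andP[_]; rewrite subr_gt0.
apply: le_kob => // al hal.
by rewrite mulrC -ler_pdivlMr//; apply: kob_le; exact: admissible_move.
Qed.

(** [p'] lies on the segment from [p] to a point [q] of the ball, at the proportion
    [s] from [p]. *)
Lemma kob_move_ball p p' v (s r : R) : 0 < s < 1 -> 0 < r ->
  (forall w, vnorm w < r -> D (p + w)) -> vnorm (p' - p) < s * r ->
  (1 - s) * kob D p' v <= kob D p v.
Proof.
move=> /andP[s0 s1] r0 hD hp.
have Dp : D p by rewrite -[p]addr0; apply: hD; rewrite vnorm0.
have Dq : D (p + s^-1%:C *: (p' - p)).
  apply: hD; rewrite vnormZ cabs_real gtr0_norm ?invr_gt0//.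
  by rewrite mulrC ltr_pdivrMr// mulrC.
have s01 : 0 <= s < 1 by rewrite ltW.
have := kob_move v s01 Dq Dp.
rewrite scalerDr scalerA -rmorphM /= divff ?gt_eqF// scale1r addrA -scalerDl.
by rewrite -rmorphD /= subrK scale1r addrC subrK.
Qed.

Lemma kob_affine p v (r : R) : 0 < r ->
  (forall z : R[i], cabs z < r -> D (p + z *: v)) -> kob D p v <= r^-1.
Proof. by move=> r0 h; apply: kob_le; exact: admissible_affine. Qed.

Lemma kob_vnorm p v (r : R) : 0 < r -> (forall w, vnorm w < r -> D (p + w)) ->
  kob D p v <= vnorm v / r.
Proof.
move=> r0 hD; have Dp : D p by rewrite -[p]addr0; apply: hD; rewrite vnorm0.
have [v0|v0] := eqVneq v 0; first by rewrite v0 kob0// divr_ge0 ?vnorm_ge0 ?ltW.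
have nv : 0 < vnorm v by rewrite lt_neqAle vnorm_ge0 andbT eq_sym vnorm_eq0.
rewrite -[X in _ <= X]invrK invf_div; apply: kob_affine; first exact: divr_gt0.
by move=> z; rewrite ltr_pdivlMr// => h; apply: hD; rewrite vnormZ.
Qed.

(** Applying [kob_move_ball] in both directions compares the metrics at [p] and [p'];
    in the vector the metric is a norm dominated by [vnorm]. *)
Lemma kob_continuous p v (e : R) : D p -> 0 < e ->
  exists2 r : R, 0 < r & forall p' v', vnorm (p' - p) < r -> vnorm (v' - v) < r ->
    `|kob D p' v' - kob D p v| <= e.
Proof.
move=> Dp e0; have [r r0 hr] := open_vecP oD Dp.
have K0 := kob_ge0 D p v; set K := kob D p v in K0 *.
pose s := Num.min (1 / 2) (e / (4 * (K + 1))).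
have K1 : 0 < 4 * (K + 1) by rewrite mulr_gt0// ltr_wpDl.
have s0 : 0 < s by rewrite lt_min !divr_gt0.
have s12 : s <= 1 / 2 by rewrite ge_min lexx.
have sK : s * (4 * (K + 1)) <= e by rewrite -ler_pdivlMr// ge_min lexx orbT.
exists (Num.min (s * (r / 2)) (e * r / 8)).
  by rewrite lt_min !(mulr_gt0, divr_gt0).
move=> p' v'; rewrite !lt_min => /andP[p1 _] /andP[_ v1].
have sr : s * (r / 2) <= r / 2 by rewrite -[leRHS]mul1r ler_wpM2r ?divr_ge0 ?ltW//; lra.
have hr' w : vnorm w < r / 2 -> D (p' + w).
  move=> hw; rewrite (_ : p' + w = p + ((p' - p) + w)); last by rewrite addrA [p + _]addrC subrK.
  by apply: hr; apply: le_lt_trans (vnormD _ _) _; lra.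
have Dp' : D p' by rewrite -[p']addr0; apply: hr'; rewrite vnorm0 divr_gt0.
have s1 : 0 < s < 1 by rewrite s0; lra.
have p2 : vnorm (p' - p) < s * r by apply: lt_le_trans p1 _; rewrite ler_wpM2l ?ltW//; lra.
have A1 := kob_move_ball v s1 r0 hr p2.
have p3 : vnorm (p - p') < s * (r / 2) by rewrite -vnormN opprB.
have A2 := kob_move_ball v s1 (divr_gt0 r0 (ltr0n _ 2)) hr' p3.
have r2 : 0 < r / 2 by rewrite divr_gt0.
have B u : kob D p' u <= 2 / r * vnorm u.
  apply: le_trans (kob_vnorm u r2 hr') _.
  by rewrite mulrC invfM invrK [_ * 2]mulrC.
have vb : 2 / r * vnorm (v' - v) <= e / 4.
  apply: (@le_trans _ _ (2 / r * (e * r / 8))); first by rewrite ler_wpM2l ?divr_ge0 ?ltW.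
  by rewrite le_eqVlt; apply/orP; left; apply/eqP; field; rewrite gt_eqF.
have C1 : kob D p' v' <= kob D p' v + e / 4.
  by have := kobD v (v' - v) Dp'; rewrite addrC subrK => /le_trans; apply; rewrite lerD2l (le_trans (B _)).
have C2 : kob D p' v <= kob D p' v' + e / 4.
  have := kobD v' (v - v') Dp'; rewrite addrC subrK => /le_trans; apply.
  by rewrite lerD2l (le_trans (B _))// -vnormN opprB.
have k'0 := kob_ge0 D p' v.
rewrite -/K in A1 A2.
have sK0 : 0 <= s * K by rewrite mulr_ge0// ltW.
have sk0 : 0 <= s * kob D p' v by rewrite mulr_ge0// ltW.
have skK : s * kob D p' v <= 2 * (s * K).
  have : kob D p' v <= 2 * K.
    have : (1 / 2) * kob D p' v <= (1 - s) * kob D p' v by rewrite ler_wpM2r//; lra.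
    lra.
  by move=> h; apply: le_trans (ler_wpM2l (ltW s0) h) _; rewrite mulrCA.
rewrite ler_norml; lra.
Qed.

End KobayashiNorm.

(** * Length of paths *)

Section Curves.
Variables (R : realType) (n : nat).
Local Notation V := 'rV[R[i]]_n.
Local Notation W := 'rV[R]_(n + n).

Lemma complexifyD (x y : W) : complexify (x + y) = complexify x + complexify y.
Proof. by apply/rowP => j; rewrite !mxE. Qed.

Lemma complexifyN (x : W) : complexify (- x) = - complexify x.
Proof. by apply/rowP => j; rewrite !mxE. Qed.

Lemma complexifyZ (c : R) (x : W) : complexify (c *: x) = c%:C *: complexify x.
Proof. by apply/rowP => j; rewrite !mxE; simpc. Qed.

Lemma normr_coord m (w : 'rV[R]_m) j : `|w 0 j| <= `|w|.
Proof.
rewrite [leRHS]/Num.Def.normr/= mx_normrE.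
exact: (le_bigmax _ (fun i : 'I_1 * 'I_m => `|w i.1 i.2|) (0, j)).
Qed.

Lemma vnorm_complexify (x : W) : vnorm (complexify x) <= 2 * `|x|.
Proof.
apply: vnorm_le => [|j]; first by rewrite mulr_ge0.
apply: le_trans (cabs_le_ReIm _) _; rewrite !mxE /=.
by rewrite mulr_natl mulr2n; apply: lerD; exact: normr_coord.
Qed.

Lemma is_derive_comp (U : normedModType R) (f : R -> R) (g : R -> U) (t s : R) (v : U) :
  is_derive t (1 : R) f s -> is_derive (f t) (1 : R) g v ->
  is_derive t (1 : R) (g \o f) (s *: v).
Proof.
move=> /is_derive_epsP df /is_derive_epsP dg; apply/is_derive_epsP => e e0.
pose M := `|s| + `|v| + 1.
have M0 : 0 < M by rewrite /M; have := normr_ge0 s; have := normr_ge0 v; lra.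
pose e1 := Num.min 1 (e / M).
have e10 : 0 < e1 by rewrite lt_min ltr01 divr_gt0.
have e11 : e1 <= 1 by rewrite ge_min lexx.
have e1M : e1 * M <= e by rewrite -ler_pdivlMr// ge_min lexx orbT.
have [r r0 hr] := df _ e10; have [k k0 hk] := dg _ e10.
exists (Num.min r (k / M)); first by rewrite lt_min r0 divr_gt0.
move=> x; rewrite lt_min ltr_pdivlMr// => /andP[xr xk].
have {}hr : `|f x - f t - (x - t) * s| <= e1 * `|x - t| := hr _ xr.
have hf : `|f x - f t| <= (`|s| + e1) * `|x - t|.
  rewrite -[f x - f t](subrK ((x - t) * s)); apply: le_trans (ler_normD _ _) _.
  by rewrite normrM; lra.
have hf1 : `|f x - f t| < k.
  apply: le_lt_trans hf _; apply: le_lt_trans xk; rewrite mulrC ler_wpM2l// /M.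
  have := normr_ge0 v; lra.
have {}hk := hk _ hf1; rewrite /=.
have -> : g (f x) - g (f t) - (x - t) *: (s *: v) =
    (g (f x) - g (f t) - (f x - f t) *: v) + (f x - f t - (x - t) * s) *: v.
  by rewrite scalerA [(f x - f t - _) *: v]scalerBl addrA subrK.
apply: le_trans (ler_normD _ _) _; rewrite normrZ.
apply: le_trans (lerD hk (ler_wpM2r (normr_ge0 v) hr)) _.
apply: (@le_trans _ _ (e1 * M * `|x - t|)); last by rewrite ler_wpM2r.
have := ler_wpM2l (ltW e10) hf.
have : e1 * (`|s| + e1) * `|x - t| <= e1 * (`|s| + 1) * `|x - t|.
  by rewrite ler_wpM2r// ler_wpM2l ?(ltW e10)// lerD2l.
rewrite /M; lra.
Qed.

Lemma is_derive_scalel (U : normedModType R) (u : U) (t : R) :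
  is_derive t (1 : R) ( *:%R ^~ u) u.
Proof.
apply/is_derive_epsP => e e0; exists 1 => // x _.
by rewrite -!scalerBl subrr scale0r normr0 mulr_ge0// ltW.
Qed.

(** Extends the speed of a path from [0, 1] to a continuous function on the line, so
    that the fundamental theorem of calculus also applies at the two ends. *)
Definition clamp (t : R) : R := Num.max 0 (Num.min t 1).

Lemma clamp_itv t : 0 <= clamp t <= 1.
Proof. by rewrite /clamp le_max lexx ge_max ler01 ge_min lexx orbT. Qed.

Lemma clamp_id t : 0 <= t <= 1 -> clamp t = t.
Proof. by move=> /andP[t0 t1]; rewrite /clamp (min_idPl t1) (max_idPr t0). Qed.

Lemma continuous_clamp : continuous clamp.
Proof.
move=> t; apply: (@lipschitz_at_continuous _ _ _ 1 1) => // s _.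
rewrite mul1r /clamp /Num.max /Num.min.
have := ler_norm (s - t); have := ler_norm (t - s); rewrite (distrC t s).
move: (`|s - t|) => A A1 A2; rewrite ler_norml.
have [s1|s1] := ltP s 1; have [t1|t1] := ltP t 1; rewrite ?ltr01.
- by have [s0|s0] := ltP 0 s; have [t0|t0] := ltP 0 t; lra.
- by have [s0|s0] := ltP 0 s; lra.
- by have [t0|t0] := ltP 0 t; lra.
- lra.
Qed.

Section Length.
Variable D : set V.
Hypotheses (oD : open D) (cD : convex D).

(** A certificate for an upper bound on the length: the curve [G], its velocity [G'],
    and a function [h] whose derivative dominates the Kobayashi speed, so that
    [h 1 - h 0] dominates the length. Upper bounds on the distance are thus obtained
    by exhibiting primitives, and metric properties by transforming certificates,
    without integrals. *)
Definition curve_bound (p q : V) (G G' : R -> W) (h h' : R -> R) :=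
  [/\ forall t : R, is_derive t (1 : R) G (G' t), continuous G',
      forall t : R, 0 <= t <= 1 -> D (complexify (G t)),
      complexify (G 0) = p /\ complexify (G 1) = q &
      forall t : R, 0 <= t <= 1 -> is_derive t (1 : R) h (h' t) /\
        kob D (complexify (G t)) (complexify (G' t)) <= h' t].

Lemma kob_curve_continuous (G G' : R -> W) (t : R) : {for t, continuous G} -> {for t, continuous G'} ->
  D (complexify (G t)) ->
  {for t, continuous (fun t => kob D (complexify (G t)) (complexify (G' t)))}.
Proof.
move=> cG cG' Dt; apply/cvgrPdist_le => e e0.
have [r r0 hr] := kob_continuous oD cD (complexify (G' t)) Dt e0.
have near_small (F : R -> W) : {for t, continuous F} ->
    \forall s \near t, vnorm (complexify (F s) - complexify (F t)) < r.
  move=> cF; near=> s.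
  rewrite -complexifyN -complexifyD; apply: le_lt_trans (vnorm_complexify _) _.
  have : `|F t - F s| < r / 2.
    by near: s; apply: cvgr_dist_lt => //; rewrite divr_gt0.
  by rewrite distrC; lra.
near=> s; rewrite distrC; apply: hr; near: s; exact: near_small.
Unshelve. all: by end_near. Qed.

(** The Kobayashi speed of a C^1 path is continuous, so the length is the increment
    of a primitive: the bridge from the integral to [curve_bound]. *)
Lemma length_primitive (G G' : R -> W) :
  (forall t : R, is_derive t (1 : R) G (G' t)) -> continuous G' ->
  (forall t : R, 0 <= t <= 1 -> D (complexify (G t))) ->
  exists F : R -> R,
    (forall t : R, 0 <= t <= 1 -> is_derive t (1 : R) F (kob D (complexify (G t)) (complexify (G' t)))) /\
    kobayashi_length D (@complexify R n \o G) = (F 1 - F 0)%:E.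
Proof.
move=> dG cG' GD.
have cG : continuous G.
  by move=> t; apply/differentiable_continuous/derivable1_diffP; have [] := dG t.
pose k0 t := kob D (complexify (G t)) (complexify (G' t)).
pose k := k0 \o clamp.
have ck : continuous k.
  move=> t; apply: continuous_comp; first exact: continuous_clamp.
  apply: kob_curve_continuous; [exact: cG|exact: cG'|].
  by apply: GD; exact: clamp_itv.
have kE t : 0 <= t <= 1 -> k t = k0 t by move=> ht; rewrite /k /= clamp_id.
have csk a b : cont_seg k a b by move=> t _; exact: ck.
pose F x := seg_int k (-1) x; exists F; split.
  move=> t ht; rewrite -/(k0 t) -kE//.
  have t2 : t < 2 by lra.
  have t1 : -1 < t by lra.
  have [d1 d2] := continuous_FTC1_closed t2 (cont_seg_integrable (csk (-1) 2)) t1 (ck t).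
  by split; [exact: d1|rewrite -derive1E; exact: d2].
have -> : F 1 - F 0 = seg_int k 0 1.
  by rewrite /F (@seg_int_split _ k (-1) 1 0)//; [rewrite addrC addKr|lra].
rewrite /seg_int /Rintegral fineK; last first.
  by apply: integrable_fin_num => //; exact: cont_seg_integrable.
apply: eq_integral => t; rewrite inE/= in_itv/= => ht.
rewrite kE// /path_derive.
rewrite kobayashi_metric_kob; last by apply: admissible_exists => //; exact: GD.
congr (kob _ _ (complexify _))%:E.
rewrite (_ : realify \o _ = G) ?derive1E; last by apply/funext => s /=; rewrite complexifyK.
by have [_ ->] := dG t.
Qed.

Lemma path_curve p q (g : R -> V) : C1_path D p q g ->
  exists G G' : R -> W, [/\ forall t : R, is_derive t (1 : R) G (G' t), continuous G',
    forall t : R, 0 <= t <= 1 -> D (complexify (G t)),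
    complexify (G 0) = p /\ complexify (G 1) = q & g = @complexify R n \o G].
Proof.
move=> [dg cg gD g0 g1]; exists (realify \o g), ((realify \o g)^`()); split.
- by move=> t; rewrite derive1E; exact: derivableP.
- exact: cg.
- by move=> t ht; rewrite /= realifyK; apply: gD; exists t => //=; rewrite in_itv.
- by rewrite /= !realifyK.
- by apply/funext => t /=; rewrite realifyK.
Qed.

Lemma curve_path p q (G G' : R -> W) : (forall t : R, is_derive t (1 : R) G (G' t)) -> continuous G' ->
  (forall t : R, 0 <= t <= 1 -> D (complexify (G t))) ->
  complexify (G 0) = p -> complexify (G 1) = q -> C1_path D p q (@complexify R n \o G).
Proof.
move=> dG cG GD.
have E : realify \o (@complexify R n \o G) = G by apply/funext => t /=; rewrite complexifyK.
move=> G0 G1; split; rewrite ?E.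
- move=> t; case: (dG t) => h _; exact: h.
- rewrite (_ : G^`() = G'); first exact: cG.
  apply/funext => t; rewrite derive1E; case: (dG t) => _ h; exact: h.
- by move=> _ [t /= + <-]; rewrite in_itv/=; exact: GD.
- exact: G0.
- exact: G1.
Qed.

Definition lengths p q : set R :=
  [set L | exists2 g, C1_path D p q g & kobayashi_length D g = L%:E].

Lemma kobayashi_distE p q : lengths p q !=set0 -> kobayashi_dist D p q = inf (lengths p q).
Proof.
move=> ne; rewrite /kobayashi_dist (_ : [set _ | _ in _] = EFin @` lengths p q); last first.
  apply/seteqP; split=> [_ [g pg <-]|_ [L [g pg gL] <-]]; last first.
    by exists g; [exact: pg|exact: gL].
  have [G [G' [dG cG GD _ gE]]] := path_curve pg.
  have [F [_ FL]] := length_primitive dG cG GD.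
  exists (F 1 - F 0); last by rewrite gE FL.
  by exists g; [exact: pg|rewrite gE; exact: FL].
rewrite ereal_inf_EFin//; exists 0 => L [g pg gL].
rewrite -lee_fin -gL; apply: integral_ge0 => t /=; rewrite in_itv/= => ht.
by apply: le_ereal_inf_tmp => _ [a [a0 _] <-]; rewrite lee_fin ltW.
Qed.

Lemma lengths_ge0 p q L : lengths p q L -> 0 <= L.
Proof.
move=> [g pg gL]; rewrite -lee_fin -gL; apply: integral_ge0 => t _.
by apply: le_ereal_inf_tmp => _ [a [a0 _] <-]; rewrite lee_fin ltW.
Qed.

Lemma derive_le_increment (f g : R -> R) (f' g' : R -> R) :
  (forall t : R, 0 <= t <= 1 -> is_derive t (1 : R) f (f' t)) ->
  (forall t : R, 0 <= t <= 1 -> is_derive t (1 : R) g (g' t)) ->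
  (forall t : R, 0 <= t <= 1 -> f' t <= g' t) -> f 1 - f 0 <= g 1 - g 0.
Proof.
move=> df dg fg.
have dgf (t : R) : 0 <= t <= 1 -> is_derive t (1 : R) (g - f) (g' t - f' t).
  by move=> ht; apply: is_deriveB; [exact: dg|exact: df].
have dgf' (t : R) : t \in `]0, 1[%R -> is_derive t (1 : R) (g - f) (g' t - f' t).
  by rewrite in_itv/= => ht; apply: dgf; lra.
have cgf : {within `[(0 : R), 1], continuous (g - f)}.
  apply: derivable_within_continuous => t; rewrite in_itv/= => ht.
  by have [h _] := dgf t ht; exact: h.
have [t + E] := MVT ltr01 dgf' cgf.
rewrite in_itv/= => ht; have : f' t <= g' t by apply: fg; lra.
by move: E; rewrite subr0 mulr1 !fctE; lra.
Qed.

Lemma dist_le_bound p q G G' h h' : curve_bound p q G G' h h' ->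
  kobayashi_dist D p q <= h 1 - h 0.
Proof.
move=> [dG cG GD [G0 G1] hb].
have [F [dF FL]] := length_primitive dG cG GD.
have mem : lengths p q (F 1 - F 0).
  by exists (@complexify R n \o G); [exact: curve_path GD G0 G1|exact: FL].
rewrite kobayashi_distE; last by eexists; exact: mem.
apply: (@le_trans _ _ (F 1 - F 0)).
  by apply: ge_inf => //; exists 0 => L; exact: lengths_ge0.
apply: (derive_le_increment dF (g' := h')) => t ht; have [h1 h2] := hb t ht; [exact: h1|exact: h2].
Qed.

Lemma curve_bound_segment p q : D p -> D q ->
  exists G G', [/\ forall t : R, is_derive t (1 : R) G (G' t), continuous G',
    forall t : R, complexify (G t) = p + t%:C *: (q - p),
    forall t : R, complexify (G' t) = q - p &
    forall t : R, 0 <= t <= 1 -> D (complexify (G t))].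
Proof.
move=> Dp Dq.
have GE (t : R) : complexify (realify p + t *: realify (q - p)) = p + t%:C *: (q - p).
  by rewrite complexifyD complexifyZ !realifyK.
exists (fun t => realify p + t *: realify (q - p)), (cst (realify (q - p))); split.
- move=> t; have := is_deriveD (is_derive_cst (realify p) t (1 : R)) (is_derive_scalel (realify (q - p)) t).
  by rewrite add0r.
- exact: cst_continuous.
- exact: GE.
- by move=> t; rewrite /= realifyK.
- move=> t ht; rewrite GE.
  have -> : p + t%:C *: (q - p) = t%:C *: q + (1 - t)%:C *: p.
    by rewrite rmorphB scalerBr scalerBl scale1r addrCA.
  by have /convexP := cD; apply.
Qed.

End Length.
End Curves.

(** * The Kobayashi distance is a length metric *)

Section KobayashiDistance.
Variables (R : realType) (n : nat).
Local Notation V := 'rV[R[i]]_n.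
Local Notation W := 'rV[R]_(n + n).

Lemma continuous_mull (f : R -> R) (k x : R) : {for x, continuous f} ->
  {for x, continuous (fun y => k * f y)}.
Proof.
by move=> cf; apply: (@continuousM _ _ (cst k) f x) => //; exact: cst_continuous.
Qed.

Definition pos_part (x : R) : R := Num.max x 0.

Lemma is_derive_sqr_pos_part (t : R) :
  is_derive t (1 : R) (fun x => pos_part x ^+ 2) (2 * pos_part t).
Proof.
apply/is_derive_epsP => e e0; exists e => // x xe.
apply: (@le_trans _ _ (`|x - t| * `|x - t|)); last by rewrite ler_wpM2r// ltW.
rewrite -expr2 real_normK ?num_real// -[_ *: _]/(_ * _) /pos_part ler_norml.
have sq := sqr_ge0 (x - t).
have [x0|x0] := ltP x 0; have [t0|t0] := ltP t 0; rewrite ?expr0n /= ?mulr0.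
- lra.
- have : 0 <= (- x) * t by rewrite mulr_ge0// oppr_ge0 ltW.
  have := sqr_ge0 x; have := sqr_ge0 t; lra.
- have : 0 <= x * (- t) by rewrite mulr_ge0// oppr_ge0 ltW.
  have := sqr_ge0 t; have := sqr_ge0 x; lra.
- lra.
Qed.

Lemma continuous_pos_part : continuous pos_part.
Proof.
move=> t; apply: (@lipschitz_at_continuous _ _ _ 1 1) => // s _.
rewrite mul1r /pos_part.
have := ler_norm (s - t); have := ler_norm (t - s); rewrite (distrC t s).
move: (`|s - t|) => A A1 A2; rewrite ler_norml.
by have [s0|s0] := ltP s 0; have [t0|t0] := ltP t 0; lra.
Qed.

(** A C^1 nondecreasing step from 0 to 1; its constant ends let two paths be
    glued with a common zero velocity. *)
Definition smooth_step (x : R) : R :=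
  2 * pos_part x ^+ 2 - 4 * pos_part (x - 1 / 2) ^+ 2 + 2 * pos_part (x - 1) ^+ 2.
Definition smooth_step' (x : R) : R :=
  4 * pos_part x - 8 * pos_part (x - 1 / 2) + 4 * pos_part (x - 1).

Lemma is_derive_smooth_step (t : R) : is_derive t (1 : R) smooth_step (smooth_step' t).
Proof.
have sh (c : R) : is_derive t (1 : R) (fun x => pos_part (x - c) ^+ 2) (2 * pos_part (t - c)).
  have d1 : is_derive t (1 : R) (fun x : R => x - c) 1.
    by have := is_deriveB (is_derive_id t (1 : R)) (is_derive_cst c t (1 : R)); rewrite subr0.
  by have := is_derive_comp d1 (is_derive_sqr_pos_part (t - c)); rewrite scale1r.
have h1 := is_deriveZ 2 (is_derive_sqr_pos_part t).
have h2 := is_deriveZ 4 (sh (1 / 2)).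
have h3 := is_deriveZ 2 (sh 1).
have := is_deriveD (is_deriveB h1 h2) h3.
rewrite (_ : _ - _ + _ = smooth_step' t); first by [].
by rewrite -![_ *: _]/(_ * _) /smooth_step'; ring.
Qed.

Lemma continuous_smooth_step' : continuous smooth_step'.
Proof.
have sh (k c : R) : continuous (fun x => k * pos_part (x - c)).
  move=> x; apply: (@continuous_mull (fun x => pos_part (x - c)) k x).
  apply: (@continuous_comp _ _ _ (fun x : R => x - c) pos_part); last exact: continuous_pos_part.
  by apply: continuousB; [exact: cvg_id|exact: cst_continuous].
have sh0 : continuous (fun x => 4 * pos_part x).
  by move=> x; apply: (@continuous_mull pos_part 4 x); exact: continuous_pos_part.
by move=> x; exact: (continuousD (continuousB (sh0 x) (sh 8 (1 / 2) x)) (sh 4 1 x)).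
Qed.

Lemma smooth_step_le0 x : x <= 0 -> smooth_step x = 0 /\ smooth_step' x = 0.
Proof.
move=> x0; rewrite /smooth_step /smooth_step' /pos_part.
rewrite (max_idPr x0) (max_idPr (_ : x - 1 / 2 <= 0)) ?(max_idPr (_ : x - 1 <= 0)); try lra.
Qed.

Lemma smooth_step_ge1 x : 1 <= x -> smooth_step x = 1 /\ smooth_step' x = 0.
Proof.
move=> x1; rewrite /smooth_step /smooth_step' /pos_part.
rewrite (max_idPl (_ : 0 <= x)) ?(max_idPl (_ : 0 <= x - 1 / 2)) ?(max_idPl (_ : 0 <= x - 1)); try lra.
Qed.

Lemma smooth_step_itv x : [/\ 0 <= smooth_step x, smooth_step x <= 1 & 0 <= smooth_step' x].
Proof.
have [x0|x0] := leP x 0; first by have [-> ->] := smooth_step_le0 x0.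
have [x1|x1] := leP 1 x; first by have [-> ->] := smooth_step_ge1 x1.
rewrite /smooth_step /smooth_step' /pos_part.
rewrite (max_idPl (ltW x0)) (max_idPr (_ : x - 1 <= 0)); last lra.
have s0 := sqr_ge0 x; have s1 := sqr_ge0 (x - 1).
have [x2|x2] := leP (x - 1 / 2) 0; rewrite ?expr0n /=.
  have : x ^+ 2 <= (1 / 2) ^+ 2 by rewrite ler_pXn2r ?nnegrE//; lra.
  by move=> h; split; lra.
have : (1 - x) ^+ 2 <= (1 / 2) ^+ 2 by rewrite ler_pXn2r ?nnegrE//; lra.
by move=> h; split; lra.
Qed.

Section Distance.
Variable D : set V.
Hypotheses (oD : open D) (cD : convex D).
Local Notation d := (kobayashi_dist D).
Local Notation bound := (curve_bound D).

Lemma lengths_neq0 p q : D p -> D q -> lengths D p q !=set0.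
Proof.
move=> Dp Dq; have [G [G' [dG cG GE _ GD]]] := curve_bound_segment cD Dp Dq.
have [F [_ FL]] := length_primitive oD cD dG cG GD.
exists (F 1 - F 0), (@complexify R n \o G); last exact: FL.
apply: curve_path dG cG GD _ _; rewrite GE ?scale0r ?addr0//.
by rewrite scale1r addrC subrK.
Qed.

Lemma dist_ge0 p q : D p -> D q -> 0 <= d p q.
Proof.
move=> Dp Dq; rewrite kobayashi_distE//; last exact: lengths_neq0.
by apply: lb_le_inf; [exact: lengths_neq0|move=> L; exact: lengths_ge0].
Qed.

Lemma dist_lt_bound p q M : D p -> D q -> d p q < M ->
  exists G G' h h', bound p q G G' h h' /\ h 1 - h 0 < M.
Proof.
move=> Dp Dq; have ne := lengths_neq0 Dp Dq.
rewrite kobayashi_distE// => /(inf_lt ne)[L [g pg gL] LM].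
have [G [G' [dG cG GD GE gE]]] := path_curve pg.
have [F [dF FL]] := length_primitive oD cD dG cG GD.
exists G, G', F, (fun t => kob D (complexify (G t)) (complexify (G' t))); split.
  by split=> // t ht; split; [exact: dF|exact: lexx].
by move: gL; rewrite gE FL => -[->].
Qed.

Lemma bound_reparam p q G G' h h' (s s' : R -> R) : bound p q G G' h h' ->
  (forall t : R, is_derive t (1 : R) s (s' t)) -> continuous s' ->
  (forall t : R, 0 <= t <= 1 -> [/\ 0 <= s t, s t <= 1 & 0 <= s' t]) ->
  bound (complexify (G (s 0))) (complexify (G (s 1))) (G \o s) (fun t => s' t *: G' (s t))
    (h \o s) (fun t => s' t * h' (s t)).
Proof.
move=> [dG cG GD _ hb] ds cs sI.
have css : continuous s.
  by move=> t; apply/differentiable_continuous/derivable1_diffP; have [] := ds t.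
split.
- move=> t; exact: is_derive_comp.
- move=> t; apply: continuousZ; first exact: cs.
  by apply: continuous_comp; [exact: css|exact: cG].
- by move=> t /sI[s0 s1 _]; apply: GD; rewrite s0.
- by [].
- move=> t /sI[s0 s1 s'0].
  have s01 : 0 <= s t <= 1 by rewrite s0.
  have [dh kh] := hb _ s01; split; first exact: is_derive_comp.
  rewrite complexifyZ /=.
  have K := kobZ oD (complexify (G' (s t))) (s' t) (GD _ s01).
  by apply: (le_trans K); rewrite ger0_norm// ler_wpM2l.
Qed.

Lemma dist_refl p : D p -> d p p = 0.
Proof.
move=> Dp; apply/eqP; rewrite eq_le dist_ge0// andbT.
have : bound p p (cst (realify p)) (cst 0) (cst 0) (cst 0).
  split.
  - by move=> t; exact: is_derive_cst.
  - by move=> t; exact: cst_continuous.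
  - by move=> t _; rewrite /= realifyK.
  - by rewrite /= realifyK.
  - move=> t _; split; first exact: is_derive_cst.
    have -> : complexify (cst 0 t : W) = 0 by apply/rowP => j; rewrite !mxE.
    by rewrite /= realifyK kob0.
by move=> /(dist_le_bound oD cD); rewrite subrr.
Qed.

Lemma dist_sym_le p q : D p -> D q -> d p q <= d q p.
Proof.
move=> Dp Dq; apply/ler_addgt0Pr => e e0.
have [|G [G' [h [h' [[dG cG GD [G0 G1] hb] hL]]]]] := @dist_lt_bound q p (d q p + e) Dq Dp.
  by rewrite ltrDl.
have ds (t : R) : is_derive t (1 : R) (fun t : R => 1 - t) (-1).
  by have := is_deriveB (is_derive_cst (1 : R) t (1 : R)) (is_derive_id t (1 : R)); rewrite sub0r.
have sI (t : R) : 0 <= t <= 1 -> 0 <= 1 - t <= 1 by lra.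
have cs : continuous (fun t : R => 1 - t).
  by move=> t; apply: continuousB; [exact: cst_continuous|exact: cvg_id].
have B : bound p q (fun t => G (1 - t)) (fun t => -1 *: G' (1 - t))
   (fun t => - h (1 - t)) (fun t => h' (1 - t)).
  split.
  - by move=> t; exact: (is_derive_comp (ds t)).
  - move=> t; apply: (@continuousZ _ _ _ (cst (-1)) (G' \o (fun t : R => 1 - t)) t); first exact: cst_continuous.
    by apply: continuous_comp; [exact: cs|exact: cG].
  - by move=> t /sI; exact: GD.
  - by rewrite subr0 subrr.
  - move=> t /sI ht; have [dh kh] := hb _ ht; split.
      have := is_deriveN (is_derive_comp (ds t) dh).
      by rewrite -[_ *: _]/(_ * _) mulN1r opprK.
    by rewrite scaleN1r complexifyN; apply: le_trans (kobN oD _ (GD _ ht)) _.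
have := dist_le_bound oD cD B.
by rewrite subr0 subrr; lra.
Qed.

Lemma dist_sym p q : D p -> D q -> d p q = d q p.
Proof. by move=> Dp Dq; apply/eqP; rewrite eq_le !dist_sym_le. Qed.

(** Two consecutive paths are reparametrized by [smooth_step] on the two halves of
    [0, 1]. One of them always rests at the common end [q] with zero velocity, so
    their sum minus [q] is a C^1 path that follows the first and then the second. *)
Lemma dist_triangle p q r : D p -> D q -> D r -> d p r <= d p q + d q r.
Proof.
move=> Dp Dq Dr; apply/ler_addgt0Pr => e e0.
have e2 : 0 < e / 2 by rewrite divr_gt0.
have [|G1 [G1' [h1 [h1' [B1 L1]]]]] := @dist_lt_bound p q (d p q + e / 2) Dp Dq.
  by rewrite ltrDl.
have [|G2 [G2' [h2 [h2' [B2 L2]]]]] := @dist_lt_bound q r (d q r + e / 2) Dq Dr.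
  by rewrite ltrDl.
have d2 (c t : R) : is_derive t (1 : R) (fun t : R => 2 * t - c) 2.
  have := is_deriveB (is_deriveZ 2 (is_derive_id t (1 : R))) (is_derive_cst c t (1 : R)).
  by rewrite subr0 -[_ *: _]/(_ * _) mulr1.
have c2 (c : R) : continuous (fun t : R => 2 * t - c).
  move=> t; apply: continuousB; last exact: cst_continuous.
  by apply: (@continuous_mull id 2 t); exact: cvg_id.
have dsc (c : R) (t : R) : is_derive t (1 : R) (fun t : R => smooth_step (2 * t - c)) (2 * smooth_step' (2 * t - c)).
  exact: (is_derive_comp (d2 c t) (is_derive_smooth_step _)).
have csc (c : R) : continuous (fun t : R => 2 * smooth_step' (2 * t - c)).
  move=> t; apply: (@continuous_mull (fun t : R => smooth_step' (2 * t - c)) 2 t).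
  by apply: (@continuous_comp _ _ _ (fun t : R => 2 * t - c) smooth_step'); [exact: c2|exact: continuous_smooth_step'].
have sI (c t : R) : 0 <= t <= 1 -> [/\ 0 <= smooth_step (2 * t - c), smooth_step (2 * t - c) <= 1 &
   0 <= 2 * smooth_step' (2 * t - c)].
  by move=> _; have [k1 k2 k3] := smooth_step_itv (2 * t - c); split=> //; rewrite mulr_ge0.
have P1 := bound_reparam B1 (dsc 0) (csc 0) (sI 0).
have P2 := bound_reparam B2 (dsc 1) (csc 1) (sI 1).
have [_ _ _ [E10 E11] _] := B1; have [_ _ _ [E20 E21] _] := B2.
have v00 : 2 * 0 - 0 <= 0 :> R by rewrite mulr0 subr0.
have v10 : 2 * 0 - 1 <= 0 :> R by lra.
have v01 : 1 <= 2 * 1 - 0 :> R by lra.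
have v11 : 1 <= 2 * 1 - 1 :> R by lra.
have [S00 _] := smooth_step_le0 v00; have [S10 _] := smooth_step_le0 v10.
have [S01 _] := smooth_step_ge1 v01; have [S11 _] := smooth_step_ge1 v11.
rewrite S00 S01 E10 E11 in P1; rewrite S10 S11 E20 E21 in P2.
set H1 := _ \o _ in P1; set H1' := (fun t => _ *: _) in P1.
set k1 := (h1 \o _) in P1; set k1' := (fun t => _ * _) in P1.
set H2 := _ \o _ in P2; set H2' := (fun t => _ *: _) in P2.
set k2 := (h2 \o _) in P2; set k2' := (fun t => _ * _) in P2.
have left_half (t : R) : t <= 1 / 2 -> [/\ complexify (H2 t) = q, H2' t = 0 & k2' t = 0].
  move=> ht; have ht' : 2 * t - 1 <= 0 by lra.
  have [u1 u2] := smooth_step_le0 ht'.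
  by rewrite /H2 /H2' /k2' /= u1 u2 E20 mulr0 scale0r mul0r.
have right_half (t : R) : 1 / 2 <= t -> [/\ complexify (H1 t) = q, H1' t = 0 & k1' t = 0].
  move=> ht; have ht' : 1 <= 2 * t - 0 by lra.
  have [u1 u2] := smooth_step_ge1 ht'.
  by rewrite /H1 /H1' /k1' /= u1 u2 E11 mulr0 scale0r mul0r.
have [p1 p2 p3 [p4 p4'] p5] := P1; have [q1 q2 q3 [q4 q4'] q5] := P2.
have GE (t : R) : complexify (H1 t + H2 t - realify q) =
    complexify (H1 t) + complexify (H2 t) - q.
  by rewrite !complexifyD complexifyN realifyK.
have GL (t : R) : t <= 1 / 2 -> complexify (H1 t + H2 t - realify q) = complexify (H1 t).
  by move=> /left_half[u _ _]; rewrite GE u addrK.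
have GR (t : R) : 1 / 2 <= t -> complexify (H1 t + H2 t - realify q) = complexify (H2 t).
  by move=> /right_half[u _ _]; rewrite GE u addrC addKr.
have B : bound p r (fun t => H1 t + H2 t - realify q) (fun t => H1' t + H2' t)
   (fun t => k1 t + k2 t) (fun t => k1' t + k2' t).
  split.
  - move=> t; have := is_deriveB (is_deriveD (p1 t) (q1 t)) (is_derive_cst (realify q) t (1 : R)).
    by rewrite subr0.
  - by move=> t; apply: continuousD; [exact: p2|exact: q2].
  - move=> t ht; have [h|/ltW h] := leP t (1 / 2); [rewrite GL//; exact: p3|rewrite GR//; exact: q3].
  - by rewrite GL ?GR//; lra.
  - move=> t ht; have [a1 a2] := p5 t ht; have [b1 b2] := q5 t ht; split; first exact: is_deriveD.
    have [h|/ltW h] := leP t (1 / 2).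
      by rewrite GL//; have [_ -> ->] := left_half t h; rewrite !addr0.
    by rewrite GR//; have [_ -> ->] := right_half t h; rewrite !add0r.
have := dist_le_bound oD cD B.
rewrite /k1 /k2 /= S00 S01 S10 S11; lra.
Qed.

(** The intermediate value theorem for the primitive of the speed of a nearly shortest
    path yields a point that divides the distance as prescribed. *)
Lemma dist_split p q s t (e : R) : D p -> D q -> 0 <= s -> 0 <= t -> d p q = s + t -> 0 < e ->
  exists z, [/\ D z, d p z <= s + e & d z q <= t + e].
Proof.
move=> Dp Dq s0 t0 dE e0.
have [|G [G' [h [h' [B L]]]]] := @dist_lt_bound p q (d p q + e) Dp Dq.
  by rewrite ltrDl.
have [dG cG GD [G0 G1] hb] := B.
have lb := dist_le_bound oD cD B.
have ch : {within `[0, 1], continuous h}.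
  apply: derivable_within_continuous => u; rewrite in_itv/= => hu.
  by have [[H _] _] := hb u hu; exact: H.
have [|u + hu] := @IVT _ h 0 1 (h 0 + s) ler01 ch.
  have hm : h 0 <= h 1 by have := dist_ge0 Dp Dq; lra.
  by rewrite (min_idPl hm) (max_idPr hm); lra.
rewrite in_itv/= => u01; have /andP[u0 u1] := u01.
have ext (a b : R) : 0 <= a -> a <= b -> b <= 1 ->
    d (complexify (G a)) (complexify (G b)) <= h b - h a.
  move=> a0 ab b1.
  have ds (v : R) : is_derive v (1 : R) (fun v : R => a + (b - a) * v) (b - a).
    have := is_deriveD (is_derive_cst a v (1 : R)) (is_deriveZ (b - a) (is_derive_id v (1 : R))).
    by rewrite add0r -[_ *: _]/(_ * _) mulr1.
  have := @bound_reparam _ _ _ _ _ _ (fun t : R => a + (b - a) * t) (cst (b - a)) B ds.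
  move=> /(_ _ _)/(dist_le_bound oD cD); rewrite /= mulr0 addr0 mulr1 [a + (b - a)]addrC subrK.
  apply; first by move=> x; exact: cst_continuous.
  move=> x /andP[x0 x1].
  have ba : 0 <= b - a by lra.
  have h1 : 0 <= (b - a) * x by rewrite mulr_ge0.
  have h2 : (b - a) * x <= (b - a) * 1 by rewrite ler_wpM2l.
  by split; rewrite /=; lra.
exists (complexify (G u)); split.
- by apply: GD; lra.
- by rewrite -G0; apply: le_trans (ext 0 u _ _ _) _; lra.
- by rewrite -G1; apply: le_trans (ext u 1 _ _ _) _; lra.
Qed.

End Distance.
End KobayashiDistance.

(** * Lower bounds, proper balls and geodesics *)

Section KobayashiSpace.
Variables (R : realType) (n : nat).
Local Notation V := 'rV[R[i]]_n.
Local Notation W := 'rV[R]_(n + n).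

Lemma rdot_bound (z a : V) : `|rdot z a| <= n%:R * vnorm a * vnorm z.
Proof. exact: le_trans (Re_le_cabs _) (hdot_bound _ _). Qed.

Lemma rdot_small (a : V) (e : R) : 0 < e ->
  exists2 r : R, 0 < r & forall w, vnorm w < r -> `|rdot w a| < e.
Proof.
move=> e0; have K0 : 0 < n%:R * vnorm a + 1 by rewrite ltr_wpDl ?mulr_ge0 ?vnorm_ge0.
exists (e / (n%:R * vnorm a + 1)); first exact: divr_gt0.
move=> w; rewrite ltr_pdivlMr// => h; apply: le_lt_trans (rdot_bound _ _) _.
by apply: le_lt_trans h; rewrite mulrC ler_wpM2l ?vnorm_ge0// lerDl.
Qed.

Lemma is_derive_rdot (G : R -> W) (g : W) (t : R) (a : V) : is_derive t (1 : R) G g ->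
  is_derive t (1 : R) (fun s => rdot (complexify (G s)) a) (rdot (complexify g) a).
Proof.
move=> /is_derive_epsP dG; apply/is_derive_epsP => e e0.
pose K := n%:R * vnorm a * 2.
have K0 : 0 <= K by rewrite !mulr_ge0 ?vnorm_ge0.
have K1 : 0 < K + 1 by rewrite ltr_wpDl.
have [r r0 hr] := dG _ (divr_gt0 e0 K1); exists r => // x xr.
rewrite -[_ *: _]/(_ * _) -rdotZl -!rdotBl -!complexifyZ -!complexifyN -!complexifyD.
apply: le_trans (rdot_bound _ _) _.
apply: (@le_trans _ _ (K * (e / (K + 1) * `|x - t|))).
  rewrite /K -[leRHS]mulrA ler_wpM2l ?mulr_ge0 ?vnorm_ge0//.
  apply: le_trans (vnorm_complexify _) _; rewrite ler_pM2l//; exact: hr.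
rewrite mulrA ler_wpM2r// mulrA ler_pdivrMr// mulrC ler_wpM2l ?(ltW e0)// lerDl//.
Qed.

Section Space.
Variable D : set V.
Hypotheses (oD : open D) (cD : convex D).
Local Notation d := (kobayashi_dist D).

(** By Schwarz-Pick half the logarithm of the distance to a hyperplane that misses [D]
    changes along a path with at most the Kobayashi speed. This is the Poincare
    distance of two points of a half-plane on the same normal line. *)
Lemma dist_log_lb p q a (c : R) : (forall z, D z -> c < rdot z a) -> D p -> D q ->
  2^-1 * ln (rdot p a - c) - 2^-1 * ln (rdot q a - c) <= d p q.
Proof.
move=> hD Dp Dq; apply/ler_addgt0Pr => e e0.
have [|G [G' [h [h' [[dG cG GD [G0 G1] hb] hL]]]]] := @dist_lt_bound _ _ D oD cD p q (d p q + e) Dp Dq.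
  by rewrite ltrDl.
pose m (t : R) := rdot (complexify (G t)) a - c.
have m0 t : 0 <= t <= 1 -> 0 < m t by move=> ht; rewrite subr_gt0; apply: hD; exact: GD.
have dm (t : R) : is_derive t (1 : R) m (rdot (complexify (G' t)) a).
  by have := is_deriveB (is_derive_rdot a (dG t)) (is_derive_cst c t (1 : R)); rewrite subr0.
have df (t : R) : 0 <= t <= 1 -> is_derive t (1 : R) (fun t => - 2^-1 * ln (m t))
    (- 2^-1 * (rdot (complexify (G' t)) a * (m t)^-1)).
  by move=> ht; exact: (is_deriveZ (- 2^-1) (is_derive_comp (dm t) (is_derive1_ln (m0 t ht)))).
have dh (t : R) (ht : 0 <= t <= 1) := (hb t ht).1.
have := derive_le_increment df dh.
have -> : m 1 = rdot q a - c by rewrite /m G1.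
have -> : m 0 = rdot p a - c by rewrite /m G0.
move=> H; have {H} : - 2^-1 * ln (rdot q a - c) - - 2^-1 * ln (rdot p a - c) <= h 1 - h 0.
  apply: H => t ht; apply: le_trans (hb t ht).2.
  have hD' z : D z -> c <= rdot z a by move=> /hD/ltW.
  have := kob_lbound oD (complexify (G' t)) hD' (GD t ht); rewrite -/(m t).
  have := Re_le_cabs (hdot (complexify (G' t)) a).
  rewrite -[complex.Re _]/(rdot _ _); set v := rdot _ _; set k := kob _ _ _.
  move=> h1 h2; rewrite mulNr -mulrN -mulNr mulrA ler_pdivrMr ?m0//.
  have := ler_norm (- v); rewrite normrN; lra.
lra.
Qed.

Lemma dist_vnorm p q (r : R) : 0 < r -> (forall w, vnorm w < r -> D (p + w)) ->
  vnorm (q - p) < r / 2 -> d p q <= vnorm (q - p) / (r / 2).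
Proof.
move=> r0 hr qp; have r2 : 0 < r / 2 by rewrite divr_gt0.
have Dp : D p by rewrite -[p]addr0; apply: hr; rewrite vnorm0.
have Dq : D q by have := hr (q - p); rewrite [p + _]addrC subrK; apply; lra.
have [G [G' [dG cG GE G'E GD]]] := curve_bound_segment cD Dp Dq.
set L := vnorm (q - p) / (r / 2).
have B : curve_bound D p q G G' (fun t => L * t) (cst L).
  split=> //; first by rewrite !GE scale0r addr0 scale1r [p + _]addrC subrK.
  move=> t /andP[t0 t1]; split.
    by have := is_deriveZ L (is_derive_id t (1 : R)); rewrite -[_ *: _]/(_ * _) mulr1.
  rewrite GE G'E; apply: kob_vnorm => // w wr; rewrite -addrA; apply: hr.
  apply: le_lt_trans (vnormD _ _) _; rewrite vnormZ cabs_real ger0_norm//.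
  have : t * vnorm (q - p) <= 1 * vnorm (q - p) by rewrite ler_wpM2r ?vnorm_ge0.
  lra.
by have := dist_le_bound oD cD B; rewrite mulr1 mulr0 subr0.
Qed.

Hypothesis bD : exists2 M : R, 0 < M & forall z, D z -> vnorm z <= M.

Lemma dist_separated p q : D p -> D q -> d p q = 0 -> p = q.
Proof.
move=> Dp Dq dpq; have [M M0 hM] := bD; pose a := p - q.
have hD z : D z -> - (n%:R * vnorm a * M) - 1 < rdot z a.
  move=> Dz; have : `|rdot z a| <= n%:R * vnorm a * M.
    by apply: le_trans (rdot_bound _ _) _; rewrite ler_wpM2l ?mulr_ge0 ?vnorm_ge0// hM.
  by rewrite ler_norml; lra.
have h1 := dist_log_lb hD Dp Dq; have h2 := dist_log_lb hD Dq Dp.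
rewrite (dist_sym oD cD Dq Dp) in h2; rewrite dpq in h1 h2.
have p0 := hD _ Dp; have q0 := hD _ Dq.
have /ln_inj E : ln (rdot p a - (- (n%:R * vnorm a * M) - 1)) =
   ln (rdot q a - (- (n%:R * vnorm a * M) - 1)) by lra.
have {}E : rdot p a = rdot q a.
  by have := E; rewrite !posrE !subr_gt0 => /(_ p0 q0); lra.
apply/eqP; rewrite -subr_eq0 -/a; apply/eqP/esq_eq0.
by rewrite /esq {1}/a rdotBl E subrr.
Qed.

Lemma kobayashi_metric_on : metric_on D d.
Proof.
split; [move=> x|move=> x y|move=> x y z].
- exact: dist_refl.
- exact: dist_sym.
- exact: dist_triangle.
Qed.

Hypothesis support : forall x, closure D x -> ~ D x -> exists a, forall z, D z -> rdot x a < rdot z a.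

(** A limit of points of the ball cannot be a boundary point: the supporting
    hyperplane there makes the distance of the approximating points tend to infinity
    by [dist_log_lb]. *)
Lemma dist_ball_closed o (r : R) : D o -> closed [set z | D z /\ d o z <= r].
Proof.
move=> Do x cl.
have clD : closure D x by apply: closureS cl => z [].
have near (e : R) : 0 < e -> exists w, [/\ vnorm w < e, D (x + w) & d o (x + w) <= r].
  by move=> e0; have [w we [Dw dw]] := (closure_vecP _ _).1 cl e e0; exists w.
have [Dx|nDx] := pselect (D x).
  split=> //; apply/ler_addgt0Pr => e e0; have [s s0 hs] := open_vecP oD Dx.
  have [|w [w1 Dw dw]] := near (Num.min (s / 2) (e * (s / 2))).
    by rewrite lt_min !(mulr_gt0, divr_gt0).
  move: w1; rewrite lt_min => /andP[w1 w2].
  have xw : x + w - x = w by rewrite addrC addKr.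
  have hv : d x (x + w) <= vnorm w / (s / 2).
    by have := dist_vnorm s0 hs (q := x + w); rewrite xw; apply.
  have s2 : 0 < s / 2 by rewrite divr_gt0.
  have : vnorm w / (s / 2) <= e by rewrite ler_pdivrMr// ltW.
  have := dist_triangle oD cD Do Dw Dx; rewrite (dist_sym oD cD Dw Dx); lra.
exfalso; have [a ha] := support clD nDx.
have m0 : 0 < rdot o a - rdot x a by rewrite subr_gt0 ha.
pose eps := expR (ln (rdot o a - rdot x a) - 2 * r).
have eps0 : 0 < eps by exact: expR_gt0.
have [s s0 small] := rdot_small a eps0; have [w [w1 Dw dw]] := near _ s0.
have := dist_log_lb ha Do Dw.
have -> : rdot (x + w) a - rdot x a = rdot w a by rewrite rdotDl addrC addKr.
have rw0 : 0 < rdot w a by have := ha _ Dw; rewrite rdotDl ltrDl.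
have : rdot w a < eps := le_lt_trans (ler_norm _) (small _ w1).
rewrite -ltr_ln ?posrE// /eps expRK; lra.
Qed.

Lemma continuous_complexify : continuous (@complexify R n).
Proof.
move=> x A /nbhs_vecP[r r0 hA]; apply/nbhs_ballP; exists (r / 2); first exact: divr_gt0.
move=> y; rewrite -ball_normE /= => xy.
have -> : complexify y = complexify x + complexify (y - x).
  by rewrite -complexifyD addrC subrK.
apply: hA; apply: le_lt_trans (vnorm_complexify _) _.
by rewrite distrC; lra.
Qed.

Lemma norm_le_vnorm (w : W) : `|w| <= vnorm (complexify w).
Proof.
rewrite [leLHS]/Num.Def.normr/= mx_normrE; apply: bigmax_le; first exact: vnorm_ge0.
move=> [i j] _ /=; rewrite (ord1 i).
have hl k : `|lsubmx w 0 k| <= vnorm (complexify w).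
  apply: le_trans (cabs_le_vnorm _ k); have := Re_le_cabs (complexify w 0 k).
  by rewrite {1}/complexify mxE.
have hr k : `|rsubmx w 0 k| <= vnorm (complexify w).
  apply: le_trans (cabs_le_vnorm _ k); have := Im_le_cabs (complexify w 0 k).
  by rewrite {1}/complexify mxE.
by rewrite -(splitK j); case: (fintype.split j) => k /=; [have := hl k|have := hr k]; rewrite mxE.
Qed.

Lemma dist_ball_compact o (r : R) : D o -> compact [set z | D z /\ d o z <= r].
Proof.
move=> Do; have cl := @dist_ball_closed o r Do.
set B := [set z | _] in cl *.
have -> : B = @complexify R n @` (@complexify R n @^-1` B).
  apply/seteqP; split=> [z Bz|_ [w Bw <-]//].
  by exists (realify z); rewrite /= ?realifyK.
apply: continuous_compact.
  by apply: continuous_subspaceT; exact: continuous_complexify.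
apply: bounded_closed_compact; last first.
  by apply: closed_comp => // x _; exact: continuous_complexify.
have [M M0 hM] := bD; exists M; split; first exact: num_real.
move=> K MK w [Dw _]; apply: le_trans (norm_le_vnorm w) _.
by apply: le_trans (hM _ Dw) _; exact: ltW.
Qed.

Theorem kobayashi_geodesic x y : D x -> D y -> exists g, geodesic_from D d x y g.
Proof.
move=> Dx Dy; apply: geodesic_exists => //.
- exact: kobayashi_metric_on.
- exact: dist_separated.
- by move=> p q s t e Dp Dq s0 t0 pq e0; exact: dist_split.
- by move=> o r Do; exact: dist_ball_compact.
- by move=> o r Do; exact: dist_ball_closed.
Qed.

End Space.
End KobayashiSpace.

(** * Interior tangent balls of a smooth domain *)

Section Taylor.
Variables (R : realType) (N : nat).
Local Notation W := 'rV[R]_N.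
Implicit Types (x y w v : W) (g : W -> R).

Lemma is_derive_along g x v (t : R) : derivable g (x + t *: v) v ->
  is_derive t (1 : R) (fun s => g (x + s *: v)) ('D_v g (x + t *: v)).
Proof.
move=> dg.
have E : (fun k : R => k^-1 *: (((fun s : R => g (x + s *: v)) \o shift t) (k *: (1 : R)) - g (x + t *: v))) =
   (fun k : R => k^-1 *: ((g \o shift (x + t *: v)) (k *: v) - g (x + t *: v))).
  apply/funext => k /=; congr (_ *: (g _ - _)).
  by rewrite [_%:A]mulr1 scalerDl addrCA.
by split; rewrite /derivable /derive E.
Qed.

Lemma le_increment_along g x v (c B : R) :
  (forall t : R, `|t| <= `|c| -> derivable g (x + t *: v) v /\ `|'D_v g (x + t *: v)| <= B) ->
  `|g (x + c *: v) - g x| <= B * `|c|.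
Proof.
move=> h; pose f (t : R) := g (x + t *: v).
have df t : `|t| <= `|c| -> is_derive t (1 : R) f ('D_v g (x + t *: v)).
  by move=> /h[dg _]; exact: is_derive_along.
have -> : g x = f 0 by rewrite /f scale0r addr0.
rewrite -/(f c).
have increment a b : a <= b -> (forall t, a <= t <= b -> `|t| <= `|c|) ->
    `|f b - f a| <= B * (b - a).
  move=> ab itv.
  have itv' t : t \in `[a, b]%R -> `|t| <= `|c| by rewrite in_itv/=; exact: itv.
  have cf : {within `[a, b], continuous f}.
    by apply: derivable_within_continuous => t /itv' /df[].
  have df' t : t \in `]a, b[%R -> is_derive t (1 : R) f ('D_v g (x + t *: v)).
    by move=> ht; apply/df/itv'; exact: subset_itv_oo_cc.
  have [t ht ->] := MVT_segment ab df' cf.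
  rewrite normrM (ger0_norm (_ : 0 <= b - a)) ?subr_ge0// ler_wpM2r ?subr_ge0//.
  by have [] := h t (itv' _ ht).
have [c0|/ltW c0] := leP 0 c.
  have := increment 0 c c0; rewrite subr0 (ger0_norm c0); apply => t /andP[t0 tc].
  by rewrite ger0_norm.
have := increment c 0 c0; rewrite sub0r distrC (ler0_norm c0); apply => t /andP[ct t0].
by rewrite ler0_norm// lerN2.
Qed.

Definition basis_vec (j : 'I_N) : W := delta_mx 0 j.

Definition truncate (k : nat) w : W := \row_j (if (j < k)%N then w 0 j else 0).

Lemma normr_row_le w (M : R) : 0 <= M -> (forall j, `|w 0 j| <= M) -> `|w| <= M.
Proof.
move=> M0 h; rewrite [leLHS]/Num.Def.normr/= mx_normrE; apply: bigmax_le => //.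
by move=> [i j] _ /=; rewrite ord1.
Qed.

(** Move one coordinate at a time: [truncate k w] keeps the first [k] coordinates of
    [w] and stays in the ball of the maximum norm. *)
Lemma mean_value_coordinates g x (s B : R) : 0 <= B ->
  (forall y, `|y| <= s -> forall j, derivable g (x + y) (basis_vec j) /\
     `|'D_(basis_vec j) g (x + y)| <= B) ->
  forall w, `|w| <= s -> `|g (x + w) - g x| <= N%:R * B * s.
Proof.
move=> B0 h w ws; have s0 : 0 <= s by exact: le_trans (normr_ge0 _) ws.
suff H k : (k <= N)%N -> `|g (x + truncate k w) - g x| <= k%:R * B * s.
  have -> : w = truncate N w by apply/rowP => j; rewrite mxE ltn_ord.
  exact: H.
elim: k => [_|k IH kN].
  have -> : truncate 0 w = 0 by apply/rowP => j; rewrite !mxE.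
  by rewrite addr0 subrr normr0 !mul0r.
pose j0 := Ordinal kN.
have E : truncate k.+1 w = truncate k w + w 0 j0 *: basis_vec j0.
  apply/rowP => j; rewrite !mxE eqxx /= ltnS.
  have [->|jj] := eqVneq j j0; first by rewrite /= ltnn leqnn add0r mulr1.
  have jk : j != k :> nat by [].
  by rewrite mulr0 addr0 leq_eqVlt (negbTE jk).
have bd (t : R) : `|t| <= `|w 0 j0| -> `|truncate k w + t *: basis_vec j0| <= s.
  move=> ht; apply: normr_row_le => // j; rewrite !mxE eqxx /=.
  have [->|jj] := eqVneq j j0.
    by rewrite /= ltnn add0r mulr1 (le_trans ht)// (le_trans (normr_coord _ _)).
  rewrite mulr0 addr0; case: ifP => _; last by rewrite normr0.
  exact: le_trans (normr_coord _ _) ws.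
have := @le_increment_along g (x + truncate k w) (basis_vec j0) (w 0 j0) B.
rewrite -addrA -E => H1.
have {}H1 : `|g (x + truncate k.+1 w) - g (x + truncate k w)| <= B * s.
  apply: (@le_trans _ _ (B * `|w 0 j0|)).
    by apply: H1 => t ht; rewrite -addrA; apply: h; exact: bd.
  by rewrite ler_wpM2l// (le_trans (normr_coord _ _)).
rewrite -(subrK (g (x + truncate k w)) (g (x + truncate k.+1 w))) -addrA.
apply: le_trans (ler_normD _ _) _.
have := IH (ltnW kN); rewrite -natr1 !mulrDl mul1r; lra.
Qed.

Lemma is_derive_linear_growth g x v (c : R) : (forall h : R, g (h *: v + x) = h * c + g x) ->
  is_derive x v g c.
Proof.
move=> h; have lim : ((fun k : R => k^-1 *: ((g \o shift x) (k *: v) - g x)) @ 0^') --> c.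
  apply/cvgrPdist_le => e e0; near=> k; rewrite /= h addrK -[_ *: _]/(_ * _) mulKf; last first.
    by near: k; exact: nbhs_dnbhs_neq.
  by rewrite subrr normr0 ltW.
by split; [apply/cvg_ex; exists c|exact: cvg_lim lim].
Unshelve. all: by end_near. Qed.

(** The mean value inequality bounds the variation of the first derivatives; applied
    once more, to [g] minus its linear part, it gives a quadratic remainder. *)
Lemma taylor2 g x (delta B : R) : 0 <= B ->
  (forall y, `|y| < delta -> forall j, derivable g (x + y) (basis_vec j) /\
     forall k, derivable ('D_(basis_vec j) g) (x + y) (basis_vec k) /\
       `|'D_(basis_vec k) ('D_(basis_vec j) g) (x + y)| <= B) ->
  forall w, `|w| < delta ->
    `|g (x + w) - g x - \sum_j w 0 j * 'D_(basis_vec j) g x| <= N%:R * (N%:R * B) * `|w| ^+ 2.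
Proof.
move=> B0 h w wd.
pose l y := \sum_j y 0 j * 'D_(basis_vec j) g x.
have lD y z : l (y + z) = l y + l z.
  by rewrite /l -big_split; apply: eq_bigr => j _; rewrite mxE mulrDl.
have lZ (c : R) y : l (c *: y) = c * l y.
  by rewrite /l mulr_sumr; apply: eq_bigr => j _; rewrite mxE mulrA.
have le j : l (basis_vec j) = 'D_(basis_vec j) g x.
  rewrite /l (bigD1 j)//= big1 ?addr0; first by rewrite mxE !eqxx mul1r.
  by move=> k /negbTE kj; rewrite mxE kj andbF mul0r.
have dl y j : is_derive y (basis_vec j) l ('D_(basis_vec j) g x).
  by apply: is_derive_linear_growth => k; rewrite lD lZ le.
have first_bound y j : `|y| <= `|w| ->
    `|'D_(basis_vec j) g (x + y) - 'D_(basis_vec j) g x| <= N%:R * B * `|w|.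
  move=> yw; apply: (@mean_value_coordinates ('D_(basis_vec j) g) x `|w| B B0 _ y yw) => z zw k.
  by have [_ ] := h z (le_lt_trans zw wd) j; apply.
have NB : 0 <= N%:R * B * `|w| by rewrite !mulr_ge0.
have := @mean_value_coordinates (g - l) x `|w| (N%:R * B * `|w|) NB.
move=> /(_ _ w (lexx _)).
have -> : (g - l) (x + w) - (g - l) x = g (x + w) - g x - l w.
  by rewrite !fctE lD; ring.
move=> H; apply: le_trans (H _) _.
  move=> y yw j; have [dg _] := h y (le_lt_trans yw wd) j.
  have [d1 d2] := is_deriveB (derivableP dg) (dl (x + y) j).
  by split=> //; rewrite d2; exact: first_bound.
by rewrite expr2 !mulrA.
Qed.

End Taylor.

Section InnerBall.
Variables (R : realType) (n : nat).
Local Notation V := 'rV[R[i]]_n.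
Local Notation W := 'rV[R]_(n + n).

(** The condition on [w] says that [xi + w] lies in the open Euclidean ball of radius
    [r] centred at [xi + r nu], which is tangent at [xi]. *)
Definition inner_ball (D : set V) (xi nu : V) (r : R) :=
  [/\ 0 < r, esq nu = 1 & forall w, esq w < 2 * r * rdot w nu -> D (xi + w)].

Lemma rdot_complexify (x y : W) : rdot (complexify x) (complexify y) = \sum_j x 0 j * y 0 j.
Proof.
rewrite rdotE [RHS]big_split_ord big_split /=.
by congr (_ + _); apply: eq_bigr => j _; rewrite !mxE.
Qed.

Lemma realifyD (z w : V) : realify (z + w) = realify z + realify w.
Proof.
by rewrite -[LHS]complexifyK -[RHS]complexifyK complexifyD !realifyK.
Qed.

Lemma le_double_sum (I : finType) (F : I -> I -> R) : (forall j k, 0 <= F j k) ->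
  forall j k, F j k <= \sum_j \sum_k F j k.
Proof.
move=> F0 j k; rewrite (bigD1 j)//= (bigD1 k)//= -addrA lerDl addr_ge0//.
  by rewrite sumr_ge0.
by rewrite sumr_ge0// => i _; rewrite sumr_ge0.
Qed.

Lemma norm_near_le (u v S : R) : `|u - v| < 1 -> `|u| <= S -> `|v| <= 1 + S.
Proof. by have := ler_normB u (u - v); rewrite opprB addrC subrK; lra. Qed.

(** With [nu] the normalized opposite of the gradient of the defining function, a
    second-order expansion gives a value at [xi + w] of at most
    [- kap * rdot w nu + C * esq w], which is negative in a tangent ball of small
    radius. The gradient does not vanish because some directional derivative does
    not. *)
Lemma smooth_inner_ball (D : set V) (xi : V) : smooth_boundary D -> boundary D xi ->
  exists nu r, inner_ball D xi nu r.
Proof.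
move=> sm bxi; have [U [rho [[oU Uxi] smo [v dv] DU]]] := sm xi bxi.
have [clxi _] := bxi.
pose f := rho \o @complexify R n; pose x0 := realify xi.
have fx0 : f x0 = rho xi by rewrite /f /= realifyK.
have Ux0 : (@complexify R n @^-1` U) x0 by rewrite /= realifyK.
pose e := @basis_vec R (n + n).
pose B := 1 + \sum_j \sum_k `|'D_(e k) ('D_(e j) f) x0|.
have B0 : 0 <= B by rewrite addr_ge0// sumr_ge0// => j _; rewrite sumr_ge0.
have nearU : \forall x \near x0, U (complexify x).
  by apply: continuous_complexify; rewrite realifyK; exact: open_nbhs_nbhs.
have nearB : \forall x \near x0, forall jk : 'I_(n + n) * 'I_(n + n),
    `|'D_(e jk.2) ('D_(e jk.1) f) x| <= B.
  pose Q (jk : 'I_(n + n) * 'I_(n + n)) (x : W) := `|'D_(e jk.2) ('D_(e jk.1) f) x| <= B.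
  apply: (@filter_forall W _ Q (nbhs x0)) => -[j k]; rewrite /Q /=.
  have [cjk _] := smo [:: e k; e j] x0 Ux0.
  near=> x.
  apply: norm_near_le (le_double_sum (fun j k => normr_ge0 ('D_(e k) ('D_(e j) f) x0)) j k).
  by near: x; apply: cvgr_dist_lt => //; exact: cjk.
have [delta /= d0 hd] := (nbhs_ballP _ _).1 (filterI nearU nearB).
have inball (y : W) : `|y| < delta -> ball x0 delta (x0 + y).
  by rewrite -ball_normE /= opprD addNKr normrN.
have T := @taylor2 R (n + n) f x0 delta B B0 _.
have {T} T (w : W) : `|w| < delta -> `|f (x0 + w) - f x0 - \sum_j w 0 j * 'D_(e j) f x0| <=
    (n + n)%:R * ((n + n)%:R * B) * `|w| ^+ 2.
  apply: T => y yd j; have [Uy By] := hd _ (inball y yd).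
  split; first by have [_ ] := smo [::] (x0 + y) Uy; apply.
  move=> k; split; last exact: (By (j, k)).
  by have [_ ] := smo [:: e j] (x0 + y) Uy; apply.
set C := (n + n)%:R * ((n + n)%:R * B) in T.
have C0 : 0 <= C by rewrite !mulr_ge0.
pose gr : W := \row_j 'D_(e j) f x0; pose a : V := complexify gr.
have grE (w : W) : \sum_j w 0 j * 'D_(e j) f x0 = rdot (complexify w) a.
  by rewrite rdot_complexify; apply: eq_bigr => j _; rewrite [gr _ _]mxE.
have a0 : a != 0.
  apply/eqP => a0; move/eqP: dv; apply.
  have [_ dfv] := smo [::] x0 Ux0; have {}dfv : derivable f x0 v := dfv v.
  apply/eqP; rewrite -normr_eq0 eq_le normr_ge0 andbT; apply/ler_addgt0Pr => eps eps0.
  rewrite add0r.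
  have K0 : 0 < C * `|v| ^+ 2 + 1 by rewrite ltr_wpDl// mulr_ge0// exprn_ge0.
  have V0 : 0 < `|v| + 1 by rewrite ltr_wpDl.
  have e2 : 0 < eps / 2 by rewrite divr_gt0.
  move/cvgrPdist_le : dfv => /(_ _ e2)/nbhs_ballP[r /= r0 hr].
  pose k := Num.min (r / 2) (Num.min (delta / (`|v| + 1) / 2) (eps / 2 / (C * `|v| ^+ 2 + 1))).
  have k0 : 0 < k by rewrite !lt_min !divr_gt0.
  have k1 : k <= r / 2 by rewrite ge_min lexx.
  have k2 : k <= delta / (`|v| + 1) / 2 by rewrite !ge_min lexx orbT.
  have k3 : k <= eps / 2 / (C * `|v| ^+ 2 + 1) by rewrite !ge_min lexx !orbT.
  have kb : ball 0 r k by rewrite -ball_normE /= sub0r normrN gtr0_norm//; lra.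
  have := hr _ kb (lt0r_neq0 k0); rewrite -/(derive f x0 v) /=.
  have kv : `|k *: v| < delta.
    rewrite normrZ gtr0_norm//.
    have : k * (`|v| + 1) <= delta / 2 by rewrite -ler_pdivlMr// mulrAC.
    lra.
  have := T _ kv; rewrite grE a0 rdotC rdot0l subr0 => T1.
  have T2 : `|k^-1 *: (f (k *: v + x0) - f x0)| <= eps / 2.
    rewrite normrZ normfV (gtr0_norm k0) mulrC ler_pdivrMr//.
    rewrite [k *: v + x0]addrC; apply: le_trans T1 _.
    rewrite normrZ (gtr0_norm k0) exprMn mulrCA (expr2 k) -mulrA [leRHS]mulrC ler_pM2l//.
    have : k * (C * `|v| ^+ 2 + 1) <= eps / 2 by rewrite -ler_pdivlMr.
    lra.
  have := ler_normD ('D_v f x0 - k^-1 *: (f (k *: v + x0) - f x0)) (k^-1 *: (f (k *: v + x0) - f x0)).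
  rewrite subrK; lra.
have ea0 : 0 < esq a.
  rewrite lt_neqAle esq_ge0 andbT eq_sym; apply/negP => /eqP/esq_eq0/eqP.
  by rewrite (negbTE a0).
pose kap := Num.sqrt (esq a); have kap0 : 0 < kap by rewrite sqrtr_gt0.
pose nu : V := (- kap^-1)%:C *: a.
have nu1 : esq nu = 1.
  rewrite /nu esqZ cabs_real normrN gtr0_norm ?invr_gt0// -[esq a]sqr_sqrtr ?ltW//.
  by rewrite -/kap -exprMn mulVf ?gt_eqF// expr1n.
have rnu w : rdot w a = - kap * rdot w nu.
  by rewrite /nu rdotZr mulrA mulrNN mulfV ?gt_eqF// mul1r.
have rho0 : f x0 <= 0.
  rewrite leNgt; apply/negP => fpos.
  have [cf _] := smo [::] x0 Ux0; have {}cf : {for x0, continuous f} := cf.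
  have nearf : \forall x \near x0, `|f x0 - f x| < f x0 by move/cvgrPdist_lt : cf; apply.
  have [s /= s0 hs] := (nbhs_ballP _ _).1 (filterI nearU nearf).
  have [w ws Dw] := (closure_vecP _ _).1 clxi s s0.
  have bw : ball x0 s (x0 + realify w).
    rewrite -ball_normE /= opprD addNKr normrN; apply: le_lt_trans ws.
    by apply: le_trans (norm_le_vnorm _) _; rewrite realifyK.
  have [Uw fw] := hs _ bw.
  have : (D `&` U) (xi + w) by split=> //; move: Uw; rewrite -realifyD realifyK.
  rewrite DU => -[/= + _]; move: fw; rewrite -realifyD /f /= !realifyK -/(rho xi).
  by rewrite -fx0 /f /= realifyK ltr_norml; lra.
pose r := Num.min (delta / 2) (kap / (2 * (2 * C + 1))).
have C1 : 0 < 2 * (2 * C + 1) by rewrite mulr_gt0// ltr_wpDl ?mulr_ge0.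
have r0 : 0 < r by rewrite lt_min !divr_gt0.
have r1 : 2 * r <= delta.
  have : r <= delta / 2 by rewrite ge_min lexx.
  lra.
have r2 : r * (2 * (2 * C + 1)) <= kap by rewrite -ler_pdivlMr// ge_min lexx orbT.
exists nu, r; split=> // w hw.
have wr : vnorm w < 2 * r.
  have : vnorm (w - r%:C *: nu) < r.
    rewrite -(ltr_pXn2r (ltn0Sn 1)) ?nnegrE ?vnorm_ge0 ?ltW//.
    apply: le_lt_trans (vnorm_sqr_le _) _.
    rewrite esqD esqN esqZ cabs_real (gtr0_norm r0) nu1 rdotNr rdotZr; lra.
  have : vnorm (r%:C *: nu) <= r.
    rewrite vnormZ cabs_real (gtr0_norm r0) -[leRHS]mulr1 ler_pM2l//.
    by rewrite -(ler_pXn2r (ltn0Sn 1)) ?nnegrE ?vnorm_ge0// expr1n -nu1 vnorm_sqr_le.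
  by have := vnormD (w - r%:C *: nu) (r%:C *: nu); rewrite subrK; lra.
have wn : `|realify w| <= vnorm w by apply: le_trans (norm_le_vnorm _) _; rewrite realifyK.
have wd : `|realify w| < delta by lra.
have [Uw _] := hd _ (inball _ wd).
have Tw := T _ wd; rewrite grE realifyK rnu in Tw.
have wpos : 0 < rdot w nu.
  have : 0 < 2 * r * rdot w nu by exact: le_lt_trans (esq_ge0 w) hw.
  by rewrite pmulr_rgt0// mulr_gt0.
have sq : C * `|realify w| ^+ 2 <= C * (2 * r * rdot w nu).
  rewrite ler_wpM2l//; apply: le_trans (ltW hw); apply: le_trans (vnorm_sqr_le w).
  by rewrite ler_pXn2r ?nnegrE ?vnorm_ge0.
have key : r * (2 * (2 * C + 1)) * rdot w nu <= kap * rdot w nu by rewrite ler_wpM2r// ltW.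
have rw : 0 < r * rdot w nu by rewrite mulr_gt0.
have Crw : 0 <= C * (r * rdot w nu) by rewrite mulr_ge0// ltW.
have neg : f (x0 + realify w) < 0 by move: Tw; rewrite ler_norml; lra.
have : ([set z | rho z < 0] `&` U) (xi + w).
  split; first by move: neg; rewrite -realifyD /f /= realifyK.
  by move: Uw; rewrite -realifyD realifyK.
by rewrite -DU => -[].
Unshelve. all: by end_near. Qed.

End InnerBall.

(** * Supporting hyperplanes *)

Section Convexity.
Variables (R : realType) (n : nat).
Local Notation V := 'rV[R[i]]_n.
Variable D : set V.
Hypotheses (oD : open D) (cD : convex D).

Lemma boundaryE x : closure D x -> ~ D x -> boundary D x.
Proof. by move=> cl nD; split=> //; rewrite (interior_id _).1. Qed.

Lemma closure_rdot_ge a (c : R) : (forall z, D z -> c <= rdot z a) ->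
  forall x, closure D x -> c <= rdot x a.
Proof.
move=> hD x /closure_vecP clx; apply/ler_addgt0Pr => e e0.
have [r r0 small] := rdot_small a e0; have [w /small + Dw] := clx _ r0.
by have := hD _ Dw; rewrite rdotDl ltr_norml; lra.
Qed.

Lemma closure_convex_interior x y (s : R) : closure D x -> D y -> 0 < s <= 1 ->
  D ((1 - s)%:C *: x + s%:C *: y).
Proof.
move=> /closure_vecP clx Dy /andP[s0 s1].
have [->|s1'] := eqVneq s 1; first by rewrite subrr scale0r add0r scale1r.
have s1s : 0 < 1 - s by rewrite subr_gt0 lt_neqAle s1'.
have [r r0 hr] := open_vecP oD Dy.
have [w wr Dw] := clx (r * s / (1 - s)) (divr_gt0 (mulr_gt0 r0 s0) s1s).
pose v := - ((1 - s) / s)%:C *: w.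
have vr : vnorm v < r.
  rewrite /v scaleNr vnormN vnormZ cabs_real gtr0_norm ?divr_gt0//.
  by rewrite mulrAC ltr_pdivrMr// mulrC -ltr_pdivlMr.
have -> : (1 - s)%:C *: x + s%:C *: y = (1 - s)%:C *: (x + w) + (1 - (1 - s))%:C *: (y + v).
  have -> : 1 - (1 - s) = s by ring.
  have vw : (1 - s)%:C *: w + s%:C *: v = 0.
    by rewrite /v scaleNr scalerN scalerA -rmorphM /= mulrC divfK ?gt_eqF// subrr.
  by rewrite !scalerDr addrACA vw addr0.
by have /convexP := cD; apply => //; [lra|exact: hr].
Qed.

(** If a point [z] of [D] were strictly below the tangent hyperplane, the ray from [z]
    through [xi] would enter the tangent ball just after [xi], and [xi] would be
    a convex combination of two points of [D]. *)
Lemma inner_ball_support xi nu (r : R) : inner_ball D xi nu r -> ~ D xi ->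
  forall z, D z -> rdot xi nu < rdot z nu.
Proof.
move=> [r0 nu1 hD] nD.
have weak z : D z -> rdot xi nu <= rdot z nu.
  move=> Dz; rewrite leNgt; apply/negP => lt; apply: nD.
  pose k := rdot xi nu - rdot z nu; have k0 : 0 < k by rewrite subr_gt0.
  pose E := esq (xi - z); have E0 : 0 <= E := esq_ge0 _.
  have E1 : 0 < E + 1 by rewrite ltr_wpDl.
  pose s := r * k / (E + 1); have s0 : 0 < s by rewrite divr_gt0// mulr_gt0.
  have sE : s * (E + 1) = r * k by rewrite /s divfK// gt_eqF.
  have Dw : D (xi + s%:C *: (xi - z)).
    apply: hD; rewrite esqZ cabs_real gtr0_norm// -/E rdotZl rdotBl -/k expr2.
    have -> : 2 * r * (s * k) = s * (2 * (r * k)) by ring.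
    by rewrite -mulrA ltr_pM2l// -sE; have := mulr_ge0 (ltW s0) E0; lra.
  have s1 : 1 + s != 0 by rewrite gt_eqF// ltr_wpDl.
  pose c := (1 + s)^-1.
  have c1 : c + c * s = 1 by rewrite /c; field.
  have cs : 1 - c = c * s by lra.
  have -> : xi = c%:C *: (xi + s%:C *: (xi - z)) + (1 - c)%:C *: z.
    rewrite cs scalerDr scalerA -rmorphM /= scalerBr -addrA subrK.
    by rewrite -scalerDl -rmorphD /= c1 scale1r.
  have c0 : 0 <= c by rewrite invr_ge0; lra.
  have cs0 : 0 <= c * s by rewrite mulr_ge0// ltW.
  by have /convexP := cD; apply=> //; lra.
move=> z Dz; rewrite lt_neqAle weak// andbT; apply/eqP => E.
have [e e0 he] := open_vecP oD Dz.
have K : 0 < vnorm nu + 1 by rewrite ltr_wpDl ?vnorm_ge0.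
pose s := e / (vnorm nu + 1) / 2; have s0 : 0 < s by rewrite !divr_gt0.
have : D (z + (- s)%:C *: nu).
  apply: he; rewrite vnormZ cabs_real normrN gtr0_norm//.
  have : s * (vnorm nu + 1) = e / 2 by rewrite /s mulrAC divfK// gt_eqF.
  lra.
by move=> /weak; rewrite rdotDl rdotZl -[rdot nu nu]/(esq nu) nu1 E; lra.
Qed.

(** The points [xi + r (nu' - s nu)] lie in the tangent ball for [s < 1]; the
    supporting hyperplane gives [s <= rdot nu' nu], and [s] tends to 1. *)
Lemma inner_ball_normal_unique xi nu nu' (r : R) : inner_ball D xi nu' r -> esq nu = 1 ->
  (forall z, D z -> rdot xi nu <= rdot z nu) -> nu' = nu.
Proof.
move=> [r0 nu'1 hD] nu1 hs.
set x := rdot nu' nu.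
have x1 : 1 <= x.
  apply/ler_addgt0Pr => e e0; pose s := Num.max 0 (1 - e).
  have s0 : 0 <= s by rewrite le_max lexx.
  have s1 : s < 1 by rewrite gt_max ltr01 /= ltrBlDr ltrDl.
  have se : 1 - e <= s by rewrite le_max lexx orbT.
  have Dw : D (xi + r%:C *: (nu' + (- s)%:C *: nu)).
    apply: hD; rewrite esqZ cabs_real gtr0_norm// esqD esqZ cabs_real normrN ger0_norm//.
    rewrite nu1 nu'1 rdotZl rdotDl rdotZr rdotZl (rdotC nu nu') -/x -[rdot nu' nu']/(esq nu') nu'1.
    have rr : 0 < r * r by rewrite mulr_gt0.
    have -> : 2 * r * (r * (1 + - s * x)) = r ^+ 2 * (2 * (1 - s * x)) by ring.
    rewrite ltr_pM2l ?exprn_gt0//.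
    have : s ^+ 2 < 1 by rewrite expr_lt1.
    lra.
  have := hs _ Dw; rewrite rdotDl lerDl rdotZl pmulr_rge0// rdotDl rdotZl -/x.
  by rewrite -[rdot nu nu]/(esq nu) nu1; lra.
apply/eqP; rewrite -subr_eq0; apply/eqP/esq_eq0/le_anti; rewrite esq_ge0 andbT.
by rewrite esqD esqN nu1 nu'1 rdotNr -/x; lra.
Qed.

Hypothesis smD : smooth_boundary D.

Lemma boundary_support x : closure D x -> ~ D x ->
  exists nu r, inner_ball D x nu r /\ forall z, D z -> rdot x nu < rdot z nu.
Proof.
move=> clx nDx; have [nu [r ib]] := smooth_inner_ball smD (boundaryE clx nDx).
by exists nu, r; split=> //; exact: inner_ball_support ib nDx.
Qed.

(** A point outside the closure is cut off by the supporting hyperplane at the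
    point where a segment towards it leaves [D]. *)
Lemma closure_separation x : D !=set0 -> ~ closure D x ->
  exists a (c : R), (forall z, D z -> c < rdot z a) /\ rdot x a < c.
Proof.
case=> y Dy nclx.
have [pt ptE] : exists pt : R -> V, forall t, pt t = y + t%:C *: (x - y) by eexists.
have pt1 : pt 1 = x by rewrite ptE scale1r [y + _]addrC subrK.
have ptD (t u : R) : pt u = pt t + (u - t)%:C *: (x - y).
  by rewrite !ptE -addrA -scalerDl -rmorphD /= [t + _]addrC subrK.
have [s [s0 s1 s_ub s_adh]] : exists s : R, [/\ 0 <= s, s <= 1,
    forall t, 0 <= t <= 1 -> D (pt t) -> t <= s &
    forall e, 0 < e -> exists t, [/\ s - e < t, t <= s & D (pt t)]].
  pose T := [set t : R | 0 <= t <= 1 /\ D (pt t)].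
  have T0 : T 0 by split; [rewrite lexx ler01|rewrite ptE scale0r addr0].
  have Tub : ubound T 1 by move=> t [/andP[]].
  have Tsup : has_sup T by split; [exists 0|exists 1].
  exists (sup T); split.
  - exact: (ub_le_sup Tsup.2 T0).
  - by apply: ge_sup; [exists 0|exact: Tub].
  - by move=> t t01 Dt; exact: (ub_le_sup Tsup.2 (conj t01 Dt)).
  - move=> e e0; have [t Tt te] := sup_adherent e0 Tsup.
    by exists t; split; [exact: te|exact: (ub_le_sup Tsup.2 Tt)|case: Tt].
have K0 : 0 < vnorm (x - y) + 1 by rewrite ltr_wpDl ?vnorm_ge0.
have small (e : R) : 0 < e -> forall t u : R, `|u - t| < e / (vnorm (x - y) + 1) ->
    vnorm ((u - t)%:C *: (x - y)) < e.
  move=> e0 t u; rewrite ltr_pdivlMr// => h; rewrite vnormZ cabs_real.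
  by apply: le_lt_trans h; rewrite ler_wpM2l// lerDl.
have cls : closure D (pt s).
  apply/closure_vecP => e e0.
  have [t [ts tle Dt]] := s_adh _ (divr_gt0 e0 K0).
  exists ((t - s)%:C *: (x - y)); last by rewrite -ptD.
  apply: small => //; rewrite distrC ger0_norm ?subr_ge0//; lra.
have s1' : s < 1 by rewrite lt_neqAle s1 andbT; apply/eqP => E; apply: nclx; rewrite -pt1 -E.
have nDs : ~ D (pt s).
  move=> Ds; have [e e0 he] := open_vecP oD Ds.
  have k0 : 0 < e / (vnorm (x - y) + 1) by rewrite divr_gt0.
  pose m := Num.min (1 - s) (e / (vnorm (x - y) + 1) / 2).
  have m0 : 0 < m by rewrite lt_min subr_gt0 s1' divr_gt0.
  have m1 : m <= 1 - s by rewrite ge_min lexx.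
  have m2 : m <= e / (vnorm (x - y) + 1) / 2 by rewrite ge_min lexx orbT.
  clearbody m; set k := e / _ in k0 m2.
  have mk : `|m| < k by rewrite (gtr0_norm m0); clear -m2 k0; lra.
  have Du : D (pt (s + m)).
    rewrite (ptD s); apply: he; apply: small; first exact: e0.
    by rewrite [s + m]addrC addrK; exact: mk.
  have : s + m <= s by apply: s_ub Du; lra.
  lra.
have [nu [r [_ sup]]] := boundary_support cls nDs.
clear nclx nDs; exists nu, (rdot (pt s) nu); split; first exact: sup.
have h := sup _ Dy; rewrite ptE rdotDl rdotZl gtrDl in h.
have k0 : rdot (x - y) nu < 0.
  have spos : 0 < s by rewrite lt_neqAle s0 andbT; apply/eqP => E; move: h; rewrite -E mul0r ltxx.
  by move: h; rewrite pmulr_rlt0.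
have -> : rdot x nu = rdot (pt s) nu + (1 - s) * rdot (x - y) nu.
  by rewrite -rdotZl -rdotDl -ptD pt1.
by rewrite gtrDl pmulr_rlt0// subr_gt0.
Qed.

End Convexity.

(** * The flat piece of the boundary swept by an analytic disc *)

Section AnalyticDisc.
Variables (R : realType) (n : nat).
Local Notation V := 'rV[R[i]]_n.

Lemma cdiff_affine (f : R[i] -> R[i]) (b c z k : R[i]) : cdiff_at f (b + c * z) k ->
  cdiff_at (fun w => f (b + c * w)) z (k * c).
Proof.
move=> h e e0; have c1 : 0 < cabs c + 1 by rewrite ltr_wpDl ?cabs_ge0.
have [r r0 hr] := h _ (divr_gt0 e0 c1).
exists (r / (cabs c + 1)); first exact: divr_gt0.
move=> w; rewrite ltr_pdivlMr// => wr.
have E : b + c * w - (b + c * z) = c * (w - z) by ring.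
have cw : cabs (c * (w - z)) <= cabs (w - z) * (cabs c + 1).
  by rewrite cabsM mulrC ler_wpM2l ?cabs_ge0// lerDl.
have := hr (b + c * w); rewrite E => /(_ (le_lt_trans cw wr)).
rewrite mulrA => /le_trans; apply.
rewrite -mulrA ler_pM2l// mulrC ler_pdivrMr//.
Qed.

Lemma is_derive_line (f : R[i] -> R[i]) (b w l : R[i]) (t : R) : cdiff_at f (b + t%:C * w) l ->
  is_derive t (1 : R) (fun s : R => complex.Re (f (b + s%:C * w))) (complex.Re (l * w)).
Proof.
move=> h; apply/is_derive_epsP => e e0.
have c1 : 0 < cabs w + 1 by rewrite ltr_wpDl ?cabs_ge0.
have [r r0 hr] := h _ (divr_gt0 e0 c1).
exists (r / (cabs w + 1)); first exact: divr_gt0.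
move=> s; rewrite ltr_pdivlMr// => sr.
have E : b + s%:C * w - (b + t%:C * w) = (s - t)%:C * w by rewrite rmorphB /=; ring.
have cw : cabs ((s - t)%:C * w) <= `|s - t| * (cabs w + 1).
  by rewrite cabsM cabs_real ler_wpM2l// lerDl.
have := hr (b + s%:C * w); rewrite E => /(_ (le_lt_trans cw sr)) H.
rewrite -[_ *: _]/(_ * _) -cReMr -!cReN -!cReD.
have -> : (s - t)%:C * (l * w) = l * ((s - t)%:C * w) by ring.
apply: le_trans (Re_le_cabs _) _; apply: le_trans H _.
by rewrite mulrAC ler_pdivrMr// -mulrA ler_pM2l.
Qed.

Lemma disc_segment (z w : R[i]) (t : R) : cabs z < 1 -> cabs w < 1 -> 0 <= t <= 1 ->
  cabs (w + t%:C * (z - w)) < 1.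
Proof.
move=> z1 w1 /andP[t0 t1].
have -> : w + t%:C * (z - w) = (1 - t)%:C * w + t%:C * z by rewrite rmorphB /=; ring.
apply: le_lt_trans (cabsD _ _) _; rewrite !cabsM !cabs_real !ger0_norm ?subr_ge0//.
have [->|t0'] := eqVneq t 0; first by rewrite mul0r addr0 subr0 mul1r.
have tpos : 0 < t by rewrite lt_neqAle eq_sym t0'.
have : t * cabs z < t * 1 by rewrite ltr_pM2l.
have : (1 - t) * cabs w <= (1 - t) * 1 by rewrite ler_wpM2l ?subr_ge0// ltW.
lra.
Qed.

(** If the derivative vanished everywhere, the product of [phi] with
    [phi z - phi w] would be constant along the segment from [w] to [z]. *)
Lemma nonconstant_derivative (phi : R[i] -> V) (z w : R[i]) :
  (forall z, cabs z < 1 -> derivable phi z 1) -> cabs z < 1 -> cabs w < 1 -> phi z != phi w ->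
  exists z1 l, [/\ cabs z1 < 1, l != 0 & is_derive z1 1 phi l].
Proof.
move=> dphi z1 w1 zw; apply: contrapT => nE.
have d0 y : cabs y < 1 -> is_derive y 1 phi 0.
  move=> y1; have dy := derivableP (dphi y y1).
  have [E|E] := eqVneq ('D_1 phi y) 0; first by rewrite -E.
  by exfalso; apply: nE; exists y, ('D_1 phi y).
clear nE; pose a := phi z - phi w.
pose f (y : R[i]) := hdot (phi y) a.
have df (t : R) : 0 <= t <= 1 ->
    is_derive t (1 : R) (fun s : R => complex.Re (f (w + s%:C * (z - w)))) 0.
  move=> t01; have := is_derive_hdot a (d0 _ (disc_segment z1 w1 t01)).
  rewrite (_ : hdot 0 a = 0); last by rewrite -(scale0r (0 : V)) hdotZl mul0r.
  by move=> /cdiff_atP/is_derive_line; rewrite mul0r.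
have dc (t : R) : 0 <= t <= 1 -> is_derive t (1 : R) (cst (0 : R)) 0 by move=> _; exact: is_derive_cst.
have le00 (t : R) : 0 <= t <= 1 -> (0 : R) <= 0 by [].
have := derive_le_increment df dc le00; have := derive_le_increment dc df le00.
rewrite mul0r addr0 mul1r [w + _]addrC subrK => h1 h2.
have E : complex.Re (f z) = complex.Re (f w) by move: h1 h2; rewrite /cst; lra.
have : esq a = 0 by rewrite /esq {1}/a rdotBl; move: E; rewrite /f -![complex.Re _]/(rdot _ _) => ->; rewrite subrr.
by move=> /esq_eq0/eqP; rewrite subr_eq0 (negbTE zw).
Qed.

Section Face.
Variable D : set V.
Hypotheses (oD : open D) (cD : convex D) (D0 : D !=set0) (smD : smooth_boundary D).

Lemma closure_convex x y (s : R) : closure D x -> closure D y -> 0 <= s <= 1 ->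
  closure D ((1 - s)%:C *: x + s%:C *: y).
Proof.
move=> /closure_vecP clx /closure_vecP cly /andP[s0 s1]; apply/closure_vecP => r r0.
have [u ur Du] := clx r r0; have [v vr Dv] := cly r r0.
exists ((1 - s)%:C *: u + s%:C *: v).
  apply: le_lt_trans (vnormD _ _) _; rewrite !vnormZ !cabs_real !ger0_norm ?subr_ge0//.
  have [->|s0'] := eqVneq s 0; first by rewrite mul0r addr0 subr0 mul1r.
  have spos : 0 < s by rewrite lt_neqAle eq_sym s0'.
  have : s * vnorm v < s * r by rewrite ltr_pM2l.
  have : (1 - s) * vnorm u <= (1 - s) * r by rewrite ler_wpM2l ?subr_ge0// ltW.
  lra.
rewrite addrACA -!scalerDr -[in s%:C](subKr 1 s).
by have /convexP := cD; apply => //; lra.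
Qed.

(** By Schwarz-Pick the tangent disc stays in every half-space that contains [D], and
    [closure D] is the intersection of these half-spaces. *)
Lemma tangent_disc_closure (phi : R[i] -> V) (z0 : R[i]) (l : V) :
  (forall z, cabs z < 1 -> derivable phi z 1) -> (forall z, cabs z < 1 -> closure D (phi z)) ->
  cabs z0 < 1 -> is_derive z0 1 phi l ->
  forall u : R[i], cabs u <= (1 - cabs z0) / 2 -> closure D (phi z0 + u *: l).
Proof.
move=> dphi phiD z01 dl u hu; apply: contrapT => nc.
have [a [c [hD hc]]] := closure_separation oD cD smD D0 nc; clear nc.
pose r := 1 - cabs z0; have r0 : 0 < r by rewrite subr_gt0.
have inD z : cabs z < 1 -> cabs (z0 + r%:C * z) < 1.
  move=> z1; apply: le_lt_trans (cabsD _ _) _; rewrite cabsM cabs_real gtr0_norm//.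
  have : r * cabs z < r * 1 by rewrite ltr_pM2l.
  rewrite /r; lra.
pose f (y : R[i]) := hdot (phi y) a - c%:C.
have fd (y : R[i]) (k : V) : is_derive y 1 phi k -> cdiff_at f y (hdot k a).
  move=> dk; apply/cdiff_atP.
  have := is_deriveB (is_derive_hdot a dk) (is_derive_cst (c%:C : R[i]) y (1 : R[i])).
  by rewrite subr0.
have dF z : cabs z < 1 -> derivable (fun w => f (z0 + r%:C * w)) z 1.
  move=> z1; have /cdiff_affine/cdiff_atP[h _] := fd _ _ (derivableP (dphi _ (inD _ z1))).
  exact: h.
have dF0 : cdiff_at (fun w => f (z0 + r%:C * w)) 0 (hdot l a * r%:C).
  by apply: cdiff_affine; rewrite mulr0 addr0; exact: fd.
have F0 z : cabs z < 1 -> 0 <= complex.Re (f (z0 + r%:C * z)).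
  move=> z1; rewrite /f cReD cReN /= subr_ge0.
  apply: (closure_rdot_ge (D := D)); last exact: phiD (inD _ z1).
  by move=> y /hD/ltW.
have := halfplane_schwarz dF dF0 F0.
rewrite mulr0 addr0 /f cReD cReN /= -[complex.Re (hdot _ _)]/(rdot _ _) cabsM cabs_real gtr0_norm// => S.
have : rdot (phi z0 + u *: l) a = rdot (phi z0) a + complex.Re (u * hdot l a).
  by rewrite rdotDl /rdot hdotZl.
have := Re_le_cabs (u * hdot l a); rewrite cabsM ler_norml => /andP[h1 _].
have : cabs u * cabs (hdot l a) <= r / 2 * cabs (hdot l a) by rewrite ler_wpM2r ?cabs_ge0.
lra.
Qed.

(** Every small [u] satisfies [0 <= Re (u * hdot l nu)]; so do its multiples by the
    fourth roots of unity, and the product vanishes. *)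
Lemma complex_tangent (p l nu : V) (r : R) : 0 < r ->
  (forall u : R[i], cabs u <= r -> rdot p nu <= rdot (p + u *: l) nu) -> hdot l nu = 0.
Proof.
move=> r0 h.
have {}h u : cabs u <= r -> 0 <= complex.Re (u * hdot l nu).
  by move=> /h; rewrite rdotDl lerDl /rdot hdotZl.
have c1 : cabs (r%:C : R[i]) <= r by rewrite cabs_real gtr0_norm.
have c2 : cabs (- r%:C : R[i]) <= r by rewrite cabsN.
have ci : cabs ('i : R[i]) = 1 by rewrite /cabs /= expr0n expr1n add0r sqrtr1.
have c3 : cabs (r%:C * 'i : R[i]) <= r by rewrite cabsM ci mulr1.
have c4 : cabs (- r%:C * 'i : R[i]) <= r by rewrite cabsM ci mulr1.
have := h _ c1; have := h _ c2; have := h _ c3; have := h _ c4.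
case: (hdot l nu) => x y; rewrite !(cReM, cImM, cReN, cImN) /=.
rewrite !(mul0r, mulr0, oppr0, subr0, addr0, sub0r, add0r, mulr1) => k1 k2 k3 k4.
have y0 : r * y = 0 by lra.
have x0 : r * x = 0 by lra.
have rn : r == 0 = false by rewrite gt_eqF.
move/eqP: x0; rewrite mulf_eq0 rn /= => /eqP ->.
by move/eqP: y0; rewrite mulf_eq0 rn /= => /eqP ->.
Qed.

Hypothesis bD : exists2 M : R, 0 < M & forall z, D z -> vnorm z <= M.

(** Let [rho] be nearly the largest radius of an affine disc in [closure D] with this
    centre and direction. A slightly larger disc has a point outside [closure D],
    and the segment towards it leaves [closure D] at a distance between [rho] and a
    little more than [rho]; this exit point is [p + e]. *)
Lemma nearly_maximal_disc (p l : V) (r : R) : 0 < r -> l != 0 ->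
  (forall u : R[i], cabs u <= r -> closure D (p + u *: l)) ->
  exists e : V, [/\ exists k : R[i], e = k *: l,
    forall u : R[i], cabs u <= 5 / 6 -> closure D (p + u *: e), closure D (p + e) &
    forall eps : R, 0 < eps -> ~ closure D (p + (1 + eps)%:C *: e)].
Proof.
move=> r0 l0 hr.
have [M M0 hM] := bD.
have clM x : closure D x -> vnorm x <= M + 1.
  move=> /closure_vecP/(_ 1 ltr01)[w w1 /hM h].
  have := vnormD (x + w) (- w); rewrite addrK vnormN; lra.
have clp : closure D p by have := hr 0; rewrite scale0r addr0 cabs0; apply; exact: ltW.
have nl : 0 < vnorm l by rewrite lt_neqAle vnorm_ge0 andbT eq_sym vnorm_eq0.
(* [rho] is at least 19/20 and [u0] at most 21/20 of the supremum of the radii. *)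
have [rho [u0 [rho0 disc u0b ncl]]] : exists (rho : R) (u0 : R[i]), [/\ 0 < rho,
    forall u : R[i], cabs u <= rho -> closure D (p + u *: l), cabs u0 <= 21 / 19 * rho &
    forall q, q = p + u0 *: l -> ~ closure D q].
  pose S := [set s : R | 0 <= s /\ forall u : R[i], cabs u <= s -> closure D (p + u *: l)].
  have Sr : S r by split; [exact: ltW|exact: hr].
  have Sub : ubound S ((M + 1 + vnorm p) / vnorm l).
    move=> s [s0 hs]; rewrite ler_pdivlMr//.
    have := clM _ (hs s%:C _); rewrite cabs_real ger0_norm// => /(_ (lexx _)) h.
    have := vnormD (p + s%:C *: l) (- p); rewrite [p + _]addrC addrK vnormN vnormZ cabs_real ger0_norm//.
    by rewrite [_ + p]addrC; lra.
  have hS : has_sup S by split; [exists r|exists ((M + 1 + vnorm p) / vnorm l)].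
  have [rs [rsr rs_ub rs_adh]] : exists rs : R, [/\ r <= rs, forall s, S s -> s <= rs &
      forall e, 0 < e -> exists2 s, S s & rs - e < s].
    exists (sup S); split.
    - exact: (ub_le_sup hS.2 Sr).
    - by move=> s; exact: (ub_le_sup hS.2).
    - by move=> e e0; exact: sup_adherent.
  have rs0 : 0 < rs by exact: lt_le_trans r0 rsr.
  have rs20 : 0 < rs / 20 by rewrite divr_gt0.
  have [rho [rho0 disc] hrho] := rs_adh _ rs20.
  have : ~ S (21 / 20 * rs) by move=> /rs_ub; lra.
  move=> nS; have [u0 hu0] : exists u0 : R[i], ~ (cabs u0 <= 21 / 20 * rs -> closure D (p + u0 *: l)).
    by apply/existsNP => h; apply: nS; split; [lra|exact: h].
  have [h1 h2] := (not_implyP _ _).1 hu0.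
  clear nS hu0; exists rho, u0; split; [clear h2; lra|exact: disc|clear h2; lra|by move=> _ ->; exact: h2].
have u0rho : rho < cabs u0.
  by rewrite ltNge; apply/negP => h; apply: (ncl _ erefl); exact: disc.
have cu0 : 0 < cabs u0 by lra.
have [pt ptE] : exists pt : R -> V, forall t, pt t = p + (t%:C * u0) *: l.
  by exists (fun t : R => p + (t%:C * u0) *: l).
have [t [t0 t1 clt t_ub]] : exists t : R, [/\ 0 < t, t <= 1, closure D (pt t) &
    forall s, 0 <= s <= 1 -> closure D (pt s) -> s <= t].
  pose T := [set t : R | 0 <= t <= 1 /\ closure D (pt t)].
  have Tr : T (rho / cabs u0).
    split.
      by apply/andP; split; [apply: divr_ge0; exact: ltW|rewrite ler_pdivrMr// mul1r ltW].
    rewrite ptE; apply: disc; rewrite cabsM cabs_real gtr0_norm ?divr_gt0//.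
    by rewrite divfK// gt_eqF.
  have Tub : ubound T 1 by move=> t [/andP[]].
  have hT : has_sup T by split; [exists (rho / cabs u0)|exists 1].
  have le1 : sup T <= 1 by apply: ge_sup; [exists (rho / cabs u0)|exact: Tub].
  have gt0 : 0 < sup T by apply: lt_le_trans (ub_le_sup hT.2 Tr); exact: divr_gt0.
  exists (sup T); split; [exact: gt0|exact: le1| |].
    have -> : closure D = closure (closure D) by apply/closure_id; exact: closed_closure.
    apply/closure_vecP => e e0.
    have K0 : 0 < cabs u0 * vnorm l + 1 by rewrite ltr_wpDl// mulr_ge0 ?cabs_ge0// ltW.
    have [t [t01 clt] ts] := sup_adherent (divr_gt0 e0 K0) hT.
    have tle := ub_le_sup hT.2 (conj t01 clt).
    exists (((t - sup T)%:C * u0) *: l); last first.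
      rewrite ptE -addrA -scalerDl -mulrDl -rmorphD /= [sup T + _]addrC subrK -ptE.
      exact: clt.
    rewrite vnormZ cabsM cabs_real distrC ger0_norm ?subr_ge0//.
    have h : (sup T - t) * (cabs u0 * vnorm l + 1) < e by rewrite -ltr_pdivlMr//; move: ts; lra.
    apply: le_lt_trans h; rewrite -mulrA ler_wpM2l ?subr_ge0// lerDl//.
  by move=> s s01 cls; exact: (ub_le_sup hT.2 (conj s01 cls)).
have t1' : t < 1.
  rewrite lt_neqAle t1 andbT; apply/eqP => E; apply: (ncl (pt t)); last exact: clt.
  by rewrite E ptE mul1r.
exists ((t%:C * u0) *: l); split.
- by exists (t%:C * u0).
- move=> u hu; rewrite scalerA; apply: disc; rewrite !cabsM cabs_real gtr0_norm//.
  have h1 : t * cabs u0 <= 1 * cabs u0 by rewrite ler_wpM2r ?cabs_ge0.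
  (* The factor [5 / 6] is small enough: [5 / 6 * (21 / 19) < 1]. *)
  apply: (@le_trans _ _ (5 / 6 * (21 / 19 * rho))); last lra.
  apply: ler_pM; [exact: cabs_ge0|exact: mulr_ge0 (ltW t0) (cabs_ge0 _)|exact: hu|].
  by apply: le_trans h1 _; rewrite mul1r.
- by rewrite -ptE.
- move=> eps eps0 cl.
  have {}cl : closure D (pt ((1 + eps) * t)) by rewrite ptE rmorphM -mulrA -scalerA.
  pose s := Num.min 1 ((1 + eps) * t).
  have et : 0 < eps * t by rewrite mulr_gt0.
  have st : t < s by rewrite lt_min t1' mulrDl mul1r ltrDl.
  have s1 : s <= 1 by rewrite ge_min lexx.
  have s2 : s <= (1 + eps) * t by rewrite ge_min lexx orbT.
  have k0 : 0 < (1 + eps) * t by rewrite mulr_gt0// addr_gt0.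
  have s01 : 0 <= s / ((1 + eps) * t) <= 1.
    apply/andP; split; last by rewrite ler_pdivrMr// mul1r.
    by apply: divr_ge0; apply: ltW => //; exact: lt_trans t0 st.
  have := closure_convex clp cl s01.
  have -> : (1 - s / ((1 + eps) * t))%:C *: p + (s / ((1 + eps) * t))%:C *: pt ((1 + eps) * t) = pt s.
    rewrite !ptE scalerDr addrA -scalerDl -rmorphD /= subrK scale1r scalerA mulrA -rmorphM /=.
    by rewrite divfK// gt_eqF.
  move=> cls; have s0 : 0 <= s <= 1 by rewrite s1 ltW// (lt_trans t0 st).
  by have := t_ub s s0 cls; rewrite leNgt st.
Qed.

(** At a point of the analytic disc where the derivative is not zero, the tangent disc
    lies in [closure D]; hence its direction is complex tangent and the supporting
    hyperplane at [xi] contains the whole disc. The exit point [xi + e] of a nearly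
    maximal disc lies on the same hyperplane, so it is a boundary point with the
    same unique normal. *)
Lemma boundary_face : contains_analytic_disc (boundary D) ->
  exists (xi e nu : V) (r : R), [/\ inner_ball D xi nu r, inner_ball D (xi + e) nu r,
    hdot e nu = 0,
    (forall z, D z -> rdot xi nu < rdot z nu) &
    [/\ forall u : R[i], cabs u <= 5 / 6 -> closure D (xi + u *: e),
      closure D (xi + e) & forall eps : R, 0 < eps -> ~ closure D (xi + (1 + eps)%:C *: e)]].
Proof.
move=> [phi [dphi phiD [z [w [z1 w1 zw]]]]].
rewrite !unit_discE in z1 w1.
have {}dphi y : cabs y < 1 -> derivable phi y 1 by move=> y1; apply: dphi; rewrite unit_discE.
have {}phiD y : cabs y < 1 -> boundary D (phi y) by move=> y1; apply: phiD; exists y => //; rewrite unit_discE.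
have [z0 [l [z01 l0 dl]]] := nonconstant_derivative dphi z1 w1 zw.
pose xi := phi z0.
have clphi y : cabs y < 1 -> closure D (phi y) by move=> /phiD[].
have [clxi nDxi] := phiD _ z01; rewrite (interior_id _).1// in nDxi.
have r0 : 0 < (1 - cabs z0) / 2 by rewrite divr_gt0// subr_gt0.
have disc := tangent_disc_closure dphi clphi z01 dl.
have [nu [r [ib sup]]] := boundary_support oD cD smD clxi nDxi.
have sup' x : closure D x -> rdot xi nu <= rdot x nu.
  by apply: closure_rdot_ge => y /sup/ltW.
have lnu : hdot l nu = 0 by apply: complex_tangent r0 _ => u /disc; exact: sup'.
have [e [[k ek] e1 e2 e3]] := nearly_maximal_disc r0 l0 disc.
have enu : hdot e nu = 0 by rewrite ek hdotZl lnu mulr0.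
have eta_nu : rdot (xi + e) nu = rdot xi nu by rewrite rdotDl [rdot e nu]/rdot enu addr0.
have nDeta : ~ D (xi + e) by move=> /sup; rewrite eta_nu ltxx.
have [nu' [r' [ib' _]]] := boundary_support oD cD smD e2 nDeta.
have [_ nu1 _] := ib.
have nuE : nu' = nu.
  by apply: inner_ball_normal_unique ib' nu1 _ => y /sup/ltW; rewrite eta_nu.
rewrite {nu'}nuE in ib'.
have shrink x s s' : inner_ball D x nu s -> 0 < s' -> s' <= s -> inner_ball D x nu s'.
  move=> [s0 _ hs] s'0 ss; split=> // v hv; apply: hs.
  have pos : 0 < 2 * s' * rdot v nu := le_lt_trans (esq_ge0 v) hv.
  apply: (lt_le_trans hv).
  have : 0 < rdot v nu by move: pos; rewrite pmulr_rgt0// mulr_gt0.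
  by move=> p; rewrite ler_pM2r// ler_pM2l.
have [rr0 _ _] := ib; have [rr0' _ _] := ib'.
exists xi, e, nu, (Num.min r r'); split; [| |exact: enu|exact: sup|by split].
- by apply: shrink ib _ _; [rewrite lt_min rr0|rewrite ge_min lexx].
- by apply: shrink ib' _ _; [rewrite lt_min rr0|rewrite ge_min lexx orbT].
Qed.

End Face.
End AnalyticDisc.

(** * Estimates near the boundary *)

Section BoundaryEstimates.
Variables (R : realType) (n : nat).
Local Notation V := 'rV[R[i]]_n.
Variable D : set V.
Hypotheses (oD : open D) (cD : convex D).
Local Notation d := (kobayashi_dist D).

Lemma inner_ball_normal xi nu (r t : R) : inner_ball D xi nu r -> 0 < t < 2 * r -> D (xi + t%:C *: nu).
Proof.
move=> [r0 nu1 hD] /andP[t0 tr]; apply: hD.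
rewrite esqZ cabs_real gtr0_norm// rdotZl -[rdot nu nu]/(esq nu) nu1 !mulr1 expr2.
by rewrite ltr_pM2r.
Qed.

(** The round disc in the complex normal line at [xi] is twice as good as the affine
    disc of radius [t]: the leading term is the Poincare metric of a half-plane. *)
Lemma kob_normal xi nu (r t : R) : inner_ball D xi nu r -> 0 < t <= r ->
  kob D (xi + t%:C *: nu) nu <= 2^-1 * t^-1 + (2 * r)^-1.
Proof.
move=> ib /andP[t0 tr]; have [r0 nu1 hD] := ib.
apply: (@le_trans _ _ (2 * t - t ^+ 2 / r)^-1).
  apply: kob_le; apply: admissible_round; first by rewrite t0; lra.
  move=> z hz; apply: hD; rewrite esqZ nu1 mulr1.
  have -> : rdot (z *: nu) nu = complex.Re z.
    rewrite /rdot hdotZl (_ : hdot nu nu = 1); first by rewrite mulr1.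
    have : complex.Im (hdot nu nu) = - complex.Im (hdot nu nu).
      by rewrite [in LHS]hdotC; case: (hdot nu nu).
    have : complex.Re (hdot nu nu) = 1 := nu1.
    by case: (hdot nu nu) => a b /= -> h; have -> : b = 0 by lra.
  have : cabs (z - r%:C) ^+ 2 < r ^+ 2 by rewrite ltr_pXn2r ?nnegrE ?cabs_ge0 ?ltW.
  by rewrite !sqr_cabs; case: (z) => x y /=; rewrite subr0; lra.
have den : 2 * t - t ^+ 2 / r = t * (2 - t / r) by field; rewrite gt_eqF.
have tr1 : t / r <= 1 by rewrite ler_pdivrMr// mul1r.
have tr0 : 0 < t / r by rewrite divr_gt0.
have k0 : 0 < t * (2 - t / r) by rewrite mulr_gt0//; lra.
rewrite den -[leLHS]mul1r ler_pdivrMr//.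
have -> : (2^-1 * t^-1 + (2 * r)^-1) * (t * (2 - t / r)) = 1 + (t / r - (t / r) ^+ 2) / 2.
  by field; rewrite !gt_eqF.
have : (t / r) ^+ 2 <= t / r by rewrite expr2 -[leRHS]mulr1 ler_wpM2l// ltW.
lra.
Qed.

(** Integrating [kob_normal]; the error term has a bounded integral. *)
Lemma dist_normal xi nu (r s t : R) : inner_ball D xi nu r -> 0 < s -> s <= t -> t <= r ->
  d (xi + s%:C *: nu) (xi + t%:C *: nu) <= 2^-1 * ln t - 2^-1 * ln s + 2^-1.
Proof.
move=> ib s0 st tr; have [r0 _ _] := ib.
have Ds : D (xi + s%:C *: nu) by apply: inner_ball_normal ib _; lra.
have Dt : D (xi + t%:C *: nu) by apply: inner_ball_normal ib _; lra.
have [G [G' [dG cG GE G'E GD]]] := curve_bound_segment cD Ds Dt.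
pose q (v : R) := s + (t - s) * v.
have diff : xi + t%:C *: nu - (xi + s%:C *: nu) = (t - s)%:C *: nu.
  by rewrite opprD addrACA subrr add0r rmorphB scalerBl.
have GE' v : complexify (G v) = xi + (q v)%:C *: nu.
  by rewrite GE diff scalerA -rmorphM -addrA -scalerDl -rmorphD /= /q [v * _]mulrC.
have q0 v : 0 <= v <= 1 -> 0 < q v <= r.
  move=> /andP[v0 v1]; have a0 : 0 <= (t - s) * v by rewrite mulr_ge0// subr_ge0.
  have a1 : (t - s) * v <= (t - s) * 1 by rewrite ler_wpM2l// subr_ge0.
  by rewrite /q; lra.
have dq (v : R) : is_derive v (1 : R) q (t - s).
  have := is_deriveD (is_derive_cst s v (1 : R)) (is_deriveZ (t - s) (is_derive_id v (1 : R))).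
  by rewrite add0r -[_ *: _]/(_ * _) mulr1.
pose h (v : R) := 2^-1 * ln (q v) + (2 * r)^-1 * q v.
have B : curve_bound D (xi + s%:C *: nu) (xi + t%:C *: nu) G G' h
    (fun v => 2^-1 * ((t - s) * (q v)^-1) + (2 * r)^-1 * (t - s)).
  split; [exact: dG|exact: cG|exact: GD| |].
    by rewrite !GE scale0r addr0 scale1r [xi + s%:C *: nu + _]addrC subrK.
  move=> v hv; have /andP[qv qr] := q0 v hv; split.
    exact: (is_deriveD (is_deriveZ 2^-1 (is_derive_comp (dq v) (is_derive1_ln qv)))
      (is_deriveZ (2 * r)^-1 (dq v))).
  rewrite GE' G'E diff; have ts0 : 0 <= t - s by rewrite subr_ge0.
  have Dv : D (xi + (q v)%:C *: nu) by rewrite -GE'; exact: GD.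
  apply: le_trans (kobZ oD _ _ Dv) _; rewrite (ger0_norm ts0).
  have := ler_wpM2l ts0 (kob_normal ib (q0 v hv)); lra.
have := dist_le_bound oD cD B; rewrite /h /q mulr1 mulr0 addr0 [s + _]addrC subrK.
have : (2 * r)^-1 * (t - s) <= 2^-1.
  rewrite invfM -mulrA -[leRHS]mulr1 ler_pM2l// mulrC ler_pdivrMr//; lra.
lra.
Qed.

(** In the direction [e] there are discs of radius [3 / 4] at the height [t] above [xi],
    by convexity, and of radius [beta] of order [sqrt t] above [xi + e], inside the
    tangent ball. By convexity the radius decreases at most linearly in between, and
    the integral of its inverse is a multiple of [- ln beta] close to [4 / 3]. The
    height of the end points is [- ln t / 2], so the factor is less than 2, as
    needed in [fellow_travel]. *)
Lemma dist_across xi e nu (r t beta : R) : inner_ball D xi nu r -> inner_ball D (xi + e) nu r ->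
  hdot e nu = 0 -> (forall u : R[i], cabs u <= 5 / 6 -> closure D (xi + u *: e)) ->
  0 < esq e -> 0 < t <= r / 10 -> 0 < beta <= 1 / 12 -> beta ^+ 2 * esq e <= r * t ->
  d (xi + t%:C *: nu) (xi + e + t%:C *: nu) <= 3 / 2 * (- ln beta).
Proof.
move=> ib ib' enu face E0 /andP[t0 tr] /andP[b0 b1] bt.
have [r0 nu1 hD] := ib; have [_ _ hD'] := ib'.
have Dx : D (xi + t%:C *: nu) by apply: inner_ball_normal ib _; lra.
have Dy : D (xi + e + t%:C *: nu) by apply: inner_ball_normal ib' _; lra.
have near_xi (u : R[i]) : cabs u < 3 / 4 -> D (xi + t%:C *: nu + u *: e).
  move=> hu; pose s := t / r.
  have s0 : 0 < s by rewrite divr_gt0.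
  have s1 : s <= 1 / 10 by rewrite ler_pdivrMr//; lra.
  have s10 : 0 < 1 - s by lra.
  have Dr : D (xi + r%:C *: nu) by apply: inner_ball_normal ib _; lra.
  have cl : closure D (xi + ((1 - s)^-1%:C * u) *: e).
    apply: face; rewrite cabsM cabs_real gtr0_norm ?invr_gt0// mulrC ler_pdivrMr//; lra.
  have s01 : 0 < s <= 1 by lra.
  have := closure_convex_interior oD cD cl Dr s01.
  have sr : s * r = t by rewrite /s divfK// gt_eqF.
  rewrite !scalerDr !scalerA mulrA -!rmorphM /= mulfV ?gt_eqF// mul1r sr addrACA.
  rewrite -[X in X + _]scalerDl -rmorphD /= subrK scale1r [u *: e + _]addrC addrA.
  exact.
have near_eta (u : R[i]) : cabs u < beta -> D (xi + e + t%:C *: nu + u *: e).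
  move=> hu; rewrite -addrA; apply: hD'.
  have ort : rdot (u *: e) nu = 0 by rewrite /rdot hdotZl enu mulr0.
  rewrite rdotDl ort addr0 rdotZl -[rdot nu nu]/(esq nu) nu1 mulr1.
  rewrite esqD esqZ cabs_real gtr0_norm// nu1 rdotZl [rdot nu _]rdotC ort esqZ mulr0 mulr0.
  have : cabs u ^+ 2 * esq e < beta ^+ 2 * esq e.
    by rewrite ltr_pM2r// ltr_pXn2r ?nnegrE ?cabs_ge0 ?ltW.
  have : t ^+ 2 <= r * t by rewrite expr2 ler_pM2r//; lra.
  lra.
pose q (s : R) := 3 / 4 - (3 / 4 - beta) * s.
have q0 s : 0 <= s <= 1 -> 0 < q s.
  move=> /andP[s0 s1]; have k : 0 <= 3 / 4 - beta by lra.
  have := ler_wpM2l k s1; rewrite /q; lra.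
have [G [G' [dG cG GE G'E GD]]] := curve_bound_segment cD Dx Dy.
have diff : xi + e + t%:C *: nu - (xi + t%:C *: nu) = e.
  by rewrite opprD addrACA subrr addr0 addrC addKr.
pose k := 3 / 4 - beta; have k0 : 2 / 3 <= k by rewrite /k; lra.
have kn : k != 0 by rewrite gt_eqF//; lra.
have dq (s : R) : is_derive s (1 : R) q (- k).
  have := is_deriveB (is_derive_cst (3 / 4 : R) s (1 : R)) (is_deriveZ k (is_derive_id s (1 : R))).
  by rewrite sub0r -[_ *: _]/(_ * _) mulr1.
have B : curve_bound D (xi + t%:C *: nu) (xi + e + t%:C *: nu) G G'
    (fun s => - k^-1 * ln (q s)) (fun s => (q s)^-1).
  split; [exact: dG|exact: cG|exact: GD| |].
    by rewrite !GE diff scale0r addr0 scale1r addrAC.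
  move=> s hs; have qs := q0 s hs; split.
    have := is_deriveZ (- k^-1) (is_derive_comp (dq s) (is_derive1_ln qs)).
    by rewrite -![_ *: _]/(_ * _) mulrA mulrNN mulVf// mul1r.
  rewrite GE G'E diff; apply: kob_affine => // u hu.
  have scaled (rho : R) : 0 < rho -> cabs ((rho / q s)%:C * u) < rho.
    move=> rho0; rewrite cabsM cabs_real gtr0_norm ?divr_gt0//.
    by rewrite mulrAC ltr_pdivrMr// ltr_pM2l.
  have A1 : cabs ((3 / 4 / q s)%:C * u) < 3 / 4 by apply: scaled; lra.
  have A2 : cabs ((beta / q s)%:C * u) < beta by exact: scaled.
  (* The disc of radius [q s] is the convex combination of the discs at the two ends. *)
  have uE : u = (s%:C * (beta / q s)%:C + (1 - s)%:C * (3 / 4 / q s)%:C) * u.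
    rewrite -!rmorphM -rmorphD /=.
    have -> : s * (beta / q s) + (1 - s) * (3 / 4 / q s) = q s / q s by rewrite /q; ring.
    by rewrite divff ?mul1r// gt_eqF.
  have Ex : s%:C *: (xi + e + t%:C *: nu + ((beta / q s)%:C * u) *: e) +
      (1 - s)%:C *: (xi + t%:C *: nu + ((3 / 4 / q s)%:C * u) *: e) =
      xi + t%:C *: nu + s%:C *: e + u *: e.
    apply/rowP => j; rewrite !mxE [in RHS]uE rmorphB /=.
    by rewrite -[1%:C]/(1 : R[i]); ring.
  rewrite -Ex; have /convexP := cD; apply; first exact: hs.
    exact: near_eta.
  exact: near_xi.
have := dist_le_bound oD cD B; rewrite /q mulr1 mulr0 subr0 subKr -/k => H.
apply: le_trans H _.
have l1 : ln (3 / 4 : R) <= 0 by rewrite ln_le0//; lra.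
have l2 : ln beta <= 0 by rewrite ln_le0//; lra.
have ki : k^-1 <= 3 / 2.
  rewrite -[leLHS]mul1r ler_pdivrMr; last lra.
  lra.
have ki0 : 0 <= k^-1 by rewrite invr_ge0; lra.
have : k^-1 * (- ln beta) <= 3 / 2 * (- ln beta) by rewrite ler_wpM2r// oppr_ge0.
have : 0 <= k^-1 * (- ln (3 / 4)) by rewrite mulr_ge0// oppr_ge0.
lra.
Qed.

(** A half-space that cuts off a point just beyond [xi + e] is nearly tangent at
    [xi + e], so the two normals separate. *)
Lemma dist_across_unbounded xi e nu (r M : R) : D !=set0 -> smooth_boundary D ->
  inner_ball D xi nu r -> inner_ball D (xi + e) nu r ->
  closure D xi -> closure D (xi + e) ->
  (forall eps : R, 0 < eps -> ~ closure D (xi + (1 + eps)%:C *: e)) ->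
  exists2 t0 : R, 0 < t0 & forall t, 0 < t <= t0 ->
    M < d (xi + t%:C *: nu) (xi + e + t%:C *: nu).
Proof.
move=> D0 smD ib ib' clx cly beyond.
have [r0 _ _] := ib.
(* For small [t] the distances of the two points to the hyperplane have a ratio of at
   most [4 * eps], so that half of its logarithm is at most [- M - 1]. *)
pose eps := expR (- 2 * M - 2) / 4.
have eps0 : 0 < eps by rewrite divr_gt0// expR_gt0.
have [a [c [hD hc]]] := closure_separation oD cD smD D0 (beyond _ eps0).
clear beyond.
have hDw z : D z -> c <= rdot z a by move=> /hD/ltW.
pose m z := rdot z a - c.
have mx : 0 <= m xi by rewrite subr_ge0; exact: (closure_rdot_ge hDw clx).
have my : 0 <= m (xi + e) by rewrite subr_ge0; exact: (closure_rdot_ge hDw cly).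
have my_lt : m (xi + e) < eps * m xi.
  have : m (xi + e) + eps * m (xi + e) < eps * m xi.
    by move: hc; rewrite /m !rdotDl rdotZl; lra.
  by have := mulr_ge0 (ltW eps0) my; lra.
have mx0 : 0 < m xi by rewrite -(pmulr_rgt0 _ eps0); exact: le_lt_trans my my_lt.
pose K := `|rdot nu a| + 1; have K0 : 0 < K by rewrite ltr_wpDl.
pose tau := Num.min (eps * m xi) (m xi / 2) / K.
have tau0 : 0 < tau by rewrite divr_gt0// lt_min mulr_gt0// divr_gt0.
exists (Num.min tau r); first by rewrite lt_min tau0 r0.
move=> t /andP[t0]; rewrite le_min => /andP[ttau tr].
have tK : t * K <= Num.min (eps * m xi) (m xi / 2) by rewrite -ler_pdivlMr.
have [t1 t2] : t * K <= eps * m xi /\ t * K <= m xi / 2.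
  by move: tK; rewrite le_min => /andP[].
have tn : `|t * rdot nu a| <= t * K.
  by rewrite normrM gtr0_norm// ler_pM2l// lerDl.
have Dx : D (xi + t%:C *: nu) by apply: inner_ball_normal ib _; lra.
have Dy : D (xi + e + t%:C *: nu) by apply: inner_ball_normal ib' _; lra.
apply: lt_le_trans (dist_log_lb oD cD hD Dx Dy).
have mxt : m xi / 2 <= rdot (xi + t%:C *: nu) a - c.
  by rewrite rdotDl rdotZl; move: tn; rewrite ler_norml; move: t2; rewrite /m; lra.
have myt : rdot (xi + e + t%:C *: nu) a - c <= 2 * eps * m xi.
  rewrite [rdot (xi + e + _) _]rdotDl rdotZl.
  by move: tn my_lt t1; rewrite ler_norml /m; lra.
have py : 0 < rdot (xi + e + t%:C *: nu) a - c by rewrite subr_gt0 hD.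
have m2 : 0 < m xi / 2 by rewrite divr_gt0.
have e2 : 0 < 2 * eps * m xi by apply: (mulr_gt0 (mulr_gt0 _ eps0) mx0).
have L1 : ln (m xi / 2) <= ln (rdot (xi + t%:C *: nu) a - c).
  by rewrite ler_ln// posrE; exact: lt_le_trans m2 mxt.
have L2 : ln (rdot (xi + e + t%:C *: nu) a - c) <= ln (2 * eps * m xi) by rewrite ler_ln// posrE.
have E : 2 * eps * m xi = expR (- 2 * M - 2) * (m xi / 2) by rewrite /eps; field.
have L3 : ln (2 * eps * m xi) = - 2 * M - 2 + ln (m xi / 2).
  by rewrite E lnM ?posrE ?expR_gt0// expRK.
lra.
Qed.

End BoundaryEstimates.

(** * Failure of hyperbolicity *)

Theorem theorem1p1 (R : realType) (n : nat) (D : set 'rV[R[i]]_n)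
  (hdom : domain D) (hbnd : bounded_set D)
  (hconv : convex D)
  (hsmooth : smooth_boundary D)
  (hdisc : contains_analytic_disc (boundary D)) :
  ~ gromov_hyperbolic D (kobayashi_dist D).
Proof.
move=> [delta delta0 thin].
have [oD _ D0] := hdom; have bD := bounded_vecP hbnd.
have supp x : closure D x -> ~ D x -> exists a, forall z, D z -> rdot x a < rdot z a.
  by move=> clx nDx; have [nu [r [_ h]]] := boundary_support oD hconv hsmooth clx nDx; exists nu.
have geod x y := @kobayashi_geodesic R n D oD hconv bD supp x y.
have [xi [e [nu [r [ib ib' enu sup [face cly beyond]]]]]] :=
  boundary_face oD hconv D0 hsmooth bD hdisc.
have [r0 nu1 _] := ib.
have clx : closure D xi.
  by have := face 0; rewrite scale0r addr0 cabs0; apply; rewrite divr_ge0.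
have E0 : 0 < esq e.
  rewrite lt_neqAle esq_ge0 andbT eq_sym; apply/eqP => /esq_eq0 e0.
  by apply: (beyond 1 ltr01); rewrite e0 scaler0 addr0.
have unb M := dist_across_unbounded oD hconv M D0 hsmooth ib ib' clx cly beyond.
clear beyond.
(* [beta0] and [t0] are linked so that the disc of radius [beta0] in the
   direction [e] fits at the height [t0] above [xi + e]. *)
pose beta0 : R := Num.min (1 / 12) (r / (4 * (esq e + 1))).
have E1 : 0 < 4 * (esq e + 1) by rewrite mulr_gt0// ltr_wpDl// ltW.
have b0 : 0 < beta0 by rewrite lt_min !divr_gt0.
have b1 : beta0 <= 1 / 12 by rewrite ge_min lexx.
have b2 : beta0 * (4 * (esq e + 1)) <= r by rewrite -ler_pdivlMr// ge_min lexx orbT.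
clearbody beta0.
pose t0 := beta0 ^+ 2 * esq e / r.
have t0E : r * t0 = beta0 ^+ 2 * esq e by rewrite /t0 mulrC divfK// gt_eqF.
have t00 : 0 < t0 by rewrite divr_gt0// mulr_gt0// exprn_gt0.
have t0r : t0 <= r / 10.
  rewrite -(ler_pM2l r0) t0E.
  have h1 : (beta0 * (4 * (esq e + 1))) ^+ 2 <= r ^+ 2.
    by rewrite ler_pXn2r ?nnegrE ?(ltW (mulr_gt0 b0 E1)) ?(ltW r0).
  have h2 : 10 * (beta0 ^+ 2 * esq e) <= (beta0 * (4 * (esq e + 1))) ^+ 2.
    rewrite exprMn mulrCA; apply: ler_wpM2l; first exact: sqr_ge0.
    have := sqr_ge0 (esq e); move: (esq e) E0 => E E0; lra.
  move: h1 h2; rewrite (expr2 r); lra.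
clearbody t0.
pose tt (U : R) := t0 * expR (- 2 * U).
have tt0 U : 0 < tt U by rewrite mulr_gt0// expR_gt0.
have tt_le U W : U <= W -> tt W <= tt U by move=> UW; rewrite ler_pM2l// ler_expR; lra.
have tt_t0 U : 0 <= U -> tt U <= t0.
  by move=> U0; rewrite -[leRHS]mulr1 ler_pM2l// expR_le1; lra.
have lntt U : ln (tt U) = ln t0 - 2 * U.
  by rewrite lnM ?posrE ?expR_gt0// expRK mulNr.
pose c := rdot xi nu.
pose b z := 2^-1 * ln t0 - 2^-1 * ln (rdot z nu - c).
have b_lip x y : D x -> D y -> b x - b y <= kobayashi_dist D x y.
  move=> Dx Dy; rewrite (dist_sym oD hconv Dx Dy).
  by have := dist_log_lb oD hconv sup Dy Dx; rewrite -/c /b; lra.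
pose x U := xi + (tt U)%:C *: nu; pose y U := xi + e + (tt U)%:C *: nu.
have hgt U : rdot (x U) nu - c = tt U /\ rdot (y U) nu - c = tt U.
  rewrite /x /y !rdotDl rdotZl [rdot e nu]/rdot enu -[rdot nu nu]/(esq nu) nu1 mulr1 addr0.
  by rewrite addrC addKr.
have xy U : 0 <= U -> [/\ D (x U), D (y U), b (x U) = U & b (y U) = U].
  move=> U0; have tU : 0 < tt U < 2 * r by rewrite tt0 (le_lt_trans (tt_t0 _ U0))//; lra.
  have [hx hy] := hgt U; rewrite /b hx hy lntt.
  by split; [exact: inner_ball_normal ib tU|exact: inner_ball_normal ib' tU|lra|lra].
pose C := 2^-1 + 3 / 2 * (- ln beta0).
have lb0 : 0 <= - ln beta0 by rewrite oppr_ge0 ln_le0//; lra.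
have up U W : 0 <= U <= W -> kobayashi_dist D (x U) (x W) <= W - U + C /\
    kobayashi_dist D (y U) (y W) <= W - U + C.
  move=> /andP[U0 UW]; have W0 : 0 <= W by exact: le_trans U0 UW.
  have [xU yU _ _] := xy U U0; have [xW yW _ _] := xy W W0.
  have tUr : tt U <= r by have := tt_t0 _ U0; lra.
  rewrite (dist_sym oD hconv xU xW) (dist_sym oD hconv yU yW).
  have := dist_normal oD hconv ib (tt0 W) (tt_le _ _ UW) tUr.
  have := dist_normal oD hconv ib' (tt0 W) (tt_le _ _ UW) tUr.
  by rewrite !lntt -!/(x _) -!/(y _) /C; split; lra.
have across U : 0 <= U -> kobayashi_dist D (x U) (y U) <= 3 / 2 * U + C.
  move=> U0; pose beta := beta0 * expR (- U).
  have be0 : 0 < beta by rewrite mulr_gt0// expR_gt0.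
  have be1 : beta <= beta0 by rewrite -[leRHS]mulr1 ler_pM2l// expR_le1 oppr_le0.
  have tU : 0 < tt U <= r / 10 by rewrite tt0 (le_trans (tt_t0 _ U0)).
  have be12 : 0 < beta <= 1 / 12 by rewrite be0 (le_trans be1).
  have be2 : beta ^+ 2 * esq e <= r * tt U.
    rewrite /beta /tt exprMn mulrA t0E -expRM_natl mulNr mulrN mulrAC.
    by rewrite le_eqVlt eqxx.
  have := dist_across oD hconv ib ib' enu face E0 tU be12 be2.
  rewrite /beta lnM ?posrE ?expR_gt0// expRK -/(x U) -/(y U) /C; lra.
have lam : 0 <= (3 / 2 : R) < 2 by lra.
have [M hM] := fellow_travel (kobayashi_metric_on oD hconv) thin geod b_lip lam xy up across.
have [tau tau0 htau] := unb M.
pose U : R := Num.max 0 (2^-1 * (ln t0 - ln tau)).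
have U0 : 0 <= U by rewrite le_max lexx.
have U1 : 2^-1 * (ln t0 - ln tau) <= U by rewrite le_max lexx orbT.
have tUtau : 0 < tt U <= tau by rewrite tt0 -ler_ln ?posrE// lntt; lra.
by have := htau _ tUtau; rewrite -/(x U) -/(y U) ltNge hM.
Qed.
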